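(* Let $q\in W_2^{-1}[-b,b]$ be complex valued. Let $K$ be the transmutation kernel, let $\varphi_k$ ($k\ge 0$) be the formal powers, and let $u(\omega,x)$ be the solution of $y''-q(x)y=-\omega^2y$ satisfying $u(\omega,0)=1$, $u'(\omega,0)=i\omega$ (all as described in the context). Let $H_n(x)=\sum_{k=0}^{n}h_{k,n}x^k$ be the Hermite polynomial of order $n$, and consider the extension of the transmutation kernel $$\widetilde K(x,y):=\begin{cases}K(x,y), & \text{when } x\in[-b,b] \text{ and } y\in[-x,x],\\ 0, & \text{otherwise.}\end{cases}$$ Then the following hold. (i) $\widetilde K$ has the series expansion $$\widetilde K(x,y)=\sum_{n=0}^{\infty}c_n(x)H_n(y)e^{-y^2},$$ whose coefficients satisfy $$\int_{-\infty}^{\infty}\widetilde K(x,y)H_n(y)\,dy=\sqrt{\pi}\,n!\,2^n c_n(x)$$ and hence are given by $$c_n(x)=\frac{1}{\sqrt{\pi}\,n!\,2^n}\int_{-x}^{x}K(x,y)H_n(y)\,dy=\frac{1}{\sqrt{\pi}\,n!\,2^n}\sum_{k=0}^{n}h_{k,n}\left(\varphi_k(x)-x^k\right).$$ (ii) The solution $u(\omega,x)$ has the representation $$u(\omega,x)=e^{i\omega x}+\int_{-\infty}^{\infty}\widetilde K(x,y)e^{i\omega y}\,dy=e^{i\omega x}+\sum_{n=0}^{\infty}c_n(x)\int_{-\infty}^{\infty}H_n(y)e^{i\omega y}e^{-y^2}\,dy=e^{i\omega x}+\sqrt{\pi}\,e^{-\frac{\omega^2}{4}}\sum_{n=0}^{\infty}c_n(x)(i\omega)^n.$$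 (iii) For the partial sum $$u_N(\omega,x)=e^{i\omega x}+\sqrt{\pi}\,e^{-\frac{\omega^2}{4}}\sum_{n=0}^{N}c_n(x)(i\omega)^n$$ one has $$\left|u(\omega,x)-u_N(\omega,x)\right|\le \pi^{\frac14}e^{\frac{(\operatorname{Im}\omega)^2}{2}}\varepsilon_N(x),$$ where $\varepsilon_N(x)$ is a nonnegative function independent of $\omega$. This means that the truncation error is uniformly bounded in any strip $|\operatorname{Im}\omega|\le C$.
   Context: The assumption $q\in W_2^{-1}[-b,b]$ allows $q$ to be, for example, piecewise continuous or to have a singularity such as $q(x)\sim c/x$. Transmutation kernel: $K$ is the kernel of the transmutation (transformation) operator, the Volterra integral operator $$Tv(x)=v(x)+\int_{-x}^{x}K(x,t)v(t)\,dt.$$ When $q\in C[-b,b]$, it is defined on $C[-b,b]$ and satisfies $\left(\frac{d^2}{dx^2}-q(x)\right)Tv=T[v'']$ for every $v\in C^2[-b,b]$. For $q\in W_2^{-1}[-b,b]$ the kernel $K(x,t)$ is an $L_2$-function. The kernel is such that $$u(\omega,x)=e^{i\omega x}+\int_{-x}^{x}K(x,t)e^{i\omega t}\,dt,$$ where $u(\omega,x)$ is the solution of $y''-q(x)y=-\omega^2y$ with $u(\omega,0)=1$, $u'(\omega,0)=i\omega$. Formal powers: let $f$ be a solution of $f''-q(x)f=0$, $x\in[-b,b]$, with $f(0)=1$, $f'(0)=0$. Set $X^{(0)}\equiv 1$, $\widetilde X^{(0)}\equiv 1$ and, for $n\ge 1$, $$X^{(n)}(x)=n\int_0^xX^{(n-1)}(s)\left(f^2(s)\right)^{(-1)^n}ds,\qquad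 \widetilde X^{(n)}(x)=n\int_0^x\widetilde X^{(n-1)}(s)\left(f^2(s)\right)^{(-1)^{n-1}}ds.$$ Then $\varphi_k=fX^{(k)}$ for $k$ odd and $\varphi_k=f\widetilde X^{(k)}$ for $k$ even. The Hermite polynomials are those orthogonal on $\mathbb{R}$ with weight $e^{-y^2}$ and normalized by $\int_{-\infty}^{\infty}H_n(y)^2e^{-y^2}\,dy=\sqrt{\pi}\,n!\,2^n$.
   Formalization: For x<0 the extended kernel is taken as -K(x,y) on y in [x,-x], since the literal definition makes (ii) false there with oriented integrals; the formula for c_n by formal powers assumes f has no zero on [-b,b], as otherwise 1/f^2 is not integrable. *)

(* Defs.v *)
From HB Require Import structures.
From mathcomp Require Import all_boot all_order all_algebra complex.
From mathcomp Require Import all_classical all_reals all_analysis.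

Set Implicit Arguments.
Unset Strict Implicit.
Unset Printing Implicit Defensive.

Import Order.TTheory GRing.Theory Num.Theory.
Import numFieldNormedType.Exports.

Local Open Scope classical_set_scope.
Local Open Scope ring_scope.
Local Open Scope complex_scope.

Section ComplexAnalysis.
Context {R : realType}.
Local Notation mu := (@lebesgue_measure R).
Local Notation C := (R[i]).

Definition cexp (z : C) : C :=
  (expR (complex.Re z))%:C * (cos (complex.Im z) +i* sin (complex.Im z)).

Definition cintegrable (A : set R) (g : R -> C) : Prop :=
  mu.-integrable A (EFin \o (@complex.Re R \o g)) /\
  mu.-integrable A (EFin \o (@complex.Im R \o g)).

Definition cintegral (A : set R) (g : R -> C) : C :=
  (\int[mu]_(x in A) complex.Re (g x)) +i* (\int[mu]_(x in A) complex.Im (g x)).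

(* Oriented integral: [ointegral a c g = - ointegral c a g]. *)
Definition ointegral (a c : R) (g : R -> C) : C :=
  if a <= c then cintegral `[a, c] g else - cintegral `[c, a] g.

Definition square_integrable (A : set R) (g : R -> C) : Prop :=
  [/\ measurable_fun A (@complex.Re R \o g),
      measurable_fun A (@complex.Im R \o g) &
      (\int[mu]_(x in A) ((Normc.normc (g x)) ^+ 2)%:E < +oo)%E].

(* Convergence in C; [R[i]^o] is C with its usual topology. *)
Definition ccvg (s : nat -> C) (l : C) : Prop :=
  (s : nat -> R[i]^o) @ \oo --> (l : R[i]^o).

End ComplexAnalysis.

Section Potential.
Context {R : realType}.
Local Notation C := (R[i]).

Definition test_function (b : R) (phi : R -> R) : Prop :=
  (forall n x, derivable (derive1n n phi) x 1) /\
  (exists2 a, a < b & forall x, a < `|x| -> phi x = 0).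

(* W_2^{-1}[-b,b] consists of the distributions q = Q' with Q in L_2(-b,b).
   Q is determined by q, as an element of L_2, up to an additive constant. *)
Definition W2m1_primitive (b : R) (q : (R -> R) -> C) (Q : R -> C) : Prop :=
  square_integrable `[- b, b] Q /\
  forall phi, test_function b phi ->
    q phi = - cintegral `[- b, b] (fun x => Q x * (derive1 phi x)%:C).

(* y is absolutely continuous on [-b,b], with derivative dy almost everywhere. *)
Definition ac_with_derivative (b : R) (y dy : R -> C) : Prop :=
  cintegrable `[- b, b] dy /\
  forall x, - b <= x <= b -> y x = y 0 + ointegral 0 x dy.

(* y'' - q y = z y on [-b,b] for q = Q', with y(0) = y0 and y'(0) = y1.
   Since y' need not have point values, the equation is read, as usual for
   distributional potentials, through the quasi-derivative w = y' - Q y: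
   y'' - q y = (y' - Q y)' + Q y' as distributions, so that the equation
   becomes y' = w + Q y, w' = z y - Q y' with y and w absolutely continuous,
   and the condition on y'(0) is imposed on w(0). If q is a continuous function
   and Q its primitive vanishing at 0, then w(0) = y'(0) and this is the
   classical initial value problem. *)
Definition solves_ivp (b : R) (Q : R -> C) (z : C) (y : R -> C) (y0 y1 : C) :
    Prop :=
  exists w : R -> C,
    let dy := fun s => w s + Q s * y s in
    [/\ ac_with_derivative b y dy,
        ac_with_derivative b w (fun s => z * y s - Q s * dy s),
        y 0 = y0 & w 0 = y1].

(* K(x,.) is square integrable for every x, and every solution with
   u(0) = 1, u'(0) = i omega is the image of e^{i omega t} under
   v |-> v(x) + \int_{-x}^x K(x,t) v(t) dt (oriented integral, for x < 0 too). *)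
Definition transmutation_kernel (b : R) (Q : R -> C) (K : R -> R -> C) : Prop :=
  forall x, - b <= x <= b ->
    square_integrable `[- `|x|, `|x|] (K x) /\
    forall (omega : C) (u : R -> C),
      solves_ivp b Q (- omega ^+ 2) u 1 ('i%C * omega) ->
      u x = cexp ('i%C * omega * x%:C) +
            ointegral (- x) x (fun t => K x t * cexp ('i%C * omega * t%:C)).

(* For x < 0 the interval with endpoints -x and x is [x, -x]; the sign makes
   the integral over the whole line agree with the oriented integral from -x
   to x. *)
Definition extended_kernel (b : R) (K : R -> R -> C) (x y : R) : C :=
  if - b <= x <= b then
    if - x <= y <= x then K x y
    else if x <= y <= - x then - K x y
    else 0
  else 0.

Fixpoint formal_X (f : R -> C) (n : nat) (x : R) : C :=
  if n is m.+1 then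
    n%:R * ointegral 0 x
      (fun s => formal_X f m s * (f s ^+ 2) ^ ((-1) ^+ m.+1 : int))
  else 1.

Fixpoint formal_Xtilde (f : R -> C) (n : nat) (x : R) : C :=
  if n is m.+1 then
    n%:R * ointegral 0 x
      (fun s => formal_Xtilde f m s * (f s ^+ 2) ^ ((-1) ^+ m : int))
  else 1.

Definition formal_power (f : R -> C) (k : nat) (x : R) : C :=
  f x * (if odd k then formal_X f k x else formal_Xtilde f k x).

(* The orthogonality and normalization relations determine H_n up to sign; as
   usual the leading coefficient is taken positive. *)
Definition hermite_polynomials (H : nat -> {poly R}) : Prop :=
  [/\ forall n, size (H n) = n.+1,
      forall n, 0 < lead_coef (H n),
      forall m n, m <> n ->
        \int[lebesgue_measure]_(y in [set: R])
          ((H m).[y] * (H n).[y] * expR (- y ^+ 2)) = 0 &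
      forall n,
        \int[lebesgue_measure]_(y in [set: R])
          ((H n).[y] ^+ 2 * expR (- y ^+ 2)) = Num.sqrt pi * n`!%:R * 2 ^+ n].

Definition u_partial (c : nat -> R -> C) (N : nat) (omega : C) (x : R) : C :=
  cexp ('i%C * omega * x%:C) +
  (Num.sqrt pi)%:C * cexp (- omega ^+ 2 / 4) *
    \sum_(0 <= n < N.+1) c n x * ('i%C * omega) ^+ n.

End Potential.

(* Main.v *)
Require Import Defs.
From HB Require Import structures.
From mathcomp Require Import all_boot all_order all_algebra complex.
From mathcomp Require Import all_classical all_reals all_analysis.
From mathcomp Require Import measurable_realfun lebesgue_integral_under.
From mathcomp Require Import normal_distribution ring lra.

Set Implicit Arguments.
Unset Strict Implicit.
Unset Printing Implicit Defensive.

Import Order.TTheory GRing.Theory Num.Theory.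
Import numFieldNormedType.Exports.

Local Open Scope classical_set_scope.
Local Open Scope ring_scope.
Local Open Scope complex_scope.

(* For fixed x put k(y) = K~(x,y) e^{y^2/2}, an element of L_2(R) because K~(x,.)
   has bounded support. The expansion (i) is the expansion of k in the Hermite
   functions H_n(y) e^{-y^2/2}, so it rests on their completeness. Let V be the
   closure of {p(y) e^{-y^2/2} : p polynomial}. The bounded functions h with
   h V in V form an algebra stable under bounded pointwise limits; it contains
   the Gaussians e^{-(y-s)^2/16} (Taylor series), hence the indicators of open
   intervals (thresholding), of Borel sets, and all bounded measurable functions.
   Truncation then gives V = L_2(R).
   Integration by parts gives
   int H_n(y) e^{zy-y^2} dy = sqrt(pi) e^{z^2/4} z^n, and
   u - u_N = int (k - partial sum)(y) e^{i omega y - y^2/2} dy is bounded by the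
   Cauchy-Schwarz inequality, which is (ii) and (iii).
   The formula with the formal powers says that T[x^k] = phi_k. For small real l
   the spectral parameter power series sum_k l^k phi_k / k! solves the initial
   value problem with i omega = l; representing it through K and comparing the
   coefficients of l^k gives the claim. *)

(** * Real square integrable functions *)

(** The kernel is given only through its action on exponentials, and y' has no point values for a
    distributional potential, so T[x^k] is not computed from the differential equation. It is read
    off from a generating function in l: since the kernel represents every solution of the initial
    value problem, the solution built as a power series may be inserted directly, and small l > 0
    determine all coefficients. That this series solves the equation requires product and quotient
    rules for functions known only as integrals of L_1 functions; these rules come from uniform
    estimates on short intervals. Completeness is argued through multiplication operators because
    they form an algebra, while V is only a vector space: powers and products of Gaussians are again
    multipliers, and indicators can be formed. Gaussians enter because their Taylor polynomials stay
    square integrable, uniformly in the degree, against the weight e^{-y^2/2}, if the Gaussian is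
    wide enough. Real and imaginary parts are treated separately, with the norm |Re| + |Im|; this
    only enlarges the function of x in the error bound by a constant factor. *)

Section L1L2.
Context {R : realType}.
Local Notation mu := (@lebesgue_measure R).
Implicit Types f g h : R -> R.

Definition L1 f := mu.-integrable [set: R] (EFin \o f).

Lemma L1_measurable f : L1 f -> measurable_fun [set: R] f.
Proof. by move=> /integrableP[/measurable_EFinP]. Qed.

Lemma L1_le f g : measurable_fun [set: R] f -> L1 g ->
  (forall x, `|f x| <= g x) -> L1 f.
Proof.
move=> mf ig fg; apply: (le_integrable _ _ _ ig) => //.
  exact/measurable_EFinP.
by move=> x _ /=; rewrite lee_fin (le_trans (fg x))// ler_norm.
Qed.

Lemma L1D f g : L1 f -> L1 g -> L1 (fun x => f x + g x).
Proof.
move=> If Ig; rewrite /L1 (_ : _ \o _ = (EFin \o f) \+ (EFin \o g))%E//.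
exact: integrableD.
Qed.

Lemma L1Z k f : L1 f -> L1 (fun x => k * f x).
Proof.
move=> If; rewrite /L1 (_ : _ \o _ = (fun x => k%:E * (EFin \o f) x)%E)//.
exact: integrableZl.
Qed.

Lemma L1N f : L1 f -> L1 (fun x => - f x).
Proof.
by move=> /(L1Z (-1)); congr L1; apply/funext => x; rewrite mulN1r.
Qed.

Lemma L1B f g : L1 f -> L1 g -> L1 (fun x => f x - g x).
Proof. by move=> If /L1N; exact: L1D. Qed.

Definition L2 f := measurable_fun [set: R] f /\ L1 (fun x => f x * f x).

Lemma L2M f g : L2 f -> L2 g -> L1 (fun x => f x * g x).
Proof.
move=> [mf If] [mg Ig]; apply: (L1_le _ (L1D If Ig)).
  exact: measurable_funM.
move=> x; rewrite ler_norml; move: (f x) (g x) => a b.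
have := sqr_ge0 (a + b); have := sqr_ge0 (a - b).
by have := sqr_ge0 a; have := sqr_ge0 b; rewrite !expr2; nra.
Qed.

Lemma L2D f g : L2 f -> L2 g -> L2 (fun x => f x + g x).
Proof.
move=> Lf Lg; split; first by apply: measurable_funD; [case: Lf|case: Lg].
have := L1D (L1D Lf.2 Lg.2) (L1Z 2 (L2M Lf Lg)).
by congr L1; apply/funext => x; ring.
Qed.

Lemma L2Z k f : L2 f -> L2 (fun x => k * f x).
Proof.
move=> Lf; split; first by apply: measurable_funM => //; case: Lf.
by have := L1Z (k * k) Lf.2; congr L1; apply/funext => x; ring.
Qed.

Lemma L2B f g : L2 f -> L2 g -> L2 (fun x => f x - g x).
Proof.
move=> Lf /(L2Z (-1)) Lg; have := L2D Lf Lg.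
by congr L2; apply/funext => x; ring.
Qed.

Lemma L2_bounded_mul h B f : measurable_fun [set: R] h ->
  (forall x, `|h x| <= B) -> L2 f -> L2 (fun x => h x * f x).
Proof.
move=> mh hB Lf; split; first by apply: measurable_funM => //; case: Lf.
apply: (L1_le _ (L1Z (B * B) Lf.2)).
  by apply: measurable_funM; apply: measurable_funM => //; case: Lf.
move=> x; rewrite (_ : _ * _ = (h x) ^+ 2 * (f x) ^+2); last by ring.
rewrite -expr2 normrM !normrX [ `|f x| ^+ 2]real_normK ?num_real//.
rewrite (_ : f x * f x = f x ^+ 2)// ler_wpM2r ?sqr_ge0//.
by rewrite lerXn2r ?nnegrE// (le_trans _ (hB x)).
Qed.

Definition ip f g : R := \int[mu]_x (f x * g x).

Lemma ipC f g : ip f g = ip g f.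
Proof. by rewrite /ip; under eq_Rintegral do rewrite mulrC. Qed.

Lemma eq_ip f f' g g' : f =1 f' -> g =1 g' -> ip f g = ip f' g'.
Proof. by move=> ff gg; apply: eq_Rintegral => x _; rewrite ff gg. Qed.

Lemma ipDl f1 f2 g : L2 f1 -> L2 f2 -> L2 g ->
  ip (fun x => f1 x + f2 x) g = ip f1 g + ip f2 g.
Proof.
move=> L1' L2' Lg; rewrite /ip -RintegralD//; [|exact: L2M..].
by under eq_Rintegral do rewrite mulrDl.
Qed.

Lemma ipZl k f g : L2 f -> L2 g -> ip (fun x => k * f x) g = k * ip f g.
Proof.
move=> Lf Lg; rewrite /ip -RintegralZl//; last exact: L2M.
by under eq_Rintegral do rewrite -mulrA.
Qed.

Lemma ipBl f1 f2 g : L2 f1 -> L2 f2 -> L2 g ->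
  ip (fun x => f1 x - f2 x) g = ip f1 g - ip f2 g.
Proof.
move=> L1' L2' Lg; rewrite /ip -RintegralB//; [|exact: L2M..].
by under eq_Rintegral do rewrite mulrBl.
Qed.

Lemma ip_ge0 f : 0 <= ip f f.
Proof. by apply: Rintegral_ge0 => x _; rewrite -expr2 sqr_ge0. Qed.

Lemma ip_sqrD f g : L2 f -> L2 g ->
  ip (fun x => f x + g x) (fun x => f x + g x) =
  ip f f + 2 * ip f g + ip g g.
Proof.
move=> Lf Lg; rewrite ipDl ?(ipC _ (fun x => _ + _))//; try exact: L2D.
by rewrite !ipDl// (ipC g f); ring.
Qed.

Lemma ip_sqrD_le f g : L2 f -> L2 g ->
  ip (fun x => f x + g x) (fun x => f x + g x) <= 2 * ip f f + 2 * ip g g.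
Proof.
move=> Lf Lg; rewrite ip_sqrD//.
have := ip_ge0 (fun x => f x - g x).
rewrite ipBl ?(ipC _ (fun x => _ - _))//; try exact: L2B.
by rewrite !ipBl// (ipC g f); lra.
Qed.

(** The quadratic polynomial t |-> |f + t g|^2 is nonnegative; evaluate it at its minimum t = - ip f
    g / ip g g. *)
Lemma ip_CauchySchwarz f g : L2 f -> L2 g ->
  `|ip f g| <= Num.sqrt (ip f f) * Num.sqrt (ip g g).
Proof.
move=> Lf Lg; rewrite -sqrtrM ?ip_ge0// -sqrtr_sqr ler_wsqrtr//.
have H t : 0 <= ip f f + 2 * (t * ip f g) + t * t * ip g g.
  have Lt : L2 (fun x => t * g x) by exact: L2Z.
  have := ip_ge0 (fun x => f x + t * g x); rewrite ip_sqrD//.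
  by rewrite (ipC f) !ipZl// (ipC g (fun x => t * g x)) ipZl// (ipC g f) [t * (t * _)]mulrA.
have := ip_ge0 f; have := ip_ge0 g; rewrite le_eqVlt => /predU1P[g0 f0|g0 f0].
  (* If [ip g g] = 0 the polynomial is affine in t; were [ip f g] nonzero, this t would give it the
     value - [ip f f] - 2 < 0. *)
  have := H (- (ip f f + 1) / ip f g); rewrite -g0 mulr0 addr0.
  have [->|n0] := eqVneq (ip f g) 0; first by rewrite expr2 !mulr0.
  by rewrite divfK//; lra.
have := mulr_ge0 (ltW g0) (H (- ip f g / ip g g)).
suff -> : ip g g * (ip f f + 2 * (- ip f g / ip g g * ip f g) +
    - ip f g / ip g g * (- ip f g / ip g g) * ip g g) =
    ip f f * ip g g - ip f g ^+ 2 by rewrite subr_ge0.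
by field; rewrite gt_eqF.
Qed.

End L1L2.

(** * Gaussian integrals and polynomials with Gaussian weight *)

Section Gaussian.
Context {R : realType}.
Local Notation mu := (@lebesgue_measure R).

(** The integrand is sqrt(pi/d) times the normal density of mean m and variance 1/(2d). *)
Lemma gaussian_center (d m : R) : 0 < d ->
  L1 (fun y => expR (- (d * (y - m) ^+ 2))) /\
  \int[mu]_y expR (- (d * (y - m) ^+ 2)) = Num.sqrt (pi / d).
Proof.
move=> d0; pose s := Num.sqrt (2 * d)^-1.
have s2 : s ^+ 2 = (2 * d)^-1 by rewrite sqr_sqrtr// invr_ge0 mulr_ge0// ltW.
have sn0 : s != 0 by rewrite gt_eqF// sqrtr_gt0 invr_gt0 mulr_gt0.
have E : (fun y => expR (- (d * (y - m) ^+ 2))) =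
    fun y => Num.sqrt (pi / d) * normal_pdf m s y.
  apply/funext => y; rewrite normal_pdfE//= /normal_peak s2.
  have -> : (2 * d)^-1 * pi *+ 2 = pi / d :> R by field; rewrite gt_eqF.
  rewrite mulVKf; last first.
    by rewrite gt_eqF// sqrtr_gt0 divr_gt0// pi_gt0.
  by congr expR; rewrite s2; field; rewrite gt_eqF.
rewrite E; split; first by apply: L1Z; exact: integrable_normal_pdf.
rewrite RintegralZl//; last exact: integrable_normal_pdf.
by rewrite /Rintegral integral_normal_pdf/= mulr1.
Qed.

Lemma gaussian_L1 (a : R) : L1 (fun y => expR (a * y - y ^+ 2)).
Proof.
have [+ _] := gaussian_center (a / 2) (@ltr01 R).
move=> /(L1Z (expR (a ^+ 2 / 4))); congr L1; apply/funext => y.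
by rewrite -expRD; congr expR; field.
Qed.

Lemma gaussian_integral (a : R) :
  \int[mu]_y expR (a * y - y ^+ 2) = Num.sqrt pi * expR (a ^+ 2 / 4).
Proof.
have [i1] := gaussian_center (a / 2) (@ltr01 R).
rewrite divr1 => <-; rewrite mulrC -RintegralZl//.
by apply: eq_Rintegral => y _; rewrite -expRD; congr expR; field.
Qed.

(** Induction on the Horner form pX + c: half of the exponent d is spent on p, the other half on |y|
    <= 1 + y^2. *)
Lemma poly_le_expR_sqr (p : {poly R}) (d : R) : 0 < d ->
  exists2 C, 0 <= C & forall y, `|p.[y]| <= C * expR (d * y ^+ 2).
Proof.
elim/poly_ind: p d => [|p c IH] d d0.
  by exists 0 => // y; rewrite horner0 normr0 mul0r.
have d20 : 0 < d / 2 by rewrite divr_gt0.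
have [C C0 HC] := IH _ d20.
exists (C * (1 + 2 / d) + `|c|).
  by rewrite addr_ge0// mulr_ge0// addr_ge0// divr_ge0// ltW.
move=> y; rewrite hornerMXaddC (le_trans (ler_normD _ _))// mulrDl lerD//; last first.
  by rewrite ler_peMr// -expR0 ler_expR mulr_ge0 ?sqr_ge0// ltW.
rewrite normrM (_ : expR (d * _) = expR (d / 2 * y ^+ 2) * expR (d / 2 * y ^+ 2)).
  rewrite mulrACA ler_pM//.
  have h := expR_ge1Dx (d / 2 * y ^+ 2).
  have e0 : 0 <= d / 2 * y ^+ 2 by rewrite mulr_ge0 ?sqr_ge0// ltW.
  have : `|y| <= 1 + y ^+ 2.
    rewrite -real_normK ?num_real//; have := normr_ge0 y.
    move: `|y| => z; have := sqr_ge0 (z - 1); rewrite !expr2; nra.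
  move=> /le_trans; apply.
  have -> : 1 + y ^+ 2 = 1 + 2 / d * (d / 2 * y ^+ 2) by field; rewrite gt_eqF.
  have : 0 <= 2 / d by rewrite divr_ge0// ltW.
  move: (2 / d) (d / 2 * y ^+ 2) (expR _) h e0 => A B D; nra.
by rewrite -expRD; congr expR; field.
Qed.

Lemma measurable_horner (p : {poly R}) : measurable_fun [set: R] (horner p).
Proof. by apply: continuous_measurable_fun; exact: continuous_horner. Qed.

Lemma measurable_expRX2 (d : R) :
  measurable_fun [set: R] (fun y : R => expR (- (d * y ^+ 2))).
Proof.
apply: measurableT_comp => //; apply: measurableT_comp => //.
apply: measurable_funM => //; exact: measurable_funX.
Qed.

Lemma gaussian_poly_L1 (p : {poly R}) (d : R) : 0 < d ->
  L1 (fun y => p.[y] * expR (- (d * y ^+ 2))).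
Proof.
move=> d0; have d20 : 0 < d / 2 by rewrite divr_gt0.
have [C C0 HC] := poly_le_expR_sqr p d20.
have [L _] := gaussian_center 0 d20.
apply: (L1_le _ (L1Z C L)).
  by apply: measurable_funM; [exact: measurable_horner|exact: measurable_expRX2].
move=> y; rewrite normrM (ger0_norm (expR_ge0 _)).
apply: le_trans (ler_wpM2r (expR_ge0 _) (HC y)) _.
rewrite -(mulrA C) -expRD subr0 ler_wpM2l// ler_expR.
by rewrite le_eqVlt; apply/orP; left; apply/eqP; field.
Qed.

(** Square root of the Hermite weight; it moves the weighted inner product of polynomials to the
    unweighted L_2, where [pw p] lives. *)
Definition gw (y : R) := expR (- (y ^+ 2 / 2)).

Lemma gwM y : gw y * gw y = expR (- y ^+ 2).
Proof. by rewrite /gw -expRD; congr expR; field. Qed.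

Lemma measurable_gw : measurable_fun [set: R] gw.
Proof.
have := measurable_expRX2 2^-1.
by congr measurable_fun; apply/funext => y; rewrite /gw mulrC.
Qed.

Definition pw (p : {poly R}) (y : R) := p.[y] * gw y.

Lemma pw_L2 p : L2 (pw p).
Proof.
split; first by apply: measurable_funM; [exact: measurable_horner|exact: measurable_gw].
have := gaussian_poly_L1 (p * p) (@ltr01 R); congr L1; apply/funext => y.
by rewrite /pw mulrACA gwM hornerM mul1r.
Qed.

End Gaussian.

(** * Completeness of the Hermite functions *)

Section HermiteClosure.
Context {R : realType}.
Local Notation mu := (@lebesgue_measure R).
Implicit Types f g h G : R -> R.

(** The space V of the overview; e bounds the square of the distance. *)
Definition hclosure f := L2 f /\
  forall e, 0 < e -> exists p : {poly R}, ip (f \- pw p) (f \- pw p) <= e.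

Lemma hclosure_pw p : hclosure (pw p).
Proof.
split; first exact: pw_L2.
move=> e e0; exists p; rewrite /ip.
under eq_Rintegral do rewrite /= subrr mulr0.
by rewrite Rintegral_cst// mul0r ltW.
Qed.

Lemma hclosure_closed f : L2 f ->
  (forall e, 0 < e -> exists2 g, hclosure g & ip (f \- g) (f \- g) <= e) -> hclosure f.
Proof.
move=> Lf H; split=> // e e0.
(* |u + v|^2 <= 2|u|^2 + 2|v|^2, with both squares at most e/4. *)
have e40 : 0 < e / 4 by rewrite divr_gt0.
have [g [Lg /(_ _ e40)[p Hp]] Hg] := H _ e40.
exists p.
have -> : f \- pw p = fun x => (f \- g) x + (g \- pw p) x.
  by apply/funext => x /=; ring.
apply: le_trans (ip_sqrD_le _ _) _.
- exact: L2B.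
- by apply: L2B => //; exact: pw_L2.
- by lra.
Qed.

(** Dominated convergence for |f - g_n|^2, which is at most 4 G^2, gives convergence in L_2. *)
Lemma hclosure_dominated (g_ : nat -> R -> R) f G : (forall n, hclosure (g_ n)) ->
  (forall x, g_ n x @[n --> \oo] --> f x) ->
  (forall n x, `|g_ n x| <= G x) -> L2 G -> hclosure f.
Proof.
move=> Vg gf gG LG.
have mf : measurable_fun [set: R] f.
  by apply: (measurable_fun_cvg (h := g_)) => [n|x _]; [case: (Vg n) => -[]|exact: gf].
have fG x : `|f x| <= G x.
  by apply: (cvgr_to_le (cvg_norm (gf x))); exact: nearW.
have Lf : L2 f.
  split=> //; apply: (L1_le _ LG.2); first exact: measurable_funM.
  by move=> x; rewrite normrM ler_pM.
apply: hclosure_closed => // e e0.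
have L (n : nat) : L1 (fun x => (f \- g_ n) x * (f \- g_ n) x).
  by apply: (L2B Lf (Vg n).1).2.
have [|||_ _ /=] := @dominated_convergence _ _ R mu setT measurableT
  (fun n x => ((f \- g_ n) x * (f \- g_ n) x)%:E) (cst 0%E)
  (fun x => (4 * (G x * G x))%:E) (fun n => measurable_int _ (L n))
  (measurable_cst _).
- apply: aeW => x _; apply: cvg_EFin; first exact: nearW.
  have h : (f x - g_ n x) @[n --> \oo] --> 0.
    by rewrite -(subrr (f x)); apply: cvgB => //; exact: cvg_cst.
  by have := cvgM h h; rewrite mulr0; apply.
- exact: (L1Z 4 LG.2).
- apply: aeW => x n _; rewrite lee_fin.
  move: (fG x) (gG n x); rewrite /= !ler_norml.
  by move: (f x) (g_ n x) (G x) => a b c /andP[? ?] /andP[? ?]; apply/andP; split; nra.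
rewrite integral_cst// mul0e => /fine_cvgP[_ /cvgrPdist_le /(_ _ e0)[N _ HN]].
exists (g_ N) => //; have := HN N (leqnn N); rewrite /= sub0r normrN.
by rewrite ger0_norm// ?ip_ge0//; apply.
Qed.

Definition multiplier h := [/\ measurable_fun [set: R] h,
  exists B, forall x, `|h x| <= B & forall g, hclosure g -> hclosure (h \* g)].

(** Multiplication by h has operator norm at most B on L_2, so invariance passes from the functions
    [pw p] to their closure. *)
Lemma multiplier_pw h B : measurable_fun [set: R] h -> (forall x, `|h x| <= B) ->
  (forall p, hclosure (h \* pw p)) -> multiplier h.
Proof.
move=> mh hB H; split=> //; first by exists B.
move=> g [Lg Hg]; apply: hclosure_closed; first exact: L2_bounded_mul hB Lg.
move=> e e0.
have B0 : 0 <= B by apply: le_trans (hB 0).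
(* The summand 1 keeps the denominator positive when B = 0. *)
have e'0 : 0 < e / (B * B + 1) by rewrite divr_gt0// ltr_wpDl// mulr_ge0.
have [p Hp] := Hg _ e'0; exists (h \* pw p) => //.
have Ld : L2 (g \- pw p) by apply: L2B => //; exact: pw_L2.
have : ip ((h \* g) \- (h \* pw p)) ((h \* g) \- (h \* pw p)) <=
    B * B * ip (g \- pw p) (g \- pw p).
  rewrite /ip -RintegralZl//; last exact: Ld.2.
  have -> : (h \* g) \- (h \* pw p) = h \* (g \- pw p).
    by apply/funext => x /=; ring.
  apply: le_Rintegral => //.
  - exact: (L2_bounded_mul mh hB Ld).2.
  - by apply: L1Z; exact: Ld.2.
  - move=> x _; move: (hB x); rewrite /= ler_norml => /andP[h1 h2].
    rewrite mulrACA ler_wpM2r// -?expr2 ?sqr_ge0//.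
    by rewrite !expr2; nra.
move=> /le_trans; apply.
apply: le_trans (ler_wpM2l _ Hp) _; first exact: mulr_ge0.
rewrite mulrCA ler_piMr ?(ltW e0)// ler_pdivrMr ?mul1r ?lerDl//.
by rewrite ltr_wpDl// mulr_ge0.
Qed.

Lemma hclosureD f g : hclosure f -> hclosure g -> hclosure (f \+ g).
Proof.
move=> [Lf Hf] [Lg Hg]; split; first exact: L2D.
move=> e e0; have e40 : 0 < e / 4 by rewrite divr_gt0.
have [p Hp] := Hf _ e40; have [q Hq] := Hg _ e40; exists (p + q).
have -> : (f \+ g) \- pw (p + q) = fun x => (f \- pw p) x + (g \- pw q) x.
  by apply/funext => x; rewrite /pw/= hornerD; ring.
apply: le_trans (ip_sqrD_le _ _) _; [exact: L2B (pw_L2 _)|exact: L2B (pw_L2 _)|].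
by lra.
Qed.

Lemma multiplier_cst k : multiplier (cst k).
Proof.
apply: (@multiplier_pw _ `|k|) => // p.
have -> : cst k \* pw p = pw (k%:P * p).
  by apply/funext => x; rewrite /pw/= hornerM hornerC mulrA.
exact: hclosure_pw.
Qed.

Lemma multiplierM h g : multiplier h -> multiplier g -> multiplier (h \* g).
Proof.
move=> [mh [B hB] Vh] [mg [C gC] Vg]; split; first exact: measurable_funM.
  by exists (B * C) => x /=; rewrite normrM ler_pM.
move=> f Vf; have -> : (h \* g) \* f = h \* (g \* f).
  by apply/funext => x /=; rewrite mulrA.
by apply: Vh; exact: Vg.
Qed.

Lemma multiplierD h g : multiplier h -> multiplier g -> multiplier (h \+ g).
Proof.
move=> [mh [B hB] Vh] [mg [C gC] Vg]; split; first exact: measurable_funD.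
  by exists (B + C) => x /=; rewrite (le_trans (ler_normD _ _))// lerD.
move=> f Vf; have -> : (h \+ g) \* f = (h \* f) \+ (g \* f).
  by apply/funext => x /=; rewrite mulrDl.
by apply: hclosureD; [exact: Vh|exact: Vg].
Qed.

Lemma multiplierX h n : multiplier h -> multiplier (fun x => h x ^+ n).
Proof.
move=> Mh; elim: n => [|n IH]; first exact: multiplier_cst.
have -> : (fun x => h x ^+ n.+1) = h \* (fun x => h x ^+ n).
  by apply/funext => x; rewrite exprS.
exact: multiplierM.
Qed.

Lemma multiplier_lim (h_ : nat -> R -> R) h B : (forall n, multiplier (h_ n)) ->
  (forall n x, `|h_ n x| <= B) -> (forall x, h_ n x @[n --> \oo] --> h x) ->
  multiplier h.
Proof.
move=> Mh hB hh.
have mh : measurable_fun [set: R] h.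
  by apply: (measurable_fun_cvg (h := h_)) => [n|x _]; [case: (Mh n)|exact: hh].
have hB' x : `|h x| <= B.
  by apply: (cvgr_to_le (cvg_norm (hh x))); exact: nearW.
split=> //; first by exists B.
move=> g Vg; apply: (@hclosure_dominated (fun n => h_ n \* g) _ (fun x => B * `|g x|)).
- by move=> n; case: (Mh n) => _ _; apply.
- by move=> x; apply: cvgM => //; exact: cvg_cst.
- by move=> n x /=; rewrite normrM ler_wpM2r.
- have [mg Lg] := Vg.1; apply: L2Z; split; first exact: measurableT_comp.
  by move: Lg; congr L1; apply/funext => x; rewrite -normrM ger0_norm// -expr2 sqr_ge0.
Qed.

(** The Taylor polynomials of the exponential at -(y-s)^2/16 are polynomials in y, and all are
    bounded by e^{(y-s)^2/16} <= e^{s^2/8} e^{y^2/8}. Against e^{-y^2/2} this majorant is still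
    square integrable; with this estimate any denominator above 4 would serve in place of 16. *)
Lemma multiplier_gauss s : multiplier (fun y => expR (- ((y - s) ^+ 2 / 16))).
Proof.
have mh : measurable_fun [set: R] (fun y => expR (- ((y - s) ^+ 2 / 16))).
  apply: measurableT_comp => //; apply: measurableT_comp => //.
  by apply: measurable_funM => //; apply: measurable_funX; exact: measurable_funB.
apply: (@multiplier_pw _ 1) => // [y|p].
  rewrite ger0_norm ?expR_ge0// -expR0 ler_expR oppr_le0.
  by rewrite divr_ge0// sqr_ge0.
pose q : {poly R} := - ((('X - s%:P) ^+ 2) * (16^-1)%:P).
pose T n : {poly R} := \sum_(0 <= k < n) (k`!%:R^-1)%:P * q ^+ k.
have qE y : q.[y] = - ((y - s) ^+ 2 / 16).
  by rewrite /q !hornerE.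
have TE n y : (T n).[y] = series (exp_coeff (- ((y - s) ^+ 2 / 16))) n.
  rewrite /T horner_sum; apply: eq_bigr => k _.
  by rewrite /exp_coeff/= hornerM hornerC horner_exp qE mulrC.
pose G y := expR (s ^+ 2 / 8) * (expR (y ^+ 2 / 8) * pw p y).
apply: (@hclosure_dominated (fun n => pw (T n * p)) _ (fun y => `|G y|)).
- by move=> n; exact: hclosure_pw.
- move=> y /=; rewrite /pw.
  under eq_fun do rewrite hornerM TE -mulrA.
  by apply: cvgM; [exact: is_cvg_series_exp_coeff|exact: cvg_cst].
- move=> n y; have -> : pw (T n * p) y = (T n).[y] * pw p y.
    by rewrite /pw hornerM mulrA.
  rewrite normrM (_ : `|G y| = `|expR (s ^+ 2 / 8) * expR (y ^+ 2 / 8)| * `|pw p y|); last by rewrite -normrM -mulrA.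
  rewrite ler_wpM2r//.
  rewrite -expRD (ger0_norm (expR_ge0 _)) TE.
  have : `|series (exp_coeff (- ((y - s) ^+ 2 / 16))) n| <=
      expR ((y - s) ^+ 2 / 16).
    apply: (@le_trans _ _ (series (exp_coeff ((y - s) ^+ 2 / 16)) n)).
      apply: le_trans (ler_norm_sum _ _ _) _; apply: ler_sum => k _.
      rewrite /exp_coeff/= normrM normrX normrN ger0_norm ?divr_ge0 ?sqr_ge0//.
      by rewrite [`|_ / _|]ger0_norm// divr_ge0// sqr_ge0.
    have nd : nondecreasing_seq (series (exp_coeff ((y - s) ^+ 2 / 16))).
      apply/nondecreasing_seqP => k; rewrite /series/= big_nat_recr//= lerDl.
      by rewrite /exp_coeff/= mulr_ge0 ?invr_ge0// exprn_ge0// divr_ge0// sqr_ge0.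
    exact: nondecreasing_cvgn_le nd (is_cvg_series_exp_coeff _) _.
  move=> /le_trans; apply; rewrite ler_expR.
  by have := sqr_ge0 (y + s); rewrite !expr2; lra.
- have mG : measurable_fun [set: R] G.
    apply: measurable_funM => //; apply: measurable_funM; last by case: (pw_L2 p).
    by apply: measurableT_comp => //; apply: measurable_funM.
  split; first exact: measurableT_comp.
  (* The square of e^{y^2/8} e^{-y^2/2} is e^{-3y^2/4}. *)
  have h34 : 0 < 3 / 4 :> R by lra.
  have := L1Z (expR (s ^+ 2 / 8) ^+ 2) (gaussian_poly_L1 (p * p) h34).
  congr L1; apply/funext => y.
  rewrite -normrM ger0_norm; last by rewrite -expr2 sqr_ge0.
  have -> : expR (- (3 / 4 * y ^+ 2)) =
      expR (y ^+ 2 / 8) * expR (y ^+ 2 / 8) * (gw y * gw y).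
    by rewrite /gw -!expRD; congr expR; field.
  by rewrite hornerM /G /pw; ring.
Qed.

End HermiteClosure.

(** * Thresholding by polynomials *)

Section Threshold.
Context {R : realType}.
Implicit Types (x t z : R).

Lemma bernoulli_le x (m : nat) : -1 <= x -> 1 + m%:R * x <= (1 + x) ^+ m.
Proof.
move=> x1; elim: m => [|m IH]; first by rewrite mul0r addr0.
have x10 : 0 <= 1 + x by lra.
rewrite exprS; apply: le_trans (ler_wpM2l x10 IH).
rewrite -natr1; have : 0 <= m%:R :> R by [].
by move: (m%:R) => k k0; have := sqr_ge0 x; rewrite expr2; nra.
Qed.

(** Write z = w^2. Bernoulli's inequality for 1/w bounds n w^n by 1/(1/w - 1), and the remaining
    factor w^n tends to 0. *)
Lemma cvg_natMexpr z : 0 <= z -> z < 1 -> (n%:R * z ^+ n) @[n --> \oo] --> 0.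
Proof.
move=> z0 z1; pose w := Num.sqrt z.
have w2 : z = w * w by rewrite -expr2 sqr_sqrtr.
have [w0|] := boolP (0 < w); last first.
  rewrite -leNgt => w0.
  have {}w0 : w = 0 by apply/eqP; rewrite eq_le w0 sqrtr_ge0.
  rewrite w2 w0 mul0r.
  rewrite (_ : (fun n => _) = cst 0); first exact: cvg_cst.
  by apply/funext => -[|n] /=; rewrite ?mul0r// expr0n mulr0.
have w1 : w < 1 by nra.
have d0 : 0 < w^-1 - 1 by rewrite subr_gt0 invf_gt1.
apply: (@squeeze_cvgr _ _ _ _ (cst 0) (fun n => (w^-1 - 1)^-1 * w ^+ n)).
- apply: nearW => n; rewrite mulr_ge0 ?exprn_ge0//= w2 exprMn mulrA.
  rewrite ler_wpM2r ?exprn_ge0 ?(ltW w0)// -[leRHS]mulr1 ler_pdivlMl//.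
  have := @bernoulli_le (w^-1 - 1) n.
  rewrite (_ : 1 + (w^-1 - 1) = w^-1); last by ring.
  have -> : -1 <= w^-1 - 1 by rewrite (le_trans _ (ltW d0))// lerN10.
  move=> /(_ isT) h.
  have : (1 + n%:R * (w^-1 - 1)) * w ^+ n <= w^-1 ^+ n * w ^+ n.
    by rewrite ler_wpM2r// exprn_ge0// ltW.
  rewrite -exprMn mulVf ?gt_eqF// expr1n mulrDl mul1r.
  have := exprn_gt0 n w0; move: (w ^+ n) (n%:R) (w^-1 - 1) => A B D; lra.
- exact: cvg_cst.
- rewrite -(mulr0 ((w^-1 - 1)^-1)); apply: cvgM; first exact: cvg_cst.
  by apply: cvg_expr; rewrite ger0_norm// ltW.
Qed.

(** A device known from elementary proofs of the Stone-Weierstrass theorem. With m = n 2^n,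
    Bernoulli gives (1 - t^n)^m >= 1 - n (2t)^n, which tends to 1 for t < 1/2. For t >= 1/2, (1 -
    s)(1 + s) <= 1 gives (1 - t^n)^m <= 1/(1 + n (2t)^n) <= 1/(n+1). The factor n in the exponent
    forces the limit 0 at t = 1/2 itself, where (1 - t^n)^(2^n) would tend to 1/e. *)
Lemma cvg_threshold t : 0 <= t <= 1 ->
  (1 - t ^+ n) ^+ (n * 2 ^ n) @[n --> \oo] --> ((t < 2^-1)%R%:R : R).
Proof.
move=> /andP[t0 t1].
have s01 n : 0 <= t ^+ n <= 1 by rewrite exprn_ge0// exprn_ile1.
have mE n : (n * 2 ^ n)%:R * t ^+ n = n%:R * (2 * t) ^+ n :> R.
  by rewrite natrM natrX exprMn mulrA.
have [th|th] := ltP t 2^-1.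
  apply: (@squeeze_cvgr _ _ _ _ (fun n => 1 - n%:R * (2 * t) ^+ n) (cst 1)).
  - apply: nearW => n /=; have /andP[s0 s1] := s01 n.
    rewrite exprn_ile1 ?subr_ge0// ?gerBl// andbT.
    have := @bernoulli_le (- t ^+ n) (n * 2 ^ n).
    by rewrite mulrN mE; apply; rewrite lerN2.
  - rewrite -[X in _ --> X]subr0; apply: cvgB; first exact: cvg_cst.
    by apply: cvg_natMexpr; lra.
  - exact: cvg_cst.
apply: (@squeeze_cvgr _ _ _ _ (cst 0) (fun n => n.+1%:R^-1)).
- apply: nearW => n /=; have /andP[s0 s1] := s01 n.
  rewrite exprn_ge0 ?subr_ge0//= -[leRHS]mul1r ler_pdivlMr ?ltr0n//.
  have b := @bernoulli_le (t ^+ n) (n * 2 ^ n).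
  have {}b : n.+1%:R <= (1 + t ^+ n) ^+ (n * 2 ^ n).
    apply: le_trans (b _); last by rewrite (le_trans _ s0)// lerN10.
    rewrite mE -natr1 addrC lerD2l ler_peMr// exprn_ege1//; lra.
  apply: (@le_trans _ _ ((1 - t ^+ n) ^+ (n * 2 ^ n) * (1 + t ^+ n) ^+ (n * 2 ^ n))).
    by rewrite ler_wpM2l// exprn_ge0// subr_ge0.
  rewrite -exprMn exprn_ile1//; nra.
- exact: cvg_cst.
- exact: cvg_harmonic.
Qed.

(** The thresholding polynomials in t are multipliers with values in [0, 1]. *)
Lemma multiplier_lt_half (t : R -> R) : multiplier t -> (forall x, 0 <= t x <= 1) ->
  multiplier (fun x => (t x < 2^-1)%R%:R).
Proof.
move=> Mt t01.
apply: (@multiplier_lim _ (fun n x => (1 - t x ^+ n) ^+ (n * 2 ^ n)) _ 1).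
- move=> n; apply: multiplierX.
  have -> : (fun x => 1 - t x ^+ n) = (cst 1) \+ (cst (-1) \* (fun x => t x ^+ n)).
    by apply/funext => x /=; rewrite mulN1r.
  apply: multiplierD; first exact: multiplier_cst.
  by apply: multiplierM; [exact: multiplier_cst|exact: multiplierX].
- move=> n x; have /andP[t0 t1] := t01 x.
  have s0 := exprn_ge0 n t0; have s1 := exprn_ile1 n t0 t1.
  by rewrite ger0_norm ?exprn_ge0 ?exprn_ile1 ?subr_ge0// ?gerBl.
- by move=> x; exact: cvg_threshold.
Qed.

End Threshold.

(** * From indicators of intervals to all bounded measurable functions *)

Section BoundedMultipliers.
Context {R : realType}.
Local Notation mu := (@lebesgue_measure R).

Lemma multiplier_ext (f g : R -> R) : f =1 g -> multiplier f -> multiplier g.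
Proof. by move=> /funext ->. Qed.

Lemma multiplier_itvoo (x y : R) : multiplier (\1_(`]x, y[%classic) : R -> R).
Proof.
have [yx|xy] := leP y x.
  by rewrite set_itv_ge ?bnd_simp -?leNgt// indic0; exact: multiplier_cst.
pose s := (x + y) / 2; pose r := (y - x) / 2.
have r0 : 0 < r by rewrite divr_gt0// subr_gt0.
pose th := expR (- (r ^+ 2 / 16)).
pose h (z : R) := expR (- ((z - s) ^+ 2 / 16)).
have h01 z : 0 <= h z <= 1.
  by rewrite expR_ge0/= -expR0 ler_expR oppr_le0 divr_ge0// sqr_ge0.
have th01 : 0 <= th <= 1.
  by rewrite expR_ge0/= -expR0 ler_expR oppr_le0 divr_ge0// sqr_ge0.
(* [th] is the value at both endpoints of the Gaussian [h] centred at the midpoint, so ]x, y[ is the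
   set [h] > [th], that is [t] < 1/2; and [t] has values in [0, 1] since [h] and [th] do. *)
pose t z := (1 + th - h z) / 2.
apply: (@multiplier_ext (fun z => (t z < 2^-1)%R%:R)).
  move=> z; rewrite indicE; congr (nat_of_bool _)%:R; apply/idP/idP.
    rewrite /t ltr_pdivrMr// mulVf// => tz.
    have : th < h z by lra.
    rewrite ltr_expR ltrN2 ltr_pM2r ?invr_gt0// => zr.
    by rewrite inE/= in_itv/=; move: zr; rewrite /s /r !expr2 => zr; apply/andP; split; nra.
  rewrite inE/= in_itv/= => /andP[xz zy].
  have : th < h z.
    rewrite ltr_expR ltrN2 ltr_pM2r ?invr_gt0//.
    by rewrite /s /r !expr2; nra.
  by rewrite /t; lra.
apply: multiplier_lt_half => [|z]; last first.
  by have /andP[? ?] := h01 z; have /andP[? ?] := th01; apply/andP; split; rewrite /t; lra.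
apply: (@multiplier_ext (cst ((1 + th) / 2) \+ (cst (- 2^-1) \* h))).
  by move=> z; rewrite /t /=; field.
apply: multiplierD; first exact: multiplier_cst.
by apply: multiplierM; [exact: multiplier_cst|exact: multiplier_gauss].
Qed.

(** The sets whose indicators are multipliers form a sigma-algebra, and it contains the open
    intervals, which generate the Borel sets. *)
Lemma multiplier_indic (A : set R) : measurable A -> multiplier (\1_A : R -> R).
Proof.
have MC (B : set R) : multiplier (\1_B : R -> R) -> multiplier (\1_(~` B) : R -> R).
  move=> MB; apply: (@multiplier_ext (cst 1 \+ (cst (-1) \* \1_B))).
    by move=> x; rewrite /= !indicE in_setC; case: (x \in B) => /=; ring.
  by apply: multiplierD; [exact: multiplier_cst|apply: multiplierM => //; exact: multiplier_cst].
rewrite [measurable A](_ : _ = (@RGenOpens.G R).-sigma.-measurable A); last first.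
  by rewrite -RGenOpens.measurableE.
move: A; apply: smallest_sub; last first.
  by move=> _ [x [y ->]]; exact: multiplier_itvoo.
split.
- by rewrite indic0; exact: multiplier_cst.
- by move=> B MB; rewrite setTD; exact: MC.
- move=> F MF; rewrite -[X in \1_X]setCK setC_bigcup; apply: (MC).
  (* A countable union is treated through its complement, whose indicator is the pointwise limit of
     these finite products. *)
  pose P n x : R := \prod_(0 <= k < n) \1_(~` F k) x.
  have PE n x : P n x = [forall k : 'I_n, x \in ~` F k]%:R.
    rewrite /P big_mkord; case: forallP => [xF|/existsNP[k xk]].
      by rewrite big1// => k _; rewrite indicE xF.
    rewrite (bigD1 k)//= indicE (_ : (x \in _) = false) ?mul0r//.
    by apply/negP.
  apply: (@multiplier_lim _ P _ 1).
  + elim=> [|n IH].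
      by apply: (@multiplier_ext (cst 1)); [move=> x; rewrite /P big_nil|exact: multiplier_cst].
    apply: (@multiplier_ext (P n \* \1_(~` F n))).
      by move=> x; rewrite /P big_nat_recr.
    by apply: multiplierM => //; apply: MC; exact: MF.
  + by move=> n x; rewrite PE; case: [forall _, _]; rewrite ?normr1 ?normr0.
  + move=> x; rewrite indicE; case: (boolP (x \in _)) => xF.
      apply: (@cvg_trans _ (cst 1 @ \oo)); last exact: cvg_cst.
      apply: near_eq_cvg; apply: nearW => n; rewrite PE/=.
      suff -> : [forall k : 'I_n, x \in ~` F k] by [].
      by apply/forallP => k; move: xF; rewrite !inE => /(_ k I).
    have [k xk] : exists k, F k x.
      apply: contrapT => H; move/negP: xF; apply; rewrite inE => k _ Fk.
      by apply: H; exists k.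
    apply: (@cvg_trans _ (cst 0 @ \oo)); last exact: cvg_cst.
    apply: near_eq_cvg; exists k.+1 => // n /= kn; rewrite PE.
    suff -> : [forall k : 'I_n, x \in ~` F k] = false by [].
    apply/negP => /forallP /(_ (Ordinal kn)); rewrite inE; exact.
Qed.

(* The first [n] binary digits of the values of [h] give [m]. *)
Lemma multiplier_dyadic (n : nat) (h : R -> R) : measurable_fun [set: R] h ->
  (forall x, 0 <= h x <= 1) ->
  exists2 m : R -> R, multiplier m & forall x, `|h x - m x| <= 2^-1 ^+ n.
Proof.
elim: n h => [|n IH] h mh h01.
  exists (cst 0); first exact: multiplier_cst.
  by move=> x; rewrite subr0 expr0; have /andP[? ?] := h01 x; rewrite ger0_norm.
pose A := [set x | 2^-1 <= h x].
have mA : measurable A.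
  have := mh measurableT _ (measurable_itv `[2^-1, +oo[).
  by rewrite setTI; congr measurable; apply/seteqP; split => x /=;
    rewrite in_itv/= andbT.
pose h' x := 2 * (h x - 2^-1 * \1_A x).
have [|x|m Mm Hm] := IH h'.
- apply: measurable_funM => //; apply: measurable_funB => //.
  by apply: measurable_funM => //; exact: measurable_indic.
- have /andP[h0 h1] := h01 x; rewrite /h' indicE.
  have [xA|xA] := leP 2^-1 (h x).
    by rewrite mem_set//= mulr1; apply/andP; split; lra.
  rewrite memNset/=; last by apply/negP; rewrite -ltNge.
  by rewrite mulr0; apply/andP; split; lra.
exists ((cst 2^-1 \* \1_A) \+ (cst 2^-1 \* m)).
  by apply: multiplierD; apply: multiplierM => //; [exact: multiplier_cst|exact: multiplier_indic|exact: multiplier_cst].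
move=> x; rewrite /= exprS; have := Hm x; rewrite /h' !ler_norml.
by move=> /andP[? ?]; apply/andP; split; lra.
Qed.

(** After an affine change of the values to [0, 1], h is a uniform limit of dyadic approximations;
    these are at most 1 + 2^{-n} <= 2 in absolute value. *)
Lemma multiplier_bounded (h : R -> R) B : measurable_fun [set: R] h ->
  (forall x, `|h x| <= B) -> multiplier h.
Proof.
move=> mh hB; wlog B0 : B hB / 0 < B.
  move=> H; apply: (H (`|B| + 1)); last by rewrite ltr_wpDl.
  by move=> x; rewrite (le_trans (hB x))// ler_wpDr// ler_norm.
pose h' x := (h x + B) / (2 * B).
have B20 : 0 < 2 * B by rewrite mulr_gt0.
have h'01 x : 0 <= h' x <= 1.
  move: (hB x); rewrite ler_norml => /andP[? ?].
  by rewrite /h' divr_ge0 ?(ltW B20) ?ler_pdivrMr//=; lra.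
have mh' : measurable_fun [set: R] h'.
  by apply: measurable_funM => //; exact: measurable_funD.
suff Mh' : multiplier h'.
  apply: (@multiplier_ext (cst (2 * B) \* h' \+ cst (- B))).
    by move=> x; rewrite /h' /=; field; rewrite gt_eqF.
  by apply: multiplierD; [apply: multiplierM => //; exact: multiplier_cst|exact: multiplier_cst].
have /choice[m Hm] n : exists m : R -> R,
    multiplier m /\ forall x, `|h' x - m x| <= 2^-1 ^+ n.
  by have [m ? ?] := multiplier_dyadic n mh' h'01; exists m.
apply: (@multiplier_lim _ m _ 2) => [n|n x|x]; first by case: (Hm n).
  have [_ /(_ x)] := Hm n; have /andP[? ?] := h'01 x.
  have : 2^-1 ^+ n <= 1 :> R by rewrite exprn_ile1// invf_le1// ler1n.
  by rewrite !ler_norml => ? /andP[? ?]; apply/andP; split; lra.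
apply/cvgrPdist_le => e e0.
have : 2^-1 ^+ n @[n --> \oo] --> (0 : R).
  by apply: cvg_expr; rewrite ger0_norm// invf_lt1// ltr1n.
move=> /cvgrPdist_le /(_ _ e0)[N _ HN]; exists N => // n /HN.
rewrite sub0r normrN ger0_norm ?exprn_ge0//.
by apply: le_trans; case: (Hm n).
Qed.

(** Write f = (f / gw) gw, where [gw] = [pw 1] lies in V. On the set |f| <= n gw the quotient is
    bounded by n, so its cut-off is a multiplier; these sets exhaust the line because gw > 0, and
    |f| dominates. *)
Lemma hclosure_L2 (f : R -> R) : L2 f -> hclosure f.
Proof.
move=> Lf; have [mf _] := Lf.
pose A n := [set x : R | `|f x| <= n%:R * gw x].
have mA n : measurable (A n).
  have := @measurable_fun_le _ _ R setT (fun x => `|f x|) (fun x => n%:R * gw x) measurableT.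
  rewrite setTI; apply; first exact: measurableT_comp.
  by apply: measurable_funM => //; exact: measurable_gw.
have gw0 (x : R) : 0 < gw x by exact: expR_gt0.
pose h n x := \1_(A n) x * (f x / gw x).
apply: (@hclosure_dominated _ (fun n => h n \* pw 1) _ (fun x => `|f x|)).
- move=> n; have [] : multiplier (h n); last by move=> _ _; apply; exact: hclosure_pw.
  apply: (@multiplier_bounded _ n%:R).
    apply: measurable_funM; first exact: measurable_indic.
    apply: measurable_funM => //.
    have -> : (fun x : R => (gw x)^-1) = (fun x => expR (x ^+ 2 / 2)).
      by apply/funext => x; rewrite /gw expRN invrK.
    apply: measurableT_comp => //; apply: measurable_funM => //.
  move=> x; rewrite /h indicE; have [xA|xA] := boolP (x \in A n); last by rewrite mul0r normr0.
  rewrite mul1r normf_div (gtr0_norm (gw0 x)) ler_pdivrMr//.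
  by rewrite inE in xA.
- move=> x; apply: (@cvg_trans _ (cst (f x) @ \oo)); last exact: cvg_cst.
  apply: near_eq_cvg; near=> n; rewrite /= /h /pw hornerC mul1r indicE mem_set ?mul1r ?divfK ?gt_eqF//.
  rewrite /A/= -ler_pdivrMr//; near: n; exact: nbhs_infty_ger.
- move=> n x /=; rewrite /h /pw hornerC mul1r -mulrA divfK ?gt_eqF// indicE.
  by case: (x \in A n); rewrite ?mul1r// mul0r normr0.
- split; first exact: measurableT_comp.
  by move: Lf.2; congr L1; apply/funext => x; rewrite -normrM ger0_norm// -expr2 sqr_ge0.
Unshelve. all: by end_near.
Qed.

End BoundedMultipliers.

(** * Gaussian integrals and Hermite polynomials *)

Section GaussianParts.
Context {R : realType}.
Local Notation mu := (@lebesgue_measure R).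
Implicit Types (f F : R -> R) (p : {poly R}) (a b x y : R).

(** The fundamental theorem of calculus on [-n, n], followed by dominated convergence. *)
Lemma Rintegral_derive_eq0 F f : (forall x, is_derive x 1 F (f x)) ->
  continuous f -> L1 f ->
  F n%:R @[n --> \oo] --> 0 -> F (- n%:R) @[n --> \oo] --> 0 ->
  \int[mu]_x f x = 0.
Proof.
move=> dF cf If Fp Fm.
have mf := L1_measurable If.
have dFx x : derivable F x 1 by [].
have cF : continuous F.
  by move=> x; apply: differentiable_continuous; apply/derivable1_diffP.
pose g n x := (f \_ (`[- n%:R, n%:R]%classic : set R)) x.
have mg n : measurable_fun [set: R] (g n).
  by apply/(measurable_restrictT _ _).1 => //; exact: measurable_funTS.
have [|||_ _] := @dominated_convergence _ _ R mu setT measurableT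
  (fun n x => (g n x)%:E) (EFin \o f) (fun x => `|f x|%:E)
  (fun n => (measurable_EFinP _ _).2 (mg n)) ((measurable_EFinP _ _).2 mf).
- apply: aeW => x _; apply: cvg_EFin; first exact: nearW.
  apply: (@cvg_trans _ (cst (f x) @ \oo)); last exact: cvg_cst.
  apply: near_eq_cvg; near=> n; rewrite [RHS]/= /g patchE mem_set//= in_itv/= -ler_norml.
  by near: n; exact: nbhs_infty_ger.
- exact: integrable_norm.
- apply: aeW => x n _; rewrite lee_fin /g patchE.
  by case: ifP; rewrite ?normr0.
have -> : (fun n => (\int[mu]_x (g n x)%:E)%E) = fun n => (F n%:R - F (- n%:R))%:E.
  (* The interval [-n, n] degenerates for n = 0, where the fundamental theorem does not apply. *)
  apply/funext => -[|n].
    rewrite oppr0 subrr (_ : (fun x => _) = EFin \o (f \_ `[0, 0])).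
      rewrite -restrict_EFin -integral_mkcond set_itv1.
      by rewrite integral_set1.
    by apply/funext => x; rewrite /g oppr0.
  rewrite (_ : (fun x => _) = (EFin \o f) \_ `[- n.+1%:R, n.+1%:R]); last first.
    by apply/funext => x; rewrite /g restrict_EFin.
  rewrite -integral_mkcond.
  rewrite (@continuous_FTC2 _ f F)//.
  - by rewrite gtrN// ltr0n.
  - exact: continuous_subspaceT.
  - split; first by move=> x _; exact: dFx.
    + by apply: cvg_at_right_filter; exact: cF.
    + by apply: cvg_at_left_filter; exact: cF.
  - by move=> x _; rewrite derive1E; exact: derive_val.
rewrite -(fineK (integrable_fin_num measurableT If)) => /fine_cvgP[_ h].
rewrite /Rintegral; apply/esym.
have H0 : (F n%:R - F (- n%:R)) @[n --> \oo] --> 0.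
  by rewrite -(subrr 0); exact: cvgB.
exact: (cvg_unique _ H0 h).
Unshelve. all: by end_near.
Qed.

(* Real and imaginary parts of p(y) e^{zy-y^2} for z = a + ib. *)
Definition gcos p a b y := p.[y] * expR (a * y - y ^+ 2) * cos (b * y).
Definition gsin p a b y := p.[y] * expR (a * y - y ^+ 2) * sin (b * y).

(** Combine |p(y)| <= C e^{y^2/4} with a y <= a^2/2 + y^2/2. *)
Lemma polyexp_bound p a : exists2 C, 0 <= C &
  forall y, `|p.[y] * expR (a * y - y ^+ 2)| <= C * expR (- (4^-1 * y ^+ 2)).
Proof.
have h4 : 0 < 4^-1 :> R by [].
have [C C0 HC] := poly_le_expR_sqr p h4.
exists (C * expR (a ^+ 2 / 2)); first by rewrite mulr_ge0// expR_ge0.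
move=> y; rewrite normrM (ger0_norm (expR_ge0 _)).
apply: le_trans (ler_wpM2r (expR_ge0 _) (HC y)) _.
rewrite -!(mulrA C) -!expRD ler_wpM2l// ler_expR.
by have := sqr_ge0 (a - y); rewrite !expr2; lra.
Qed.

Lemma measurable_polyexp p a :
  measurable_fun [set: R] (fun y => p.[y] * expR (a * y - y ^+ 2)).
Proof.
apply: measurable_funM; first exact: measurable_horner.
by apply: measurableT_comp => //; apply: measurable_funB.
Qed.

Lemma polyexp_mul_L1 p a (c : R -> R) : measurable_fun [set: R] c ->
  (forall y, `|c y| <= 1) -> L1 (fun y => p.[y] * expR (a * y - y ^+ 2) * c y).
Proof.
move=> mc c1; have [C C0 HC] := polyexp_bound p a.
have h4 : 0 < 4^-1 :> R by [].
have [L _] := gaussian_center 0 h4.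
apply: (L1_le _ (L1Z C L)).
  by apply: measurable_funM => //; exact: measurable_polyexp.
move=> y; rewrite normrM subr0 -[leRHS]mulr1 ler_pM//.
Qed.

Lemma measurable_cosM b : measurable_fun [set: R] (fun y => cos (b * y)).
Proof.
apply: measurableT_comp; last exact: measurable_funM.
by apply: continuous_measurable_fun; exact: continuous_cos.
Qed.

Lemma measurable_sinM b : measurable_fun [set: R] (fun y => sin (b * y)).
Proof.
apply: measurableT_comp; last exact: measurable_funM.
by apply: continuous_measurable_fun; exact: continuous_sin.
Qed.

Lemma gcos_L1 p a b : L1 (gcos p a b).
Proof.
apply: polyexp_mul_L1; first exact: measurable_cosM.
by move=> y; rewrite ler_norml cos_geN1 cos_le1.
Qed.

Lemma gsin_L1 p a b : L1 (gsin p a b).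
Proof.
apply: polyexp_mul_L1; first exact: measurable_sinM.
by move=> y; rewrite ler_norml sin_geN1 sin_le1.
Qed.

Lemma is_derive_polyexp p a y :
  is_derive y 1 (fun y => p.[y] * expR (a * y - y ^+ 2))
   ((p^`() + (a%:P - 2%:P * 'X) * p).[y] * expR (a * y - y ^+ 2)).
Proof.
have h1 : is_derive y 1 (fun y : R => a * y - y ^+ 2) (a - 2 * y).
  have h := is_deriveB (is_deriveZ a (is_derive_id y 1)) (is_deriveX 2 (is_derive_id y 1)).
  apply: (is_derive_eq h).
  by rewrite /GRing.scale/=; ring.
have h2 := is_derive1_comp (g := fun y : R => a * y - y ^+ 2) (is_derive_expR _) h1.
have h3 := is_deriveM (is_derive_poly p y) h2.
apply: (is_derive_eq h3).
by rewrite !hornerE /GRing.scale/=; ring.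
Qed.

Lemma is_derive_trigM b y :
  is_derive y 1 (fun y => cos (b * y)) (- b * sin (b * y)) /\
  is_derive y 1 (fun y => sin (b * y)) (b * cos (b * y)).
Proof.
have h1 : is_derive y 1 (fun y : R => b * y) b.
  apply: (is_derive_eq (is_deriveZ b (is_derive_id y 1))).
  by rewrite /GRing.scale/= mulr1.
split.
  apply: (is_derive_eq (is_derive1_comp (g := fun y : R => b * y) (is_derive_cos _) h1)).
  by rewrite mulrC mulrN mulNr.
by apply: (is_derive_eq (is_derive1_comp (g := fun y : R => b * y) (is_derive_sin _) h1)); rewrite mulrC.
Qed.

(** The sign e = 1 or -1 selects the end of the line, and c stands for a cosine or sine. The rate
    4/(n+1) comes from (n+1)/4 <= 1 + n^2/4 <= e^{n^2/4}. *)
Lemma cvg_polyexp p a (c : R -> R) (e : R) : e ^+ 2 = 1 -> (forall y, `|c y| <= 1) ->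
  (fun y => p.[y] * expR (a * y - y ^+ 2) * c y) (e * n%:R) @[n --> \oo] --> 0.
Proof.
move=> e2 c1; have [C C0 HC] := polyexp_bound p a.
apply: norm_cvg0; apply: (@squeeze_cvgr _ _ _ _ (cst 0) (fun n => C * (4 * n.+1%:R^-1))).
- apply: nearW => n /=; rewrite normr_ge0 normrM/=.
  apply: (@le_trans _ _ (C * expR (- (4^-1 * (e * n%:R) ^+ 2)) * 1)).
    by apply: ler_pM.
  rewrite mulr1 ler_wpM2l// exprMn e2 mul1r expRN.
  rewrite (_ : 4 * _ = (4^-1 * n.+1%:R)^-1); last by rewrite invfM invrK.
  rewrite lef_pV2 ?posrE ?expR_gt0// ?mulr_gt0// ?invr_gt0// ?ltr0n//.
  apply: le_trans (expR_ge1Dx _).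
  have : (n <= n ^ 2)%N by rewrite -{1}(expn1 n); case: n => // n; rewrite leq_pexp2l.
  rewrite -(ler_nat R) natrX -(natr1 n) => h; lra.
- exact: cvg_cst.
- rewrite -(mulr0 C); apply: cvgM; first exact: cvg_cst.
  rewrite -(mulr0 4); apply: cvgM; first exact: cvg_cst.
  exact: cvg_harmonic.
Qed.

Lemma is_derive1_cvg F x (d : R) : is_derive x 1 F d ->
  F z @[z --> x] --> F x.
Proof.
move=> [dF _]; have : {for x, continuous F}; last by [].
by apply: differentiable_continuous; apply/derivable1_diffP.
Qed.

Lemma continuous_gcos p a b : continuous (gcos p a b).
Proof.
move=> y; apply: cvgM; first exact: is_derive1_cvg (is_derive_polyexp p a y).
exact: is_derive1_cvg (is_derive_trigM b y).1.
Qed.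

Lemma continuous_gsin p a b : continuous (gsin p a b).
Proof.
move=> y; apply: cvgM; first exact: is_derive1_cvg (is_derive_polyexp p a y).
exact: is_derive1_cvg (is_derive_trigM b y).2.
Qed.

Definition Jc p a b := \int[mu]_y gcos p a b y.
Definition Js p a b := \int[mu]_y gsin p a b y.

Lemma cvg_gcos_gsin p a b (e : R) : e ^+ 2 = 1 ->
  gcos p a b (e * n%:R) @[n --> \oo] --> 0 /\
  gsin p a b (e * n%:R) @[n --> \oo] --> 0.
Proof.
move=> e2; split.
  apply: (@cvg_polyexp p a (fun y => cos (b * y)) e) => // y.
  by rewrite ler_norml cos_geN1 cos_le1.
apply: (@cvg_polyexp p a (fun y => sin (b * y)) e) => // y.
by rewrite ler_norml sin_geN1 sin_le1.
Qed.

(** Polynomial factor in the derivative of p(y) e^{ay-y^2}. With J = Jc + i Js, the two integrations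
    by parts below read J(dp p a) = - i b J(p). *)
Let dp p a := p^`() + (a%:P - 2%:P * 'X) * p.

Lemma Jc_parts p a b : Jc (dp p a) a b = b * Js p a b.
Proof.
apply/eqP; rewrite -subr_eq0; apply/eqP.
rewrite /Jc /Js -RintegralZl//; last exact: gsin_L1.
rewrite -RintegralB//; [|exact: gcos_L1|by apply: L1Z; exact: gsin_L1].
apply: (@Rintegral_derive_eq0 (gcos p a b)).
- move=> y; apply: (is_derive_eq (is_deriveM (is_derive_polyexp p a y) (is_derive_trigM b y).1)).
  by rewrite /gcos /gsin /dp /GRing.scale/=; ring.
- move=> y; apply: cvgB; first exact: continuous_gcos.
  by apply: cvgM; [exact: cvg_cst|exact: continuous_gsin].
- by apply: L1B; [exact: gcos_L1|apply: L1Z; exact: gsin_L1].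
- have [+ _] := @cvg_gcos_gsin p a b 1 (expr1n _ _).
  by under eq_fun do rewrite mul1r.
- have [|+ _] := @cvg_gcos_gsin p a b (-1); first by rewrite sqrrN expr1n.
  by under eq_fun do rewrite mulN1r.
Qed.

Lemma Js_parts p a b : Js (dp p a) a b = - b * Jc p a b.
Proof.
apply/eqP; rewrite -subr_eq0; apply/eqP.
rewrite /Jc /Js -RintegralZl//; last exact: gcos_L1.
rewrite -RintegralB//; [|exact: gsin_L1|by apply: L1Z; exact: gcos_L1].
apply: (@Rintegral_derive_eq0 (gsin p a b)).
- move=> y; apply: (is_derive_eq (is_deriveM (is_derive_polyexp p a y) (is_derive_trigM b y).2)).
  by rewrite /gcos /gsin /dp /GRing.scale/=; ring.
- move=> y; apply: cvgB; first exact: continuous_gsin.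
  by apply: cvgM; [exact: cvg_cst|exact: continuous_gcos].
- by apply: L1B; [exact: gsin_L1|apply: L1Z; exact: gcos_L1].
- have [_ +] := @cvg_gcos_gsin p a b 1 (expr1n _ _).
  by under eq_fun do rewrite mul1r.
- have [|_ +] := @cvg_gcos_gsin p a b (-1); first by rewrite sqrrN expr1n.
  by under eq_fun do rewrite mulN1r.
Qed.

End GaussianParts.

(** * Complex exponentials integrated against the Gaussian *)

Section GaussianFourier.
Context {R : realType}.
Local Notation mu := (@lebesgue_measure R).
Implicit Types (p q : {poly R}) (a b x y : R).

Lemma JcD p q a b : Jc (p + q) a b = Jc p a b + Jc q a b.
Proof.
rewrite /Jc -RintegralD//; [|exact: gcos_L1..].
by apply: eq_Rintegral => y _; rewrite /gcos hornerD !mulrDl.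
Qed.

Lemma JcZ (k : R) p a b : Jc (k *: p) a b = k * Jc p a b.
Proof.
rewrite /Jc -RintegralZl//; last exact: gcos_L1.
by apply: eq_Rintegral => y _; rewrite /gcos hornerZ !mulrA.
Qed.

Lemma JsD p q a b : Js (p + q) a b = Js p a b + Js q a b.
Proof.
rewrite /Js -RintegralD//; [|exact: gsin_L1..].
by apply: eq_Rintegral => y _; rewrite /gsin hornerD !mulrDl.
Qed.

Lemma JsZ (k : R) p a b : Js (k *: p) a b = k * Js p a b.
Proof.
rewrite /Js -RintegralZl//; last exact: gsin_L1.
by apply: eq_Rintegral => y _; rewrite /gsin hornerZ !mulrA.
Qed.

(** With [Js_raise], and J = Jc + i Js: the raising operator p |-> 2Xp - p' turns into
    multiplication of J by z = a + ib. *)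
Lemma Jc_raise p a b :
  Jc (2 *: ('X * p) - p^`()) a b = a * Jc p a b - b * Js p a b.
Proof.
have := Jc_parts p a b.
have -> : p^`() + (a%:P - 2%:P * 'X) * p =
    a *: p + (-1) *: (2 *: ('X * p) - p^`()).
  rewrite -!mul_polyC polyCN mulrBl; ring.
by rewrite JcD !JcZ mulN1r => <-; ring.
Qed.

Lemma Js_raise p a b :
  Js (2 *: ('X * p) - p^`()) a b = a * Js p a b + b * Jc p a b.
Proof.
have := Js_parts p a b.
have -> : p^`() + (a%:P - 2%:P * 'X) * p =
    a *: p + (-1) *: (2 *: ('X * p) - p^`()).
  rewrite -!mul_polyC polyCN mulrBl; ring.
by rewrite JsD !JsZ mulN1r mulNr => h; apply/eqP; rewrite -subr_eq0; apply/eqP; lra.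
Qed.

Lemma derive_under (f g : R -> R -> R) (G : R -> R) b :
  (forall x, L1 (f x)) -> (forall x y, is_derive x 1 (f ^~ y) (g x y)) ->
  L1 G -> (forall y, 0 <= G y) -> (forall x y, `|g x y| <= G y) ->
  is_derive b 1 (fun x => \int[mu]_y f x y) (\int[mu]_y g b y).
Proof.
move=> If df IG G0 gG.
(* The radius 1 is arbitrary, since G dominates for all values of the parameter. *)
have bI : `]b - 1, b + 1[%classic b by rewrite /= in_itv/=; apply/andP; split; lra.
have If' x : `]b - 1, b + 1[%classic x -> mu.-integrable setT (EFin \o f x).
  by move=> _; exact: If.
have df' x y : `]b - 1, b + 1[%classic x -> [set: R] y -> derivable (f ^~ y) x 1.
  by move=> _ _; case: (df x y).
have pE x y : partial1of2 f x y = g x y.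
  by rewrite partial1of2E; exact: derive_val.
have gG' x y : `]b - 1, b + 1[%classic x -> [set: R] y -> `|partial1of2 f x y| <= G y.
  by rewrite pE.
have d := derivable_under_integral measurableT bI If' df' G0 IG gG'.
apply: DeriveDef => //; rewrite -derive1E.
rewrite (differentiation_under_integral measurableT bI If' df' G0 IG gG').
by apply: eq_Rintegral => y _.
Qed.

Lemma polyexp_norm_L1 p a : L1 (fun y => `|p.[y] * expR (a * y - y ^+ 2)|).
Proof.
have : L1 (fun y => p.[y] * expR (a * y - y ^+ 2) * 1).
  apply: (@polyexp_mul_L1 _ _ _ (cst 1)) => // y; by rewrite normr1.
by move=> /integrable_norm; congr L1; apply/funext => y /=; rewrite mulr1.
Qed.

Lemma is_derive_Jc a b : is_derive b 1 (fun b => Jc 1 a b) (- Js 'X a b).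
Proof.
have h := @derive_under (fun b y => gcos 1 a b y) (fun b y => - gsin 'X a b y)
  (fun y => `|'X.[y] * expR (a * y - y ^+ 2)|) b.
apply: (is_derive_eq (h _ _ _ _ _)) => //.
- by move=> x; exact: gcos_L1.
- move=> x y; have h1 : is_derive x 1 (fun x : R => x * y) y.
    by apply: (is_derive_eq (is_deriveM (is_derive_id x 1) (is_derive_cst y x 1)));
       rewrite /GRing.scale/= mulr0 add0r mulr1.
  have h2 := is_derive1_comp (g := fun x : R => x * y) (is_derive_cos _) h1.
  have h3 := is_deriveM (is_derive_cst (1.[y] * expR (a * y - y ^+ 2)) x 1) h2.
  apply: (is_derive_eq h3); rewrite /GRing.scale/= /gsin hornerX hornerC; ring.
- exact: polyexp_norm_L1.
- move=> x y; rewrite normrN /gsin normrM ler_piMr//.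
  by rewrite ler_norml sin_geN1 sin_le1.
- rewrite -[RHS]mulN1r -RintegralZl//; last exact: gsin_L1.
  by apply: eq_Rintegral => y _; rewrite mulN1r.
Qed.

Lemma is_derive_Js a b : is_derive b 1 (fun b => Js 1 a b) (Jc 'X a b).
Proof.
have h := @derive_under (fun b y => gsin 1 a b y) (fun b y => gcos 'X a b y)
  (fun y => `|'X.[y] * expR (a * y - y ^+ 2)|) b.
apply: (is_derive_eq (h _ _ _ _ _)) => //.
- by move=> x; exact: gsin_L1.
- move=> x y; have h1 : is_derive x 1 (fun x : R => x * y) y.
    by apply: (is_derive_eq (is_deriveM (is_derive_id x 1) (is_derive_cst y x 1)));
       rewrite /GRing.scale/= mulr0 add0r mulr1.
  have h2 := is_derive1_comp (g := fun x : R => x * y) (is_derive_sin _) h1.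
  have h3 := is_deriveM (is_derive_cst (1.[y] * expR (a * y - y ^+ 2)) x 1) h2.
  apply: (is_derive_eq h3); rewrite /GRing.scale/= /gcos hornerX hornerC; ring.
- exact: polyexp_norm_L1.
- move=> x y; rewrite /gcos normrM ler_piMr//.
  by rewrite ler_norml cos_geN1 cos_le1.
Qed.

Lemma Jc1_0 a : Jc 1 a 0 = Num.sqrt pi * expR (a ^+ 2 / 4).
Proof.
rewrite -gaussian_integral; apply: eq_Rintegral => y _.
by rewrite /gcos mul0r cos0 hornerC mul1r mulr1.
Qed.

Lemma Js_0 p a : Js p a 0 = 0.
Proof.
rewrite /Js (_ : gsin p a 0 = cst 0); first by rewrite Rintegral_cst// mul0r.
by apply/funext => y; rewrite /gsin mul0r sin0 mulr0.
Qed.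

Lemma JcX a b : Jc 'X a b = (a * Jc 1 a b - b * Js 1 a b) / 2.
Proof.
by have := Jc_raise 1 a b; rewrite mulr1 derivC subr0 JcZ => <-; field.
Qed.

Lemma JsX a b : Js 'X a b = (a * Js 1 a b + b * Jc 1 a b) / 2.
Proof.
by have := Js_raise 1 a b; rewrite mulr1 derivC subr0 JsZ => <-; field.
Qed.

(* The integral J(z) of e^{zy-y^2} satisfies dJ/db = i z J / 2 for z = a + ib,
   so J(z) e^{-z^2/4} does not depend on b. *)
Lemma gaussian_fourier a b :
  Jc 1 a b = Num.sqrt pi * expR ((a ^+ 2 - b ^+ 2) / 4) * cos (a * b / 2) /\
  Js 1 a b = Num.sqrt pi * expR ((a ^+ 2 - b ^+ 2) / 4) * sin (a * b / 2).
Proof.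
pose ex (t : R) := expR (t ^+ 2 / 4).
pose co (t : R) := cos (a * t / 2).
pose si (t : R) := sin (a * t / 2).
have dlin (t : R) : is_derive t 1 (fun t : R => a * t / 2) (a / 2).
  have h := is_deriveM (is_deriveZ a (is_derive_id t 1)) (is_derive_cst (2^-1 : R) t 1).
  by apply: (is_derive_eq h); rewrite /GRing.scale/=; ring.
have dex (t : R) : is_derive t 1 ex (ex t * (t / 2)).
  have h := is_deriveM (is_deriveX 2 (is_derive_id t 1)) (is_derive_cst (4^-1 : R) t 1).
  have h2 := is_derive1_comp (g := fun t : R => t ^+ 2 / 4) (is_derive_expR _) h.
  by apply: (is_derive_eq h2); rewrite /GRing.scale/= -/(ex t); field.
have dco (t : R) : is_derive t 1 co (- si t * (a / 2)).
  exact: (is_derive1_comp (g := fun t : R => a * t / 2) (is_derive_cos _) (dlin t)).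
have dsi (t : R) : is_derive t 1 si (co t * (a / 2)).
  exact: (is_derive1_comp (g := fun t : R => a * t / 2) (is_derive_sin _) (dlin t)).
pose C t := Jc 1 a t; pose S t := Js 1 a t.
have dC (t : R) : is_derive t 1 C (- ((a * S t + t * C t) / 2)).
  by apply: (is_derive_eq (is_derive_Jc a t)); rewrite JsX.
have dS (t : R) : is_derive t 1 S ((a * C t - t * S t) / 2).
  by apply: (is_derive_eq (is_derive_Js a t)); rewrite JcX.
(* This function and the one in [dW] are, up to the factor e^{-a^2/4}, the real and imaginary parts
   of J(z) e^{-z^2/4} at z = a + it. *)
have dU (t : R) : is_derive t 1 (ex * (C * co + S * si)) 0.
  apply: (is_derive_eq (is_deriveM (dex t) (is_deriveD (is_deriveM (dC t) (dco t))
    (is_deriveM (dS t) (dsi t))))).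
  by rewrite /GRing.scale/= !fctE; field.
have dW (t : R) : is_derive t 1 (ex * (S * co - C * si)) 0.
  apply: (is_derive_eq (is_deriveM (dex t) (is_deriveB (is_deriveM (dS t) (dco t))
    (is_deriveM (dC t) (dsi t))))).
  by rewrite /GRing.scale/= !fctE; field.
have := is_derive_0_is_cst b 0 dU; rewrite !fctE.
have := is_derive_0_is_cst b 0 dW; rewrite !fctE.
rewrite /C /S /ex /co /si Jc1_0 Js_0 !mulr0 !mul0r sin0 cos0 expr0n mul0r expR0.
rewrite !mulr0 !mul1r mulr1 subr0 addr0.
have E : expR ((a ^+ 2 - b ^+ 2) / 4) = expR (a ^+ 2 / 4) * (expR (b ^+ 2 / 4))^-1.
  by rewrite -expRN -expRD; congr expR; field.
move=> W0 U0; have {}W0 : Js 1 a b * cos (a * b / 2) - Jc 1 a b * sin (a * b / 2) = 0.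
  by move/eqP : W0; rewrite mulf_eq0 gt_eqF ?expR_gt0// => /eqP.
have {}U0 : Jc 1 a b * cos (a * b / 2) + Js 1 a b * sin (a * b / 2) =
    Num.sqrt pi * expR ((a ^+ 2 - b ^+ 2) / 4).
  by rewrite E mulrA -U0; field; rewrite gt_eqF// expR_gt0.
(* The two relations form a rotation applied to (Jc, Js), inverted by means of cos^2 + sin^2 = 1. *)
rewrite -U0; have := cos2Dsin2 (a * b / 2).
move: (cos _) (sin _) (Jc _ _ _) (Js _ _ _) W0 => c s C' S' W0 cs; split.
  rewrite -[LHS]mulr1 -cs; apply/eqP; rewrite -subr_eq0 -oppr0 -(mulr0 s) -W0.
  by apply/eqP; ring.
rewrite -[LHS]mulr1 -cs; apply/eqP; rewrite -subr_eq0 -(mulr0 c) -W0.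
by apply/eqP; ring.
Qed.

End GaussianFourier.

Section Span.
Context {F : fieldType}.
Implicit Types (p : {poly F}) (G : nat -> {poly F}).

Lemma poly_span G n p : (forall k, size (G k) = k.+1) -> (size p <= n)%N ->
  exists c : nat -> F, p = \sum_(0 <= k < n) c k *: G k.
Proof.
move=> sG; elim: n p => [|n IH] p sp.
  exists (fun=> 0); rewrite big_nil; apply/eqP.
  by rewrite -size_poly_leq0.
have l0 : lead_coef (G n) != 0 by rewrite lead_coef_eq0 -size_poly_eq0 sG.
pose k := p`_n / lead_coef (G n).
have [|c Hc] := IH (p - k *: G n).
  apply/leq_sizeP => j nj; rewrite coefB coefZ.
  move: nj; rewrite leq_eqVlt => /predU1P[<-|nj].
    have -> : (G n)`_n = lead_coef (G n) by rewrite lead_coefE sG.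
    by rewrite divfK ?subrr.
  by rewrite !nth_default ?mulr0 ?subr0// ?sG// (leq_trans sp).
exists (fun j => if j == n then k else c j).
rewrite big_nat_recr//= eqxx -[LHS](subrK (k *: G n)) Hc; congr (_ + _).
by apply: eq_big_nat => j /andP[_ jn]; rewrite ltn_eqF.
Qed.

End Span.

(** * Hermite polynomials: orthogonality, uniqueness, expansion in L_2 *)

Section Hermite.
Context {R : realType}.
Local Notation mu := (@lebesgue_measure R).
Implicit Types (p q : {poly R}).

(** The recursion by the raising operator is the form in which every step multiplies the Gaussian
    integral by z. *)
Fixpoint herm (n : nat) : {poly R} :=
  if n is m.+1 then 2 *: ('X * herm m) - (herm m)^`() else 1.

(** The integral against e^{-y^2}, taken as the case z = 0 of [Jc] so that linearity and integration
    by parts carry over. *)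
Definition gaussian_functional p : R := Jc p 0 0.

Lemma gaussian_functionalE p : gaussian_functional p = \int[mu]_y (p.[y] * expR (- y ^+ 2)).
Proof.
by apply: eq_Rintegral => y _; rewrite /gcos !mul0r cos0 mulr1 add0r.
Qed.

Lemma gaussian_functionalD p q : gaussian_functional (p + q) = gaussian_functional p + gaussian_functional q. Proof. exact: JcD. Qed.
Lemma gaussian_functionalZ (k : R) p : gaussian_functional (k *: p) = k * gaussian_functional p. Proof. exact: JcZ. Qed.
Lemma gaussian_functionalB p q : gaussian_functional (p - q) = gaussian_functional p - gaussian_functional q.
Proof. by rewrite -scaleN1r gaussian_functionalD gaussian_functionalZ mulN1r. Qed.

Lemma gaussian_functional_sum n (P : nat -> {poly R}) :
  gaussian_functional (\sum_(0 <= k < n) P k) = \sum_(0 <= k < n) gaussian_functional (P k).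
Proof.
elim: n => [|n IH]; last by rewrite !big_nat_recr//= gaussian_functionalD IH.
by rewrite !big_nil -(scale0r 0) gaussian_functionalZ mul0r.
Qed.

Lemma gaussian_functional1 : gaussian_functional 1 = Num.sqrt pi.
Proof. by rewrite /gaussian_functional Jc1_0 expr0n mul0r expR0 mulr1. Qed.

Lemma gaussian_functional_parts p : gaussian_functional p^`() = gaussian_functional (2 *: ('X * p)).
Proof.
apply/esym/eqP; rewrite -subr_eq0 -gaussian_functionalB; apply/eqP.
by rewrite /gaussian_functional Jc_raise !mul0r subrr.
Qed.

(** The raising operator is the adjoint of differentiation for the Gaussian weight. *)
Lemma gaussian_functional_herm_rec n p : gaussian_functional (herm n.+1 * p) = gaussian_functional (herm n * p^`()).
Proof.
have := gaussian_functional_parts (herm n * p); rewrite derivM gaussian_functionalD => h.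
rewrite /= mulrBl gaussian_functionalB -scalerAl -mulrA -h; ring.
Qed.

Lemma ip_pw p q : ip (pw p) (pw q) = gaussian_functional (p * q).
Proof.
rewrite gaussian_functionalE; apply: eq_Rintegral => y _.
by rewrite /pw hornerM mulrACA gwM.
Qed.

(** By adjointness n derivatives fall on p and annihilate it. *)
Lemma gaussian_functional_herm_low n p : (size p <= n)%N -> gaussian_functional (herm n * p) = 0.
Proof.
elim: n p => [|n IH] p sp.
  have -> : p = 0 by apply/eqP; rewrite -size_poly_leq0.
  by rewrite mulr0 -(scale0r 0) gaussian_functionalZ mul0r.
rewrite gaussian_functional_herm_rec IH//; have [->|p0] := eqVneq p 0.
  by rewrite deriv0 size_poly0.
by rewrite -ltnS (leq_trans _ sp)// lt_size_deriv.
Qed.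

Lemma deriv_herm n : (herm n.+1)^`() = (2 * n.+1%:R) *: herm n.
Proof.
elim: n => [|n IH].
  by rewrite /= derivB derivZ derivM derivX derivC mulr0 addr0 mul1r derivC subr0 mulr1.
rewrite [herm n.+2]/= derivB derivZ derivM derivX mul1r.
rewrite -[_ - (herm n)^`()]/(herm n.+1) IH derivZ.
rewrite -[in LHS]/(herm n.+1) scalerDr -scalerAr [2 *: ((_ * _) *: _)]scalerA.
rewrite [in RHS]/= -!mul_polyC -(natr1 n.+1) !polyCM !polyCD.
have -> : (n.+1%:R)%:P = n.+1%:R :> {poly R} by rewrite polyC_natr.
by rewrite [herm n.+1]/= -mul_polyC polyCD polyC1; ring.
Qed.

Lemma size_lead_herm n : size (herm n) = n.+1 /\ lead_coef (herm n) = 2 ^+ n.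
Proof.
elim: n => [|n [IHs IHl]]; first by rewrite size_poly1 lead_coef1 expr0.
have h0 : herm n != 0 by rewrite -size_poly_eq0 IHs.
have s1 : size (2 *: ('X * herm n)) = n.+2.
  by rewrite size_scale ?pnatr_eq0// mulrC size_mulX// IHs.
have s2 : (size (- (herm n)^`())%R < size (2 *: ('X * herm n))%R)%N.
  by rewrite s1 size_polyN (leq_trans (lt_size_deriv h0))// IHs.
split; first by rewrite /= size_polyDl.
by rewrite /= lead_coefDl// lead_coefZ -(mulrC (herm n)) lead_coefMX IHl exprS.
Qed.

Definition hermite_norm n : R := Num.sqrt pi * n`!%:R * 2 ^+ n.

Lemma hermite_norm_gt0 n : 0 < hermite_norm n.
Proof.
by rewrite !mulr_gt0// ?sqrtr_gt0 ?pi_gt0// ?ltr0n ?fact_gt0// exprn_gt0.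
Qed.

Lemma gaussian_functional_herm_sqr n : gaussian_functional (herm n * herm n) = hermite_norm n.
Proof.
elim: n => [|n IH]; first by rewrite mul1r gaussian_functional1 /hermite_norm fact0 expr0 !mulr1.
rewrite gaussian_functional_herm_rec deriv_herm -scalerAr gaussian_functionalZ IH /hermite_norm factS natrM exprS.
ring.
Qed.

(** Both members of index n have degree n and are orthogonal to all lower degrees, so they differ by
    a scalar [al]; the normalization gives al^2 = 1 and the positive leading coefficient selects al
    = 1. *)
Lemma hermite_herm (H : nat -> {poly R}) : hermite_polynomials H -> H = herm.
Proof.
move=> [sH lH oH nH]; apply/funext => n.
have oH' i j : i <> j -> gaussian_functional (H i * H j) = 0.
  by move=> /oH <-; rewrite gaussian_functionalE; apply: eq_Rintegral => y _; rewrite hornerM.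
have H_low m p : (size p <= m)%N -> gaussian_functional (H m * p) = 0.
  move=> sp; have [c ->] := poly_span sH sp.
  rewrite mulr_sumr gaussian_functional_sum big_nat big1// => k /andP[_ km].
  rewrite -scalerAr gaussian_functionalZ oH' ?mulr0//.
  by move=> mk; rewrite mk ltnn in km.
have [sh lh] := size_lead_herm n.
pose al := lead_coef (H n) / 2 ^+ n.
have al0 : 0 < al by rewrite divr_gt0// exprn_gt0.
pose D : {poly R} := H n - al *: herm n.
have sD : (size D <= n)%N.
  apply/leq_sizeP => j nj; rewrite coefB coefZ.
  move: nj; rewrite leq_eqVlt => /predU1P[<-|nj]; last first.
    by rewrite !nth_default ?mulr0 ?subrr// ?sH ?sh.
  have -> : (herm n)`_n = 2 ^+ n by rewrite -lh lead_coefE sh.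
  have -> : (H n)`_n = lead_coef (H n) by rewrite lead_coefE sH.
  by rewrite divfK ?subrr// gt_eqF// exprn_gt0.
have D_low k : (k < n)%N -> gaussian_functional (D * herm k) = 0.
  move=> kn; rewrite mulrBl gaussian_functionalB -scalerAl gaussian_functionalZ H_low ?(size_lead_herm k).1//.
  by rewrite gaussian_functional_herm_low ?(size_lead_herm k).1// mulr0 subrr.
(* A nonzero D of degree m < n would be orthogonal to [herm m], although only its leading term
   contributes to that product, with a nonzero value. *)
have D0 : D = 0.
  apply/eqP; apply: contraT => Dn0.
  have [m sDm] : exists m, size D = m.+1.
    by case: (size D) (size_poly_eq0 D) => [|m]; [rewrite (negPf Dn0)|exists m].
  have [sm lm] := size_lead_herm m.
  pose c := lead_coef D / 2 ^+ m.
  have c0 : c != 0 by rewrite mulf_neq0 ?invr_eq0 ?lead_coef_eq0// expf_neq0.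
  have sE : (size (D - c *: herm m)%R <= m)%N.
    apply/leq_sizeP => j nj; rewrite coefB coefZ.
    move: nj; rewrite leq_eqVlt => /predU1P[<-|nj]; last first.
      by rewrite !nth_default ?mulr0 ?subrr// ?sDm ?sm.
    have -> : (herm m)`_m = 2 ^+ m by rewrite -lm lead_coefE sm.
    have -> : D`_m = lead_coef D by rewrite lead_coefE sDm.
    by rewrite divfK ?subrr// expf_neq0.
  have := D_low m; rewrite -sDm => /(_ sD) /eqP.
  have -> : D * herm m = herm m * (D - c *: herm m) + c *: (herm m * herm m).
    by rewrite mulrBr -scalerAr subrK mulrC.
  rewrite gaussian_functionalD gaussian_functionalZ gaussian_functional_herm_low// add0r gaussian_functional_herm_sqr mulf_eq0 (negPf c0)/=.
  by rewrite gt_eqF// hermite_norm_gt0.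
have HE : H n = al *: herm n by apply/eqP; rewrite -subr_eq0 -/D D0.
have : gaussian_functional (H n * H n) = hermite_norm n.
  by rewrite /hermite_norm -nH gaussian_functionalE; apply: eq_Rintegral => y _; rewrite hornerM expr2.
rewrite HE -scalerAl -scalerAr !gaussian_functionalZ gaussian_functional_herm_sqr => /eqP.
rewrite mulrA -subr_eq0 -{2}[hermite_norm n]mul1r -mulrBl mulf_eq0 (gt_eqF (hermite_norm_gt0 n)) orbF.
rewrite subr_eq0 -expr2 sqrf_eq1 => /orP[/eqP->|/eqP al1]; first by rewrite scale1r.
by move: al0; rewrite al1 ltr0N1.
Qed.

Lemma ip_suml (n : nat) (c : nat -> R) (P : nat -> {poly R}) (f : R -> R) : L2 f ->
  ip (pw (\sum_(0 <= k < n) c k *: P k)) f = \sum_(0 <= k < n) c k * ip (pw (P k)) f.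
Proof.
move=> Lf; have Z k p : ip (pw (k *: p)) f = k * ip (pw p) f.
  rewrite -ipZl//; last exact: pw_L2.
  by apply: eq_ip => // x; rewrite /pw hornerZ mulrA.
elim: n => [|n IH]; last first.
  rewrite !big_nat_recr//= -IH -Z -ipDl//; try exact: pw_L2.
  by apply: eq_ip => // x; rewrite /pw hornerD mulrDl.
by rewrite !big_nil -(scale0r 0) Z mul0r.
Qed.

(** The residual f - S N is orthogonal to all [pw q] with q of degree at most N, so by Pythagoras S
    N is the best approximation of that degree; density of the functions [pw p] then gives
    convergence. *)
Theorem hermite_expansion (f : R -> R) : L2 f ->
  let S N := pw (\sum_(0 <= k < N.+1) (ip (pw (herm k)) f / hermite_norm k) *: herm k) in
  ip (f \- S N) (f \- S N) @[N --> \oo] --> 0.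
Proof.
move=> Lf S.
have LS N : L2 (f \- S N) by apply: L2B => //; exact: pw_L2.
have orth N k : (k <= N)%N -> ip (pw (herm k)) (f \- S N) = 0.
  move=> kN; rewrite ipC ipBl//; try exact: pw_L2.
  rewrite (ipC f) /S ip_suml; last exact: pw_L2.
  rewrite (bigD1_seq k) ?mem_index_iota ?iota_uniq//=.
  rewrite ip_pw gaussian_functional_herm_sqr divfK ?(gt_eqF (hermite_norm_gt0 k))//.
  rewrite big1 ?addr0 ?subrr// => j jk; rewrite ip_pw.
  have [jk'|kj|E] := ltngtP j k.
  - by rewrite (mulrC (herm j)) gaussian_functional_herm_low ?mulr0// (size_lead_herm j).1.
  - by rewrite gaussian_functional_herm_low ?mulr0// (size_lead_herm k).1.
  - by rewrite E eqxx in jk.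
have best N p : (size p <= N.+1)%N ->
    ip (f \- S N) (f \- S N) <= ip (f \- pw p) (f \- pw p).
  move=> sp; pose q := (\sum_(0 <= k < N.+1) (ip (pw (herm k)) f / hermite_norm k) *: herm k) - p.
  have sq : (size q <= N.+1)%N.
    rewrite (leq_trans (size_polyD _ _))// geq_max size_polyN sp andbT.
    rewrite big_mkord (leq_trans (size_sum _ _ _))//.
    apply/bigmax_leqP => i _; rewrite (leq_trans (size_scale_leq _ _))//.
    by rewrite (size_lead_herm i).1.
  have -> : f \- pw p = fun x => (f \- S N) x + pw q x.
    by apply/funext => x; rewrite /= /S /pw /q hornerD hornerN; ring.
  rewrite (@ip_sqrD _ (f \- S N) (pw q)) //; last exact: pw_L2.
  have -> : ip (f \- S N) (pw q) = 0.
    have [c ->] := poly_span (fun k => (size_lead_herm k).1) sq.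
    rewrite ipC ip_suml// big_nat big1// => k /andP[_ kN].
    by rewrite orth ?mulr0.
  by rewrite mulr0 addr0 lerDl ip_ge0.
apply/cvgrPdist_le => e e0.
have [_ /(_ _ e0)[p Hp]] := hclosure_L2 Lf.
exists (size p) => // N /= pN; rewrite sub0r normrN ger0_norm ?ip_ge0//.
by apply: le_trans (best _ _ _) Hp; exact: leq_trans pN _.
Qed.

End Hermite.

(** * Complex-valued functions *)

Section ComplexNorm1.
Context {R : realType}.
Local Notation C := (R[i]).
Local Notation Re := (@complex.Re R).
Local Notation Im := (@complex.Im R).
Implicit Types (z w : C).

Lemma cReD z w : Re (z + w) = Re z + Re w. Proof. by case: z w => [? ?] []. Qed.
Lemma cImD z w : Im (z + w) = Im z + Im w. Proof. by case: z w => [? ?] []. Qed.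
Lemma cReN z : Re (- z) = - Re z. Proof. by case: z. Qed.
Lemma cImN z : Im (- z) = - Im z. Proof. by case: z. Qed.
Lemma cReM z w : Re (z * w) = Re z * Re w - Im z * Im w.
Proof. by case: z w => [? ?] []. Qed.
Lemma cImM z w : Im (z * w) = Re z * Im w + Im z * Re w.
Proof. by case: z w => [? ?] []. Qed.
Definition complex_partsE := (cReD, cImD, cReN, cImN, cReM, cImM).

Lemma complex_ext z w : Re z = Re w -> Im z = Im w -> z = w.
Proof. by case: z w => [? ?] [? ?] /= -> ->. Qed.

Lemma Re_sum n (P : nat -> C) :
  Re (\sum_(0 <= k < n) P k) = \sum_(0 <= k < n) Re (P k).
Proof.
by elim: n => [|n IH]; rewrite ?big_nil// !big_nat_recr//= cReD IH.
Qed.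

Lemma Im_sum n (P : nat -> C) :
  Im (\sum_(0 <= k < n) P k) = \sum_(0 <= k < n) Im (P k).
Proof.
by elim: n => [|n IH]; rewrite ?big_nil// !big_nat_recr//= cImD IH.
Qed.

(* Submultiplicative, and |int g| <= int |g| is the real inequality for each part. *)
Definition norm1 z : R := `|Re z| + `|Im z|.

Lemma norm1_ge0 z : 0 <= norm1 z. Proof. exact: addr_ge0. Qed.
Lemma norm10 : norm1 0 = 0. Proof. by rewrite /norm1 normr0 addr0. Qed.
Lemma norm1N z : norm1 (- z) = norm1 z. Proof. by rewrite /norm1 !complex_partsE !normrN. Qed.
Lemma norm1C (x : R) : norm1 x%:C = `|x|. Proof. by rewrite /norm1 normr0 addr0. Qed.

Lemma norm1D z w : norm1 (z + w) <= norm1 z + norm1 w.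
Proof.
rewrite /norm1 !complex_partsE; have := ler_normD (Re z) (Re w).
have := ler_normD (Im z) (Im w); lra.
Qed.

Lemma norm1_distC z w : norm1 (z - w) = norm1 (w - z).
Proof. by rewrite -norm1N opprB. Qed.

Lemma norm1M z w : norm1 (z * w) <= norm1 z * norm1 w.
Proof.
rewrite /norm1 !complex_partsE; have := ler_normB (Re z * Re w) (Im z * Im w).
have := ler_normD (Re z * Im w) (Im z * Re w); rewrite !normrM.
lra.
Qed.

Lemma norm1_eq0 z : norm1 z = 0 -> z = 0.
Proof.
move=> /eqP; rewrite paddr_eq0// !normr_eq0 => /andP[/eqP a /eqP c].
exact: complex_ext.
Qed.

Lemma normc_le_n1 z : Normc.normc z <= norm1 z.
Proof.
case: z => a c; rewrite /Normc.normc /norm1/= -(@ger0_norm _ (`|a| + `|c|)) ?addr_ge0//.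
rewrite -sqrtr_sqr ler_wsqrtr// sqrrD !real_normK ?num_real//.
by rewrite lerD2r lerDl mulrn_wge0// mulr_ge0.
Qed.

Lemma normc_sqr z : Normc.normc z ^+ 2 = Re z ^+ 2 + Im z ^+ 2.
Proof. by case: z => a c; rewrite /Normc.normc/= sqr_sqrtr// addr_ge0 ?sqr_ge0. Qed.

Lemma ccvg_n1 (s : nat -> C) (l : C) :
  norm1 (l - s n) @[n --> \oo] --> 0 -> ccvg s l.
Proof.
move=> h; apply/(@cvgrPdist_lt _ R[i]^o) => e e0.
(* In the order of C, 0 < e means that e is real and positive. *)
have [eI eR] : Im e = 0 /\ 0 < Re e.
  by move: e0; rewrite ltcE/= => /andP[/eqP ? ?].
move/cvgrPdist_lt : h => /(_ _ eR)[N _ HN]; exists N => // n /HN.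
rewrite sub0r normrN ger0_norm ?norm1_ge0// => h.
have E : `|(l - s n : R[i])| = (Normc.normc (l - s n))%:C.
  by rewrite normc_def; case: (l - s n).
suff : (Normc.normc (l - s n))%:C < e by rewrite -E.
rewrite ltcE eI /= eqxx/=; apply: le_lt_trans h.
exact: normc_le_n1.
Qed.

End ComplexNorm1.

(** * Integration of complex-valued functions *)

Section ComplexIntegral.
Context {R : realType}.
Local Notation mu := (@lebesgue_measure R).
Local Notation C := (R[i]).
Local Notation Re := (@complex.Re R).
Local Notation Im := (@complex.Im R).
Variables (A : set R).
Hypothesis mA : measurable A.
Implicit Types (f g h : R -> C).

Lemma integrable_EFinZ (k : R) (F : R -> R) : mu.-integrable A (EFin \o F) ->
  mu.-integrable A (EFin \o (fun x => k * F x)).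
Proof.
move=> IF; rewrite (_ : _ \o _ = (fun x => k%:E * (EFin \o F) x)%E)//.
exact: integrableZl.
Qed.

Definition cmeasurable (A : set R) f := measurable_fun A (Re \o f) /\ measurable_fun A (Im \o f).

Lemma cintegrable_measurable f : cintegrable A f -> cmeasurable A f.
Proof.
by move=> [/integrableP[/measurable_EFinP ? _] /integrableP[/measurable_EFinP ? _]].
Qed.

Lemma cmeasurableM f g : cmeasurable A f -> cmeasurable A g ->
  cmeasurable A (fun x => f x * g x).
Proof.
move=> [f1 f2] [g1 g2]; split.
  rewrite (_ : _ \o _ = fun x => Re (f x) * Re (g x) - Im (f x) * Im (g x)).
    by apply: measurable_funB; apply: measurable_funM.
  by apply/funext => x /=; rewrite complex_partsE.
rewrite (_ : _ \o _ = fun x => Re (f x) * Im (g x) + Im (f x) * Re (g x)).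
  by apply: measurable_funD; apply: measurable_funM.
by apply/funext => x /=; rewrite complex_partsE.
Qed.

Lemma cintegrableD f g : cintegrable A f -> cintegrable A g ->
  cintegrable A (fun x => f x + g x).
Proof.
move=> [f1 f2] [g1 g2]; split.
  rewrite (_ : _ \o _ = (EFin \o (Re \o f)) \+ (EFin \o (Re \o g)))%E.
    exact: integrableD.
  by apply/funext => x /=; rewrite complex_partsE.
rewrite (_ : _ \o _ = (EFin \o (Im \o f)) \+ (EFin \o (Im \o g)))%E.
  exact: integrableD.
by apply/funext => x /=; rewrite complex_partsE.
Qed.

Lemma cintegralD f g : cintegrable A f -> cintegrable A g ->
  cintegral A (fun x => f x + g x) = cintegral A f + cintegral A g.
Proof.
move=> [f1 f2] [g1 g2]; apply: complex_ext; rewrite !complex_partsE/= -RintegralD//;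
  by apply: eq_Rintegral => x _; rewrite complex_partsE.
Qed.

Lemma eq_cintegrable f g : (forall x, A x -> f x = g x) ->
  cintegrable A f -> cintegrable A g.
Proof.
move=> fg [f1 f2]; split.
  by apply: eq_integrable f1 => // x /[!inE] Ax /=; rewrite fg.
by apply: eq_integrable f2 => // x /[!inE] Ax /=; rewrite fg.
Qed.

Lemma eq_cintegral f g : (forall x, A x -> f x = g x) ->
  cintegral A f = cintegral A g.
Proof.
by move=> fg; congr (_ +i* _); apply: eq_Rintegral => x /[!inE] Ax; rewrite fg.
Qed.

Lemma cintegrableN f : cintegrable A f -> cintegrable A (fun x => - f x).
Proof.
move=> [f1 f2]; split.
  rewrite (_ : _ \o _ = \- (EFin \o (Re \o f)))%E; first exact: integrableN.
  by apply/funext => x /=; rewrite complex_partsE.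
rewrite (_ : _ \o _ = \- (EFin \o (Im \o f)))%E; first exact: integrableN.
by apply/funext => x /=; rewrite complex_partsE.
Qed.

Lemma norm1_integrable f : cintegrable A f -> mu.-integrable A (EFin \o (fun x => norm1 (f x))).
Proof.
move=> [f1 f2]; rewrite (_ : _ \o _ = (EFin \o (fun x => `|Re (f x)|%R)) \+ (EFin \o (fun x => `|Im (f x)|%R)))%E//.
by apply: integrableD => //; exact: integrable_norm.
Qed.

Lemma cintegrable_le f (G : R -> R) : cmeasurable A f ->
  mu.-integrable A (EFin \o G) -> (forall x, A x -> norm1 (f x) <= G x) ->
  cintegrable A f.
Proof.
move=> [f1 f2] IG fG; split.
  apply: (le_integrable _ _ _ IG) => //; first exact/measurable_EFinP.
  move=> x Ax; rewrite /= lee_fin (le_trans _ (ler_norm _))// (le_trans _ (fG _ Ax))//.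
  by rewrite lerDl.
apply: (le_integrable _ _ _ IG) => //; first exact/measurable_EFinP.
move=> x Ax; rewrite /= lee_fin (le_trans _ (ler_norm _))// (le_trans _ (fG _ Ax))//.
by rewrite lerDr.
Qed.

Lemma cintegrableM_bounded h f B : cmeasurable A h -> (forall x, A x -> norm1 (h x) <= B) ->
  cintegrable A f -> cintegrable A (fun x => h x * f x).
Proof.
move=> mh hB If.
apply: (@cintegrable_le _ (fun x => B * norm1 (f x))).
- by apply: cmeasurableM => //; exact: cintegrable_measurable.
- by apply: integrable_EFinZ; exact: norm1_integrable.
- by move=> x Ax; rewrite (le_trans (norm1M _ _))// ler_wpM2r ?norm1_ge0 ?hB.
Qed.

Lemma cmeasurable_cst (k : C) : cmeasurable A (cst k).
Proof. by split; exact: measurable_cst. Qed.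

Lemma cintegrableZ k f : cintegrable A f -> cintegrable A (fun x => k * f x).
Proof. by apply: (@cintegrableM_bounded (cst k) _ (norm1 k)) => //; exact: cmeasurable_cst. Qed.

Lemma cintegralZ k f : cintegrable A f ->
  cintegral A (fun x => k * f x) = k * cintegral A f.
Proof.
move=> [f1 f2].
apply: complex_ext; rewrite !complex_partsE/= -!RintegralZl// -?RintegralB -?RintegralD//;
  try exact: integrable_EFinZ; by apply: eq_Rintegral => x _; rewrite complex_partsE.
Qed.

Lemma cintegralN f : cintegrable A f ->
  cintegral A (fun x => - f x) = - cintegral A f.
Proof.
move=> If; rewrite -mulN1r -cintegralZ//.
by apply: eq_cintegral => x _; rewrite mulN1r.
Qed.

Lemma cintegralB f g : cintegrable A f -> cintegrable A g ->
  cintegral A (fun x => f x - g x) = cintegral A f - cintegral A g.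
Proof. by move=> If Ig; rewrite cintegralD ?cintegralN//; exact: cintegrableN. Qed.

Lemma cintegrableB f g : cintegrable A f -> cintegrable A g ->
  cintegrable A (fun x => f x - g x).
Proof. by move=> If Ig; apply: cintegrableD => //; exact: cintegrableN. Qed.

Lemma norm1_cintegral f : cintegrable A f ->
  norm1 (cintegral A f) <= \int[mu]_(x in A) norm1 (f x).
Proof.
move=> [f1 f2]; rewrite /norm1 /= RintegralD//; try exact: integrable_norm.
by apply: lerD; exact: le_normr_Rintegral.
Qed.

Lemma norm1_cintegral_le f (G : R -> R) : cintegrable A f ->
  mu.-integrable A (EFin \o G) -> (forall x, A x -> norm1 (f x) <= G x) ->
  norm1 (cintegral A f) <= \int[mu]_(x in A) G x.
Proof.
move=> If IG fG; apply: le_trans (norm1_cintegral If) _.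
by apply: le_Rintegral => //; exact: norm1_integrable.
Qed.

Lemma cintegrable_sum n (P : nat -> R -> C) : (forall k, cintegrable A (P k)) ->
  cintegrable A (fun x => \sum_(0 <= k < n) P k x) /\
  cintegral A (fun x => \sum_(0 <= k < n) P k x) =
  \sum_(0 <= k < n) cintegral A (P k).
Proof.
move=> IP; elim: n => [|n [IH1 IH2]].
  have E : (fun x => \sum_(0 <= k < 0) P k x) = (fun x => 0 * P 0 x).
    by apply/funext => x; rewrite big_nil mul0r.
  rewrite E; split; first exact: cintegrableZ.
  by rewrite cintegralZ// mul0r big_nil.
have E : (fun x => \sum_(0 <= k < n.+1) P k x) =
    (fun x => \sum_(0 <= k < n) P k x + P n x).
  by apply/funext => x; rewrite big_nat_recr.
by rewrite E cintegralD// big_nat_recr//= IH2; split => //; exact: cintegrableD.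
Qed.

End ComplexIntegral.

Section ComplexIntegralSets.
Context {R : realType}.
Local Notation mu := (@lebesgue_measure R).
Local Notation C := (R[i]).

Lemma cintegrableS (A B : set R) (f : R -> C) : measurable A -> measurable B ->
  A `<=` B -> cintegrable B f -> cintegrable A f.
Proof.
by move=> mA mB AB [f1 f2]; split;
  [exact: (@integrableS _ _ R mu B A _ mB mA AB f1)|exact: (@integrableS _ _ R mu B A _ mB mA AB f2)].
Qed.

Lemma cintegral_chasles (s r t : R) (f : R -> C) : s <= r -> r <= t ->
  cintegrable `[s, t] f ->
  cintegral `[s, t] f = cintegral `[s, r] f + cintegral `[r, t] f.
Proof.
move=> sr rt [f1 f2].
have key (F : R -> R) : mu.-integrable `[s, t] (EFin \o F) ->
    \int[mu]_(x in `[s, t]) F x = \int[mu]_(x in `[s, r]) F x + \int[mu]_(x in `[r, t]) F x.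
  move=> IF; apply/eqP; rewrite addrC -subr_eq; apply/eqP.
  rewrite Rintegral_itvB ?bnd_simp// Rintegral_itv_obnd_cbnd//.
  by apply: integrableS IF => //; apply: subset_itv; rewrite bnd_simp.
by apply: complex_ext; rewrite complex_partsE /=; apply: key.
Qed.

Lemma cintegral_mkcond (A : set R) (f g : R -> C) : measurable A ->
  (forall x, A x -> g x = f x) -> (forall x, ~ A x -> g x = 0) ->
  cintegral setT g = cintegral A f /\
  (cintegrable A f -> cintegrable setT g).
Proof.
move=> mA gf g0.
have E : (@complex.Re R \o g = (@complex.Re R \o f) \_ A) /\
         (@complex.Im R \o g = (@complex.Im R \o f) \_ A).
  split; apply/funext => x; rewrite patchE /=; case: (boolP (x \in A)) => [/set_mem h|/negP h];
    by [rewrite gf|rewrite g0// => /mem_set].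
split; last first.
  move=> [f1 f2]; split; rewrite ?E.1 ?E.2 -restrict_EFin.
    by have [h _] := integrable_mkcond (mu := mu) (EFin \o (@complex.Re R \o f)) mA; apply: h.
  by have [h _] := integrable_mkcond (mu := mu) (EFin \o (@complex.Im R \o f)) mA; apply: h.
apply: complex_ext; rewrite /= [RHS]Rintegral_mkcond.
  by apply: eq_Rintegral => x _; rewrite -[LHS]/((@complex.Re R \o g) x) E.1.
by apply: eq_Rintegral => x _; rewrite -[LHS]/((@complex.Im R \o g) x) E.2.
Qed.

Lemma cintegral_set1 (a : R) (f : R -> C) : cintegral `[a, a] f = 0.
Proof. by rewrite /cintegral set_itv1 !Rintegral_set1. Qed.

End ComplexIntegralSets.

(** * Absolutely continuous functions *)

Section UniformContinuity.
Context {R : realType}.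
Local Notation mu := (@lebesgue_measure R).
Local Notation C := (R[i]).
Local Notation Re := (@complex.Re R).
Local Notation Im := (@complex.Im R).
Variable (b : R).
Hypothesis b0 : 0 < b.
Implicit Types (f g h : R -> C).

(** Restricted to [-b, b], because the functions of the problem are arbitrary outside it. *)
Definition ucont g := forall e, 0 < e -> exists2 d, 0 < d &
  forall s t, - b <= s -> s <= t -> t <= b -> t - s <= d -> norm1 (g t - g s) <= e.

(** Retraction of the line onto [-b, b]. Composition with it yields functions continuous on the
    whole line, from which measurability and extreme values are obtained. *)
Let clamp (x : R) := Num.min b (Num.max (- b) x).

Lemma clamp_in x : - b <= clamp x <= b.
Proof.
rewrite /clamp le_min ge_min lexx/= andbT le_max lexx/= andbT.
by rewrite (le_trans _ (ltW b0))// oppr_le0 ltW.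
Qed.

Lemma clamp_id x : - b <= x <= b -> clamp x = x.
Proof. by move=> /andP[bx xb]; rewrite /clamp max_r// min_r. Qed.

Lemma clamp_mono x y : x <= y -> clamp x <= clamp y /\ clamp y - clamp x <= y - x.
Proof.
move=> xy; rewrite /clamp /Num.min /Num.max.
by repeat case: ifP => //; move=> *; split; lra.
Qed.

Lemma ucont_clamp (g : R -> C) : ucont g ->
  continuous (fun x => Re (g (clamp x))) /\ continuous (fun x => Im (g (clamp x))).
Proof.
move=> ug.
have key x e : 0 < e -> \forall y \near x, norm1 (g (clamp x) - g (clamp y)) <= e.
  move=> e0; have [d d0 H] := ug _ e0.
  near=> y.
  have yx : `|x - y| <= d by near: y; apply: (@cvgr_dist_le _ R^o) => //; exact: cvg_id.
  have [xy|/ltW xy] := leP x y.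
    rewrite norm1_distC; have [m l] := clamp_mono xy.
    have /andP[cx _] := clamp_in x; have /andP[_ cy] := clamp_in y.
    apply: H => //; apply: le_trans l _.
    by rewrite -[y - x]ger0_norm ?subr_ge0// distrC.
  have [m l] := clamp_mono xy.
  have /andP[_ cx] := clamp_in x; have /andP[cy _] := clamp_in y.
  apply: H => //; apply: le_trans l _.
  by rewrite -[x - y]ger0_norm ?subr_ge0.
split=> x; apply/(@cvgrPdist_le _ R^o) => e e0; near=> y.
  apply: (@le_trans _ _ (norm1 (g (clamp x) - g (clamp y)))).
    by rewrite /norm1 !complex_partsE lerDl.
  by near: y; exact: key.
apply: (@le_trans _ _ (norm1 (g (clamp x) - g (clamp y)))).
  by rewrite /norm1 !complex_partsE lerDr.
by near: y; exact: key.
Unshelve. all: by end_near.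
Qed.

Lemma ucont_measurable g : ucont g -> cmeasurable `[- b, b] g.
Proof.
move=> /ucont_clamp[cR cI]; split.
  apply: (eq_measurable_fun (fun x => Re (g (clamp x)))).
    by move=> x; rewrite inE/= in_itv/= => h; rewrite clamp_id.
  by apply: measurable_funTS; exact: continuous_measurable_fun.
apply: (eq_measurable_fun (fun x => Im (g (clamp x)))).
  by move=> x; rewrite inE/= in_itv/= => h; rewrite clamp_id.
by apply: measurable_funTS; exact: continuous_measurable_fun.
Qed.

Let bb : - b <= b.
Proof. by rewrite (le_trans _ (ltW b0))// oppr_le0 ltW. Qed.

Lemma ucont_bounded g : ucont g ->
  exists2 B, 0 < B & forall x, - b <= x <= b -> norm1 (g x) <= B.
Proof.
move=> /ucont_clamp[cR cI].
have cN : continuous (fun x => norm1 (g (clamp x))).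
  by move=> x; apply: cvgD; apply: cvg_norm; [exact: cR|exact: cI].
have [c _ Hc] := EVT_max bb (continuous_subspaceT cN).
exists (norm1 (g (clamp c)) + 1); first by rewrite ltr_wpDl// norm1_ge0.
move=> x xb; have := Hc x; rewrite in_itv/= => /(_ xb).
by rewrite clamp_id// => /le_trans; apply; rewrite lerDl.
Qed.

Lemma ucont_cst (k : C) : ucont (cst k).
Proof.
by move=> e e0; exists 1 => // s t _ _ _ _; rewrite subrr norm10 ltW.
Qed.

Lemma ucontM g h : ucont g -> ucont h -> ucont (fun x => g x * h x).
Proof.
move=> ug uh e e0.
have [B B0 HB] := ucont_bounded ug; have [B' B'0 HB'] := ucont_bounded uh.
have e1 : 0 < e / (2 * B') by rewrite divr_gt0// mulr_gt0.
have e2 : 0 < e / (2 * B) by rewrite divr_gt0// mulr_gt0.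
have [d d0 Hd] := ug _ e1; have [d' d'0 Hd'] := uh _ e2.
exists (Num.min d d'); first by rewrite lt_min d0.
move=> s t bs st tb; rewrite le_min => /andP[td td'].
rewrite (_ : _ - _ = (g t - g s) * h t + g s * (h t - h s)); last by ring.
have sb : s <= b by exact: le_trans tb.
have bt : - b <= t by exact: le_trans st.
apply: le_trans (norm1D _ _) _.
apply: (@le_trans _ _ (e / (2 * B') * B' + B * (e / (2 * B)))).
  apply: lerD; apply: le_trans (norm1M _ _) _; apply: ler_pM; rewrite ?norm1_ge0//.
  - exact: Hd.
  - by apply: HB'; rewrite bt.
  - by apply: HB; rewrite bs.
  - exact: Hd'.
rewrite le_eqVlt; apply/orP; left; apply/eqP; field.
by rewrite !gt_eqF.
Qed.

Lemma norm1V (z : C) : z != 0 ->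
  norm1 z^-1 = norm1 z / (Re z ^+ 2 + Im z ^+ 2).
Proof.
case: z => x y z0; rewrite /norm1 /= normrN !normf_div -mulrDl.
by rewrite (@ger0_norm _ (x ^+ 2 + _)) ?addr_ge0 ?sqr_ge0.
Qed.

(** By compactness |f|^2 has a positive minimum m, so 1/f is bounded by B/m, and the difference of
    two inverses is the difference of the values times the product of the inverses. *)
Lemma ucontV f : ucont f -> (forall s, - b <= s <= b -> f s != 0) ->
  ucont (fun x => (f x)^-1).
Proof.
move=> uf f0; have [B B0 HB] := ucont_bounded uf.
have [cR cI] := ucont_clamp uf.
have cN : continuous (fun x => Re (f (clamp x)) ^+ 2 + Im (f (clamp x)) ^+ 2).
  by move=> x; apply: cvgD; apply: cvgM; try exact: cR; exact: cI.
have [c cb Hc] := EVT_min bb (continuous_subspaceT cN).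
move: Hc; set m := _ + _ => Hc.
have m0 : 0 < m.
  rewrite lt_def addr_ge0 ?sqr_ge0// andbT paddr_eq0 ?sqr_ge0// !sqrf_eq0.
  have := f0 _ (clamp_in c); case: (f (clamp c)) => x y.
  by rewrite eq_complex.
have HV x : - b <= x <= b -> norm1 (f x)^-1 <= B / m.
  move=> xb; rewrite norm1V ?f0//.
  have := Hc x; rewrite in_itv/= => /(_ xb); rewrite clamp_id// => mx.
  have m'0 := lt_le_trans m0 mx.
  rewrite ler_pM ?norm1_ge0 ?invr_ge0 ?(ltW m'0) ?HB//.
  by rewrite lef_pV2 ?posrE.
have Bm : 0 < B / m by rewrite divr_gt0.
move=> e e0; have e1 : 0 < e / (B / m * (B / m)) by rewrite divr_gt0// mulr_gt0.
have [d d0 Hd] := uf _ e1; exists d => // s t bs st tb td.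
have sb : - b <= s <= b by rewrite bs (le_trans st).
have bt : - b <= t <= b by rewrite tb (le_trans bs).
have -> : (f t)^-1 - (f s)^-1 = - (f t - f s) * ((f t)^-1 * (f s)^-1).
  by field; rewrite !f0.
apply: le_trans (norm1M _ _) _; rewrite norm1N.
apply: (@le_trans _ _ (e / (B / m * (B / m)) * (B / m * (B / m)))); last first.
  by rewrite divfK// gt_eqF// mulr_gt0.
apply: ler_pM; rewrite ?norm1_ge0 ?Hd//.
by apply: le_trans (norm1M _ _) _; apply: ler_pM; rewrite ?norm1_ge0 ?HV.
Qed.

End UniformContinuity.

(** * Integral form of the derivative; product, quotient and limit rules *)

Section AbsolutelyContinuous.
Context {R : realType}.
Local Notation mu := (@lebesgue_measure R).
Local Notation C := (R[i]).
Variable (b : R).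
Hypothesis b0 : 0 < b.
Implicit Types (f g h y dy : R -> C).

(** The form of [ac_with_derivative] without base point or orientation, suited to subdividing
    intervals. *)
Definition abs_cont y dy := cintegrable `[- b, b] dy /\
  forall s t, - b <= s -> s <= t -> t <= b -> y t - y s = cintegral `[s, t] dy.

Lemma sub_itvb s t : - b <= s -> t <= b -> `[s, t]%classic `<=` `[- b, b]%classic.
Proof. by move=> bs tb; apply: subset_itv; rewrite bnd_simp. Qed.

Lemma cintegrable_sub g s t : - b <= s -> t <= b ->
  cintegrable `[- b, b] g -> cintegrable `[s, t] g.
Proof. by move=> bs tb; apply: cintegrableS => //; exact: sub_itvb. Qed.

Lemma abs_cont_of_derivative y dy : ac_with_derivative b y dy -> abs_cont y dy.
Proof.
move=> [Idy Hy]; split=> // s t bs st tb.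
rewrite (Hy s) ?bs ?(le_trans st)// (Hy t) ?tb ?(le_trans bs)//.
rewrite opprD addrACA subrr add0r /ointegral; have [s0|s0] := leP 0 s.
  rewrite (le_trans s0 st) (@cintegral_chasles _ 0 s t)//.
    by rewrite addrC addKr.
  by apply: cintegrable_sub => //; rewrite oppr_le0 ltW.
have [t0|t0] := leP 0 t.
  rewrite opprK (@cintegral_chasles _ s 0 t) ?(ltW s0)// 1?addrC//.
  exact: cintegrable_sub.
rewrite opprK (@cintegral_chasles _ s t 0) ?(ltW t0)//.
  by rewrite addrC addrK.
by apply: cintegrable_sub => //; exact: ltW.
Qed.

Lemma derivative_of_abs_cont y dy : abs_cont y dy -> ac_with_derivative b y dy.
Proof.
move=> [Idy Hy]; split=> // x /andP[bx xb]; rewrite /ointegral.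
have [x0|/ltW x0] := leP 0 x.
  by rewrite -Hy ?oppr_le0 ?(ltW b0)// addrC subrK.
by rewrite -Hy ?(ltW b0)// opprB addrC subrK.
Qed.

Lemma abs_cont_ointegral (y0 : C) dy : cintegrable `[- b, b] dy ->
  abs_cont (fun x => y0 + ointegral 0 x dy) dy.
Proof.
move=> Idy; apply: abs_cont_of_derivative; split=> // x _.
by rewrite {2}/ointegral lexx cintegral_set1 addr0.
Qed.

Lemma abs_cont_cst (k : C) : abs_cont (cst k) (cst 0).
Proof.
have I0 : cintegrable `[- b, b] (cst (0 : C)).
  by split; apply: eq_integrable (integrable0 _ _).
by split=> // s t _ _ _; rewrite subrr /cintegral !Rintegral_cst// !mul0r.
Qed.

Lemma abs_contD y1 dy1 y2 dy2 : abs_cont y1 dy1 -> abs_cont y2 dy2 ->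
  abs_cont (fun x => y1 x + y2 x) (fun x => dy1 x + dy2 x).
Proof.
move=> [I1 H1] [I2 H2]; split; first exact: cintegrableD.
move=> s t bs st tb; rewrite cintegralD//; try exact: cintegrable_sub.
by rewrite -H1// -H2//; ring.
Qed.

Lemma abs_contZ (k : C) y dy : abs_cont y dy -> abs_cont (fun x => k * y x) (fun x => k * dy x).
Proof.
move=> [I1 H1]; split; first exact: cintegrableZ.
move=> s t bs st tb; rewrite cintegralZ//; last exact: cintegrable_sub.
by rewrite -H1//; ring.
Qed.

Lemma eq_abs_cont y y' dy dy' : (forall x, - b <= x <= b -> y x = y' x) ->
  (forall x, - b <= x <= b -> dy x = dy' x) -> abs_cont y dy -> abs_cont y' dy'.
Proof.
move=> yy dd [I1 H1].
have dd' s t : - b <= s -> t <= b -> forall x, `[s, t]%classic x -> dy x = dy' x.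
  by move=> bs tb x /(sub_itvb bs tb); rewrite /= in_itv/=; exact: dd.
split; first by apply: eq_cintegrable I1 => //; exact: dd'.
move=> s t bs st tb; rewrite -!yy ?bs ?tb ?(le_trans bs st) ?(le_trans st tb)//.
by rewrite H1//; apply: eq_cintegral => //; exact: dd'.
Qed.

Lemma abs_cont_ucont y dy : abs_cont y dy -> ucont b y.
Proof.
move=> [I1 H1] e e0.
have mb : measurable (`[- b, b]%classic : set R) by [].
pose G := (fun x => norm1 (dy x)) \_ `[- b, b].
have IG : mu.-integrable setT (EFin \o G).
  rewrite /G -restrict_EFin.
  have [h _] := integrable_mkcond (mu := mu) (EFin \o (fun x => norm1 (dy x))) mb.
  by apply: h; exact: norm1_integrable.
have [d [d0 Hd]] := integral_normr_continuous IG e0.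
(* Halved, because the measure of the interval has to be strictly below d. *)
exists (d / 2); first by rewrite divr_gt0.
move=> s t bs st tb td; rewrite H1//.
have I2 := cintegrable_sub bs tb I1.
apply: le_trans (norm1_cintegral _ I2) _ => //.
have mst : (mu `[s, t] < d%:E)%E.
  rewrite lebesgue_measure_itv/= lte_fin.
  case: ifP => _; last by rewrite lte_fin.
  by rewrite -EFinB lte_fin (le_lt_trans td)// ltr_pdivrMr// ltr_pMr// ltr1n.
have /ltW := Hd `[s, t]%classic (measurable_itv _) mst.
apply: le_trans.
rewrite le_eqVlt; apply/orP; left; apply/eqP; apply: eq_Rintegral => x.
move=> /[!inE] /(sub_itvb bs tb) xb; rewrite /G patchE mem_set//.
by rewrite ger0_norm// norm1_ge0.
Qed.

Lemma norm1_small_eq0 (z : C) (T : R) : 0 <= T -> (forall e, 0 < e -> norm1 z <= e * T) -> z = 0.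
Proof.
move=> T0 H; apply: norm1_eq0; apply/eqP; rewrite eq_le norm1_ge0 andbT.
rewrite leNgt; apply/negP => z0.
have e0 : 0 < norm1 z / (2 * (T + 1)) by rewrite divr_gt0// mulr_gt0// ltr_wpDl.
have := H _ e0; rewrite leNgt => /negP; apply.
have T1 : 0 < 2 * (T + 1) by rewrite mulr_gt0// ltr_wpDl.
by rewrite mulrAC ltr_pdivrMr// ltr_pM2l//; lra.
Qed.

(* The defect h(t) - h(s) - int_s^t (p1 dy1 + p2 dy2) is additive in the interval
   and at most e times the integral of |dy1| + |dy2| on intervals of length d;
   this yields the product and quotient rules. *)
Lemma abs_cont_comp y1 dy1 y2 dy2 h (F1 F2 : R -> R -> C) (p1 p2 : R -> C) :
  abs_cont y1 dy1 -> abs_cont y2 dy2 -> ucont b p1 -> ucont b p2 ->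
  (forall s t, - b <= s -> s <= t -> t <= b ->
     h t - h s = F1 s t * (y1 t - y1 s) + F2 s t * (y2 t - y2 s)) ->
  (forall e, 0 < e -> exists2 d, 0 < d & forall s r t,
     - b <= s -> s <= r -> r <= t -> t <= b -> t - s <= d ->
     norm1 (F1 s t - p1 r) <= e /\ norm1 (F2 s t - p2 r) <= e) ->
  abs_cont h (fun x => p1 x * dy1 x + p2 x * dy2 x).
Proof.
move=> [I1 H1] [I2 H2] u1 u2 Hh HF.
set g := fun x => _.
have [B1 _ HB1] := ucont_bounded b0 u1.
have [B2 _ HB2] := ucont_bounded b0 u2.
have Ip1 : cintegrable `[- b, b] (fun x => p1 x * dy1 x).
  by apply: (@cintegrableM_bounded _ _ _ _ _ B1) => //; exact: ucont_measurable.
have Ip2 : cintegrable `[- b, b] (fun x => p2 x * dy2 x).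
  by apply: (@cintegrableM_bounded _ _ _ _ _ B2) => //; exact: ucont_measurable.
have Ig : cintegrable `[- b, b] g by exact: cintegrableD.
pose G x := norm1 (dy1 x) + norm1 (dy2 x).
have IG : mu.-integrable `[- b, b] (EFin \o G).
  rewrite (_ : _ \o _ = (EFin \o (fun x => norm1 (dy1 x))) \+ (EFin \o (fun x => norm1 (dy2 x))))%E//.
  by apply: integrableD => //; exact: norm1_integrable.
have IGst s t : - b <= s -> t <= b -> mu.-integrable `[s, t] (EFin \o G).
  by move=> bs tb; apply: (@integrableS _ _ R mu _ _ _ _ _ (sub_itvb bs tb) IG).
have G0 x : 0 <= G x by rewrite addr_ge0// norm1_ge0.
pose T s t := \int[mu]_(x in `[s, t]) G x.
have Tadd s r t : - b <= s -> s <= r -> r <= t -> t <= b -> T s t = T s r + T r t.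
  move=> bs sr rt tb; rewrite /T; apply/eqP; rewrite addrC -subr_eq; apply/eqP.
  rewrite Rintegral_itvB ?bnd_simp//; last exact: IGst.
  rewrite Rintegral_itv_obnd_cbnd//.
  apply: (@integrableS _ _ R mu `[s, t]%classic) => //; last exact: IGst.
  by apply: subset_itv; rewrite bnd_simp.
have T0 s t : 0 <= T s t by apply: Rintegral_ge0 => x _.
have local e : 0 < e -> exists2 d, 0 < d & forall s t, - b <= s -> s <= t -> t <= b ->
    t - s <= d -> norm1 (h t - h s - cintegral `[s, t] g) <= e * T s t.
  move=> e0; have [d d0 Hd] := HF _ e0; exists d => // s t bs st tb td.
  have sub := fun k => @cintegrable_sub k s t bs tb.
  have -> : h t - h s - cintegral `[s, t] g =
      cintegral `[s, t] (fun x => (F1 s t - p1 x) * dy1 x + (F2 s t - p2 x) * dy2 x).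
    rewrite Hh// H1// H2// -!cintegralZ//; try exact: sub.
    rewrite -cintegralD//; try by apply: cintegrableZ => //; exact: sub.
    rewrite -cintegralB//; last exact: sub.
      by apply: eq_cintegral => // x _; rewrite /g; ring.
    by apply: cintegrableD => //; apply: cintegrableZ => //; exact: sub.
  rewrite /T -RintegralZl//; last exact: IGst.
  apply: norm1_cintegral_le => //.
  - have E x : `[s, t]%classic x ->
        F1 s t * dy1 x + F2 s t * dy2 x - g x = (F1 s t - p1 x) * dy1 x + (F2 s t - p2 x) * dy2 x.
      by move=> _; rewrite /g; ring.
    apply: (eq_cintegrable _ E) => //; apply: cintegrableB => //; last exact: sub.
    by apply: cintegrableD => //; apply: cintegrableZ => //; exact: sub.
  - by apply: integrable_EFinZ => //; exact: IGst.
  - move=> x; rewrite /= in_itv/= => /andP[sx xt].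
    have [h1 h2] := Hd _ _ _ bs sx xt tb td.
    apply: le_trans (norm1D _ _) _; rewrite /G mulrDr.
    by apply: lerD; apply: le_trans (norm1M _ _) _; rewrite ler_wpM2r ?norm1_ge0.
split=> // s t bs st tb; apply/eqP; rewrite -subr_eq0; apply/eqP.
apply: (@norm1_small_eq0 _ (T s t)) => // e e0.
have [d d0 Hd] := local _ e0.
(* Induction on the number n of pieces of length at most d covering [s, t]; the last piece starts at
   max(s, t - d). *)
suff H n : forall t, s <= t -> t <= b -> t - s <= n%:R * d ->
    norm1 (h t - h s - cintegral `[s, t] g) <= e * T s t.
  have ar : t - s <= (Num.truncn ((t - s) / d)).+1%:R * d.
    by rewrite -ler_pdivrMr// ltW// truncnS_gt.
  exact: H ar.
elim: n => [|n IH] {st tb}t st tb tn.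
  rewrite mul0r in tn; have -> : t = s by apply/eqP; rewrite eq_le st andbT; lra.
  by rewrite subrr cintegral_set1 subrr norm10 mulr_ge0// ltW.
pose r := Num.max s (t - d).
have [sr rt rd rn] : [/\ s <= r, r <= t, t - r <= d & r - s <= n%:R * d].
  move: tn; rewrite -natr1 mulrDl mul1r => tn.
  have nd : 0 <= n%:R * d by rewrite mulr_ge0// ltW.
  by rewrite /r /Num.max; case: ltP => ?; split; lra.
rewrite (@cintegral_chasles _ s r t)//; last exact: cintegrable_sub.
rewrite (Tadd s r t)// mulrDr.
rewrite (_ : _ - _ = (h r - h s - cintegral `[s, r] g) +
  (h t - h r - cintegral `[r, t] g)); last by ring.
apply: le_trans (norm1D _ _) _; apply: lerD.
  by apply: IH => //; exact: le_trans tb.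
by apply: Hd => //; exact: le_trans sr.
Qed.

(** The increment of the product over [s, t] is y2(s) (y1(t) - y1(s)) + y1(t) (y2(t) - y2(s)), and
    the two coefficients are uniformly close to y2(r) and y1(r) for r in a short [s, t]. *)
Lemma abs_contM y1 dy1 y2 dy2 : abs_cont y1 dy1 -> abs_cont y2 dy2 ->
  abs_cont (fun x => y1 x * y2 x) (fun x => y2 x * dy1 x + y1 x * dy2 x).
Proof.
move=> a1 a2; have u1 := abs_cont_ucont a1; have u2 := abs_cont_ucont a2.
apply: (@abs_cont_comp _ _ _ _ _ (fun s t => y2 s) (fun s t => y1 t) _ _ a1 a2) => //.
  by move=> s t _ _ _; ring.
move=> e e0; have [d d0 Hd] := u1 _ e0; have [d' d'0 Hd'] := u2 _ e0.
exists (Num.min d d'); first by rewrite lt_min d0.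
move=> s r t bs sr rt tb; rewrite le_min => /andP[td td']; split.
  by rewrite norm1_distC; apply: Hd' => //; [exact: le_trans rt tb|lra].
by apply: Hd => //; [exact: le_trans bs sr|lra].
Qed.

Lemma abs_contV f df : abs_cont f df -> (forall s, - b <= s <= b -> f s != 0) ->
  abs_cont (fun x => (f x)^-1) (fun x => - ((f x)^-1 * (f x)^-1) * df x).
Proof.
move=> af f0; have uf := abs_cont_ucont af; have uV := ucontV b0 uf f0.
pose p x := - ((f x)^-1 * (f x)^-1).
have up : ucont b p.
  have := ucontM b0 (ucont_cst b (-1)) (ucontM b0 uV uV).
  by congr ucont; apply/funext => x; rewrite /p mulN1r.
apply: (@eq_abs_cont (fun x => (f x)^-1) _ (fun x => p x * df x + 0 * df x)) => //.
  by move=> x _; rewrite mul0r addr0.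
(* There is only one function to differentiate; the second slot is filled by f again, with
   coefficient 0. *)
apply: (@abs_cont_comp _ _ _ _ _ (fun s t => - ((f s)^-1 * (f t)^-1)) (fun _ _ => 0)
  p (cst 0) af af) => //; first exact: ucont_cst.
  move=> s t bs st tb; have f0s : f s != 0 by rewrite f0// bs (le_trans st).
  have f0t : f t != 0 by rewrite f0// tb (le_trans bs).
  by field; rewrite f0s f0t.
have [B B0 HB] := ucont_bounded b0 uV.
move=> e e0; have e1 : 0 < e / (2 * B) by rewrite divr_gt0// mulr_gt0.
have [d d0 Hd] := uV _ e1; exists d => // s r t bs sr rt tb td.
rewrite subrr norm10 (ltW e0); split=> //.
have bt : - b <= t <= b by rewrite tb (le_trans bs)// (le_trans sr).
have br : - b <= r <= b by rewrite (le_trans bs sr) (le_trans rt tb).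
rewrite /p (_ : _ - _ = ((f r)^-1 - (f s)^-1) * (f t)^-1 -
  ((f t)^-1 - (f r)^-1) * (f r)^-1); last by ring.
apply: le_trans (norm1D _ _) _; rewrite norm1N.
apply: (@le_trans _ _ (e / (2 * B) * B + e / (2 * B) * B)); last first.
  by rewrite le_eqVlt; apply/orP; left; apply/eqP; field; rewrite gt_eqF.
have /andP[? ?] := br; have /andP[? ?] := bt.
by apply: lerD; apply: le_trans (norm1M _ _) _; apply: ler_pM; rewrite ?norm1_ge0 ?HB// Hd//; lra.
Qed.

Lemma abs_cont_lim (Y_ dY_ : nat -> R -> C) y dy (e_ : nat -> R) :
  (forall n, abs_cont (Y_ n) (dY_ n)) -> cintegrable `[- b, b] dy ->
  e_ @ \oo --> 0 ->
  (forall n x, - b <= x <= b -> norm1 (Y_ n x - y x) <= e_ n) ->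
  (forall n x, - b <= x <= b -> norm1 (dY_ n x - dy x) <= e_ n) ->
  abs_cont y dy.
Proof.
move=> aY Idy e_0 HY HdY; split=> // s t bs st tb.
apply/eqP; rewrite -subr_eq0; apply/eqP.
(* Two errors at the endpoints, and one integrated over a length of at most 2b. *)
apply: (@norm1_small_eq0 _ (2 + 2 * b)) => [|e e0].
  by rewrite addr_ge0// mulr_ge0// ltW.
move/cvgrPdist_le : e_0 => /(_ _ e0)[n _ /(_ n (leqnn n))].
rewrite sub0r normrN => en; have {}en : e_ n <= e by rewrite (le_trans (ler_norm _)).
have bb : - b <= s <= b by rewrite bs (le_trans st).
have bt : - b <= t <= b by rewrite tb (le_trans bs).
have [In Hn] := aY n.
have sub k := @cintegrable_sub k s t bs tb.
rewrite (_ : _ - _ = - (Y_ n t - y t) + (Y_ n s - y s) +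
   cintegral `[s, t] (fun x => dY_ n x - dy x)); last first.
  by rewrite cintegralB//; [rewrite -Hn//; ring|exact: sub|exact: sub].
apply: le_trans (norm1D _ _) _; rewrite mulrDr; apply: lerD.
  apply: le_trans (norm1D _ _) _; rewrite norm1N.
  by have := HY n _ bb; have := HY n _ bt; lra.
have cst_int (k : R) : mu.-integrable `[s, t] (EFin \o cst k).
  apply: continuous_compact_integrable; first exact: segment_compact.
  by apply: continuous_subspaceT => x; exact: cvg_cst.
apply: (@le_trans _ _ (\int[mu]_(x in `[s, t]) e)).
  apply: norm1_cintegral_le => //.
  - by apply: cintegrableB => //; exact: sub.
  - exact: cst_int.
  - move=> x /(sub_itvb bs tb); rewrite /= in_itv/= => xb.
    exact: le_trans (HdY n x xb) en.
rewrite Rintegral_cst//= ler_wpM2l ?(ltW e0)// lebesgue_measure_itv/=.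
by case: ifP => _ /=; [lra|rewrite mulr_ge0// ltW].
Qed.

End AbsolutelyContinuous.

(** * Spectral parameter power series *)

Section GeometricSeries.
Context {R : realType}.
Local Notation C := (R[i]).
Local Notation Re := (@complex.Re R).
Local Notation Im := (@complex.Im R).

Lemma geometric_tail (a : nat -> R) (r : R) : 0 <= r <= 2^-1 ->
  (forall k, `|a k| <= r ^+ k) ->
  exists s, forall N, `|s - \sum_(0 <= k < N) a k| <= 2 * r ^+ N.
Proof.
move=> /andP[r0 r2] ar.
(* The constant 2 bounds 1/(1 - r); the factor 1 - 2^{-M} makes the estimate inductive in M. *)
have tail N M : `|\sum_(N <= k < N + M) a k| <= 2 * r ^+ N * (1 - 2^-1 ^+ M).
  elim: M => [|M IH]; first by rewrite addn0 big_geq// normr0 expr0 subrr mulr0.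
  rewrite addnS big_nat_recr ?leq_addr//= (le_trans (ler_normD _ _))//.
  have := ar (N + M)%N; rewrite exprD => h.
  have : r ^+ N * r ^+ M <= r ^+ N * 2^-1 ^+ M.
    by rewrite ler_wpM2l ?exprn_ge0// lerXn2r// nnegrE.
  move: IH h; rewrite exprS.
  by move: (r ^+ N) (r ^+ M) (2^-1 ^+ M) => A B D; lra.
have tail' N M : (N <= M)%N ->
    `|\sum_(0 <= k < M) a k - \sum_(0 <= k < N) a k| <= 2 * r ^+ N.
  move=> NM; rewrite (big_cat_nat _ NM)//= addrAC subrr add0r -(subnKC NM).
  apply: le_trans (tail _ _) _; rewrite ler_piMr ?mulr_ge0 ?exprn_ge0//.
have c : cvgn (series a).
  apply/normed_cvg/(series_le_cvg (v_ := geometric 1 r)) => [n|n|n|] /=.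
  - exact: normr_ge0.
  - by rewrite mulr_ge0 ?exprn_ge0.
  - by rewrite mul1r.
  - apply: is_cvg_geometric_series; rewrite ger0_norm// (le_lt_trans r2)//.
    by rewrite invf_lt1// ltr1n.
exists (limn (series a)) => N.
have h : `|series a M - \sum_(0 <= k < N) a k| @[M --> \oo] -->
   `|limn (series a) - \sum_(0 <= k < N) a k|.
  by apply: cvg_norm; apply: cvgB => //; exact: cvg_cst.
by apply: (cvgr_to_le h); exists N => // M /= NM; exact: tail'.
Qed.

Lemma cgeometric_tail (a : nat -> C) (r : R) : 0 <= r <= 2^-1 ->
  (forall k, norm1 (a k) <= r ^+ k) ->
  exists s, forall N, norm1 (s - \sum_(0 <= k < N) a k) <= 4 * r ^+ N.
Proof.
move=> r01 ar.
have [|s Hs] := @geometric_tail (fun k => Re (a k)) r r01.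
  by move=> k; apply: le_trans (ar k); rewrite lerDl.
have [|t Ht] := @geometric_tail (fun k => Im (a k)) r r01.
  by move=> k; apply: le_trans (ar k); rewrite lerDr.
exists (s +i* t) => N; rewrite /norm1 !complex_partsE Re_sum Im_sum /=.
by have := Hs N; have := Ht N; lra.
Qed.

(** The tail is compared termwise through (N+k)! >= k!. *)
Lemma expR_taylor (z : R) (N : nat) :
  `|expR z - \sum_(0 <= k < N) z ^+ k / k`!%:R| <= `|z| ^+ N * expR `|z|.
Proof.
have h : `|series (exp_coeff z) M - \sum_(0 <= k < N) z ^+ k / k`!%:R| @[M --> \oo] -->
   `|expR z - \sum_(0 <= k < N) z ^+ k / k`!%:R|.
  apply: cvg_norm; apply: cvgB; last exact: cvg_cst.
  exact: is_cvg_series_exp_coeff.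
apply: (cvgr_to_le h); exists N => // M /= NM.
rewrite /series/= (big_cat_nat _ NM)//= addrAC subrr add0r.
rewrite (le_trans (ler_norm_sum _ _ _))//.
rewrite -{1}[N]add0n big_addn.
have nd : nondecreasing_seq (series (exp_coeff `|z|)).
  apply/nondecreasing_seqP => k; rewrite /series/= big_nat_recr//= lerDl.
  by rewrite /exp_coeff/= divr_ge0// exprn_ge0.
have le1 := nondecreasing_cvgn_le nd (is_cvg_series_exp_coeff _) (M - N)%N.
apply: (@le_trans _ _ (`|z| ^+ N * series (exp_coeff `|z|) (M - N)%N)); last first.
  by rewrite ler_wpM2l// exprn_ge0.
rewrite /series/= mulr_sumr; apply: ler_sum => k _.
rewrite /exp_coeff/= normrM normrX [`|_^-1|]ger0_norm ?invr_ge0//.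
rewrite addnC exprD -mulrA ler_wpM2l ?exprn_ge0// ler_wpM2l ?exprn_ge0//.
rewrite lef_pV2 ?posrE ?ltr0n ?fact_gt0// ler_nat.
by apply: leq_fact; exact: leq_addl.
Qed.

(** Uniqueness of asymptotic expansions at 0+: if d n is the first nonzero coefficient, N = n+1
    gives |d n| <= M t for all small t > 0. *)
Lemma expansion_unique (d : nat -> C) (r : R) : 0 < r ->
  (forall N, exists M, forall t : R, 0 < t <= r ->
    norm1 (\sum_(0 <= k < N) (t ^+ k)%:C * d k) <= M * t ^+ N) ->
  forall k, d k = 0.
Proof.
move=> r0 H k; elim/ltn_ind: k => n IH.
have [M HM] := H n.+1.
have M0 : 0 <= M.
  have := HM r; rewrite r0 lexx => /(_ isT) /(le_trans (norm1_ge0 _)).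
  by rewrite pmulr_lge0// exprn_gt0.
apply: norm1_eq0; apply/eqP; rewrite eq_le norm1_ge0 andbT leNgt; apply/negP => dn.
(* Chosen so that M t < |d n|; the summand 1 allows M = 0. *)
pose t := Num.min r (norm1 (d n) / (2 * (M + 1))).
have M1 : 0 < 2 * (M + 1) by rewrite mulr_gt0// ltr_wpDl.
have t0 : 0 < t by rewrite lt_min r0 divr_gt0.
have tr : 0 < t <= r by rewrite t0 ge_min lexx.
have := HM t tr; rewrite big_nat_recr//= big_nat big1 ?add0r; last first.
  by move=> j /andP[_ jn]; rewrite IH ?mulr0.
have -> : norm1 ((t ^+ n)%:C * d n) = t ^+ n * norm1 (d n).
  rewrite /norm1 !complex_partsE /= !mul0r subr0 addr0 !normrM (@ger0_norm _ (t ^+ n)) ?exprn_ge0 ?ltW//.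
  by rewrite mulrDr.
rewrite exprS (_ : M * (t * t ^+ n) = t ^+ n * (M * t)); last by ring.
rewrite ler_pM2l ?exprn_gt0// leNgt => /negP; apply.
have td : t <= norm1 (d n) / (2 * (M + 1)) by rewrite ge_min lexx orbT.
apply: (@le_lt_trans _ _ (M * (norm1 (d n) / (2 * (M + 1))))); first by rewrite ler_wpM2l.
by rewrite mulrA ltr_pdivrMr// mulrC ltr_pM2l//; lra.
Qed.

End GeometricSeries.

Section OrientedIntegral.
Context {R : realType}.
Local Notation mu := (@lebesgue_measure R).
Local Notation C := (R[i]).
Variable (b : R).
Hypothesis b0 : 0 < b.
Implicit Types (g h : R -> C).

Lemma cst_integrable_itv (s t k : R) : mu.-integrable `[s, t] (EFin \o cst k).
Proof.
apply: continuous_compact_integrable; first exact: segment_compact.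
by apply: continuous_subspaceT => x; exact: cvg_cst.
Qed.

Lemma ucont_integrable g : ucont b g -> cintegrable `[- b, b] g.
Proof.
move=> ug; have [B B0 HB] := ucont_bounded b0 ug.
apply: (@cintegrable_le _ _ _ _ (cst B)) => //.
- exact: ucont_measurable.
- exact: cst_integrable_itv.
Qed.

Lemma eq_ointegral x g h : - b <= x <= b -> (forall s, - b <= s <= b -> g s = h s) ->
  ointegral 0 x g = ointegral 0 x h.
Proof.
move=> /andP[bx xb] gh; rewrite /ointegral; have [x0|/ltW x0] := leP 0 x.
  apply: eq_cintegral => // s; rewrite /= in_itv/= => /andP[s0 sx].
  by apply: gh; rewrite (le_trans sx xb) (le_trans _ s0)// oppr_le0 ltW.
congr (- _); apply: eq_cintegral => // s; rewrite /= in_itv/= => /andP[xs s0].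
by apply: gh; rewrite (le_trans bx xs) (le_trans s0)// ltW.
Qed.

Lemma ointegralZ x (k : C) g : - b <= x <= b -> cintegrable `[- b, b] g ->
  ointegral 0 x (fun s => k * g s) = k * ointegral 0 x g.
Proof.
move=> /andP[bx xb] Ig; rewrite /ointegral; case: ifP => _.
  rewrite cintegralZ//; apply: (cintegrable_sub (b := b)) => //.
  by rewrite oppr_le0 ltW.
rewrite cintegralZ ?mulrN//; apply: (cintegrable_sub (b := b)) => //.
exact: ltW.
Qed.

Lemma norm1_ointegral x (c : R) g : - b <= x <= b -> cintegrable `[- b, b] g -> 0 <= c ->
  (forall s, - b <= s <= b -> norm1 (g s) <= c) -> norm1 (ointegral 0 x g) <= c * b.
Proof.
move=> /andP[bx xb] Ig c0 Hc; rewrite /ointegral.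
have key s t : - b <= s -> s <= t -> t <= b -> t - s <= b -> norm1 (cintegral `[s, t] g) <= c * b.
  move=> bs st tb tsb.
  apply: (@le_trans _ _ (\int[mu]_(x in `[s, t]) c)).
    apply: norm1_cintegral_le => //.
    - exact: (cintegrable_sub (b := b)).
    - exact: cst_integrable_itv.
    - by move=> y /(sub_itvb bs tb); rewrite /= in_itv/=; exact: Hc.
  rewrite Rintegral_cst//= ler_wpM2l// lebesgue_measure_itv/=.
  by case: ifP => _ //=; rewrite ltW.
have bn : - b <= 0 by rewrite oppr_le0 ltW.
have [x0|/ltW x0] := leP 0 x; rewrite ?norm1N; apply: key => //; try exact: ltW.
  by rewrite subr0.
by rewrite sub0r lerNl.
Qed.

End OrientedIntegral.

(** * Construction of a solution as a power series in l *)

Section SPPS.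
Context {R : realType}.
Local Notation mu := (@lebesgue_measure R).
Local Notation C := (R[i]).
Variables (b : R) (f wf Q : R -> C).
Hypothesis b0 : 0 < b.
Let df s := wf s + Q s * f s.
Hypothesis af : abs_cont b f df.
Hypothesis aw : abs_cont b wf (fun s => 0 * f s - Q s * df s).
Hypothesis f1 : f 0 = 1.
Hypothesis wf0 : wf 0 = 0.
Hypothesis fn0 : forall s, - b <= s <= b -> f s != 0.

Let b00 : - b <= 0 <= b.
Proof. by rewrite oppr_le0 !ltW. Qed.

Let g2 x := f x * f x.
Let gi x := (f x)^-1 * (f x)^-1.

Let uf : ucont b f. Proof. exact: abs_cont_ucont af. Qed.
Let uV : ucont b (fun x => (f x)^-1). Proof. exact: ucontV. Qed.
Let u2 : ucont b g2. Proof. exact: ucontM. Qed.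
Let ui : ucont b gi. Proof. exact: ucontM. Qed.

(* X~^(n) / n! and X^(n) / n!, exchanged for odd n: then the first component is
   phi_n / (f n!), and differentiation alternates between the two components. *)
Fixpoint spps (n : nat) : (R -> C) * (R -> C) :=
  if n is m.+1 then
    (fun x => 0 + ointegral 0 x (fun s => (spps m).2 s * gi s),
     fun x => 0 + ointegral 0 x (fun s => (spps m).1 s * g2 s))
  else (cst 1, cst 1).

Lemma spps_ucont n : ucont b (spps n).1 /\ ucont b (spps n).2.
Proof.
elim: n => [|n [IH1 IH2]]; first by split; exact: ucont_cst.
by split; apply: (@abs_cont_ucont _ b); apply: abs_cont_ointegral => //;
  apply: ucont_integrable => //; exact: ucontM.
Qed.

Lemma spps_abs_cont n :
  abs_cont b (spps n.+1).1 (fun s => (spps n).2 s * gi s) /\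
  abs_cont b (spps n.+1).2 (fun s => (spps n).1 s * g2 s).
Proof.
have [h1 h2] := spps_ucont n.
by split; apply: abs_cont_ointegral => //; apply: ucont_integrable => //; exact: ucontM.
Qed.

(** The exponents (-1)^n alternate with n; exchanging the two families at odd n leaves the fixed
    weight 1/f^2 in the first component and f^2 in the second. *)
Lemma spps_formal n x : - b <= x <= b ->
  (if odd n then formal_X f n x else formal_Xtilde f n x) = n`!%:R * (spps n).1 x /\
  (if odd n then formal_Xtilde f n x else formal_X f n x) = n`!%:R * (spps n).2 x.
Proof.
elim: n x => [|n IH] x xb; first by rewrite /= mulr1.
have [h1 h2] := spps_ucont n.
have E1 (P : R -> C) : (forall s, - b <= s <= b -> P s = n`!%:R * (spps n).2 s) ->
    n.+1%:R * ointegral 0 x (fun s => P s * (f s ^+ 2) ^ (-1)) = n.+1`!%:R * (spps n.+1).1 x.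
  move=> HP; rewrite factS natrM -mulrA; congr (_ * _).
  rewrite /= add0r -(ointegralZ b0)//; last first.
    by apply: ucont_integrable => //; exact: ucontM.
  apply: (eq_ointegral b0 xb) => s sb; rewrite HP// -mulrA; congr (_ * (_ * _)).
  by rewrite /gi exprN1 expr2 invfM.
have E2 (P : R -> C) : (forall s, - b <= s <= b -> P s = n`!%:R * (spps n).1 s) ->
    n.+1%:R * ointegral 0 x (fun s => P s * (f s ^+ 2) ^ 1) = n.+1`!%:R * (spps n.+1).2 x.
  move=> HP; rewrite factS natrM -mulrA; congr (_ * _).
  rewrite /= add0r -(ointegralZ b0)//; last first.
    by apply: ucont_integrable => //; exact: ucontM.
  by apply: (eq_ointegral b0 xb) => s sb; rewrite HP// -mulrA.
have sE : ((-1) ^+ n : int) = if odd n then -1 else 1.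
  by rewrite -signr_odd; case: odd.
rewrite [odd _]/= [formal_X _ _ _]/= [formal_Xtilde _ _ _]/= exprS sE.
case: (boolP (odd n)) => on /=.
  rewrite mulrNN mulr1; split; [apply: E1|apply: E2] => s sb;
    by have := IH s sb; rewrite on => -[].
rewrite mulr1; split; [apply: E1|apply: E2] => s sb;
  by have := IH s sb; rewrite (negPf on) => -[].
Qed.

(** Each integration from 0 covers a length of at most b and meets a weight bounded by B. *)
Lemma spps_bound : exists2 M, 0 < M & forall n x, - b <= x <= b ->
  norm1 ((spps n).1 x) <= M ^+ n /\ norm1 ((spps n).2 x) <= M ^+ n.
Proof.
have [B1 B10 H1] := ucont_bounded b0 u2; have [B2 B20 H2] := ucont_bounded b0 ui.
pose B := B1 + B2; exists (B * b); first by rewrite mulr_gt0// addr_gt0.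
have M0 : 0 <= B * b by rewrite mulr_ge0 ?addr_ge0 ?ltW.
elim=> [|n IH] x xb; first by rewrite expr0 /= /norm1 /= normr1 normr0 addr0.
have [h1 h2] := spps_ucont n.
rewrite exprSr /= !add0r; rewrite !mulrA.
by split; apply: (norm1_ointegral b0 xb);
  rewrite ?mulr_ge0 ?exprn_ge0 ?addr_ge0 ?(ltW B10) ?(ltW B20)//;
  (try by apply: ucont_integrable => //; exact: ucontM);
  move=> s sb; apply: le_trans (norm1M _ _) _; apply: ler_pM; rewrite ?norm1_ge0//;
  have [] := IH s sb => // *; rewrite /B;
  [rewrite (le_trans (H2 _ sb))// lerDr ltW|rewrite (le_trans (H1 _ sb))// lerDl ltW].
Qed.

(* Y = sum_k l^k (spps k).1 and Z = sum_k l^k (spps k).2 satisfy Y' = l Z / f^2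
   and Z' = l Y f^2, whence v = f Y solves the equation with spectral
   parameter l^2, the quasi-derivative being wf Y + l Z / f. *)
Lemma spps_solution : exists r M : R, [/\ 0 < r, 0 <= M & forall l, 0 < l <= r ->
  exists2 v : R -> C,
    solves_ivp b Q (l%:C ^+ 2) v 1 l%:C &
    forall N x, - b <= x <= b ->
      norm1 (v x - \sum_(0 <= k < N) (l ^+ k)%:C * (f x * (spps k).1 x)) <= M ^+ N * (norm1 (f x) * 4) * l ^+ N].
Proof.
have [M M0 HM] := spps_bound.
(* This radius makes the ratio l M of the dominating geometric series at most 1/2. *)
exists (2 * M)^-1, M; split; [by rewrite invr_gt0 mulr_gt0|exact: ltW|].
move=> l /andP[l0 lr].
have q02 : 0 <= l * M <= 2^-1.
  by rewrite (mulr_ge0 (ltW l0) (ltW M0))/= -ler_pdivlMr// -invfM.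
have n1l k (z : C) : norm1 ((l ^+ k)%:C * z) = l ^+ k * norm1 z.
  rewrite /norm1 !complex_partsE /= !mul0r subr0 addr0 !normrM (@ger0_norm _ (l ^+ k)) ?exprn_ge0 ?ltW//.
  by rewrite mulrDr.
have bnd (P : nat -> R -> C) : (forall k x, - b <= x <= b -> norm1 (P k x) <= M ^+ k) ->
    exists S : R -> C, forall x, - b <= x <= b -> forall N,
      norm1 (S x - \sum_(0 <= k < N) (l ^+ k)%:C * P k x) <= 4 * (l * M) ^+ N.
  move=> HP; have /choice[S HS] : forall x, exists s : C, - b <= x <= b -> forall N,
      norm1 (s - \sum_(0 <= k < N) (l ^+ k)%:C * P k x) <= 4 * (l * M) ^+ N; last by exists S.
  move=> x.
  (* The value 0 outside [-b, b] is arbitrary. *)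
  have [xb|xb] := boolP (- b <= x <= b); last by exists 0.
  have [|s Hs] := @cgeometric_tail R (fun k => (l ^+ k)%:C * P k x) (l * M) q02.
    by move=> k; rewrite n1l exprMn ler_wpM2l ?exprn_ge0 ?(ltW l0)// HP.
  by exists s.
have [|Y HY] := bnd (fun k => (spps k).1); first by move=> k x xb; case: (HM k x xb).
have [|Z HZ] := bnd (fun k => (spps k).2); first by move=> k x xb; case: (HM k x xb).
pose YN N x := \sum_(0 <= k < N) (l ^+ k)%:C * (spps k).1 x.
pose ZN N x := \sum_(0 <= k < N) (l ^+ k)%:C * (spps k).2 x.
(* The truncations satisfy the first-order system exactly, up to a shift of the order by one. *)
have acN N : abs_cont b (YN N.+1) (fun x => l%:C * (ZN N x * gi x)) /\
             abs_cont b (ZN N.+1) (fun x => l%:C * (YN N x * g2 x)).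
  elim: N => [|N [IH1 IH2]].
    split; apply: (eq_abs_cont _ _ (abs_cont_cst b 1)) => x _; rewrite /YN /ZN.
    - by rewrite big_nat1 mulr1.
    - by rewrite big_nil mul0r mulr0.
    - by rewrite big_nat1 mulr1.
    - by rewrite big_nil mul0r mulr0.
  have [a1 a2] := spps_abs_cont N.
  split.
    apply: (eq_abs_cont _ _ (abs_contD IH1 (abs_contZ (l ^+ N.+1)%:C a1))) => x _; rewrite /YN /ZN.
      by rewrite [RHS]big_nat_recr.
    by rewrite [in RHS]big_nat_recr//= exprS rmorphM/=; ring.
  apply: (eq_abs_cont _ _ (abs_contD IH2 (abs_contZ (l ^+ N.+1)%:C a2))) => x _; rewrite /YN /ZN.
    by rewrite [RHS]big_nat_recr.
  by rewrite [in RHS]big_nat_recr//= exprS rmorphM/=; ring.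
have cvg0 (K : R) : (fun N => K * (l * M) ^+ N) @ \oo --> 0.
  rewrite -(mulr0 K); apply: cvgM; first exact: cvg_cst.
  have /andP[q0 q2] := q02; apply: cvg_expr; rewrite ger0_norm// (le_lt_trans q2)//.
  by rewrite invf_lt1// ltr1n.
have /andP[q0 q2] := q02.
have uYN N : ucont b (YN N) /\ ucont b (ZN N).
  case: N => [|N]; last by have [a1 a2] := acN N; split; [exact: abs_cont_ucont a1|exact: abs_cont_ucont a2].
  split; [have -> : YN 0 = cst 0 by apply/funext => x; rewrite /YN big_nil|
    have -> : ZN 0 = cst 0 by apply/funext => x; rewrite /ZN big_nil]; exact: ucont_cst.
have ulim (S : R -> C) (SN : nat -> R -> C) : (forall N, ucont b (SN N)) ->
    (forall x, - b <= x <= b -> forall N, norm1 (S x - SN N x) <= 4 * (l * M) ^+ N) -> ucont b S.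
  move=> uS HS e e0; have e3 : 0 < e / 3 by rewrite divr_gt0.
  have /cvgrPdist_le/(_ _ e3)[N _ /(_ N (leqnn N))] := cvg0 4.
  rewrite sub0r normrN => eN; have {}eN : 4 * (l * M) ^+ N <= e / 3 by rewrite (le_trans (ler_norm _)).
  have [d d0 Hd] := uS N _ e3; exists d => // s t bs st tb td.
  have sb : - b <= s <= b by rewrite bs (le_trans st).
  have tb' : - b <= t <= b by rewrite tb (le_trans bs).
  rewrite (_ : _ - _ = (S t - SN N t) + (SN N t - SN N s) - (S s - SN N s)); last by ring.
  apply: le_trans (norm1D _ _) _; rewrite norm1N.
  have := norm1D (S t - SN N t) (SN N t - SN N s).
  by have := HS _ sb N; have := HS _ tb' N; have := Hd _ _ bs st tb td; lra.
have uY : ucont b Y by apply: (ulim _ YN) => // N; case: (uYN N).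
have uZ : ucont b Z by apply: (ulim _ ZN) => // N; case: (uYN N).
have n1lC z : norm1 (l%:C * z) = l * norm1 z by have := n1l 1%N z; rewrite expr1.
have aclim (S S' g : R -> C) (SN SN' : nat -> R -> C) : ucont b g -> ucont b S' ->
    (forall N, abs_cont b (SN N.+1) (fun x => l%:C * (SN' N x * g x))) ->
    (forall x, - b <= x <= b -> forall N, norm1 (S x - SN N x) <= 4 * (l * M) ^+ N) ->
    (forall x, - b <= x <= b -> forall N, norm1 (S' x - SN' N x) <= 4 * (l * M) ^+ N) ->
    abs_cont b S (fun x => l%:C * (S' x * g x)).
  move=> ug uS' aS HS HS'; have [B B0 HB] := ucont_bounded b0 ug.
  apply: (@abs_cont_lim _ _ b0 (fun N => SN N.+1) (fun N x => l%:C * (SN' N x * g x)) _ _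
    (fun N => (4 + 4 * (l * B)) * (l * M) ^+ N)) => //.
  - by apply: cintegrableZ => //; apply: ucont_integrable => //; exact: ucontM.
  - move=> N x xb; rewrite norm1_distC (le_trans (HS _ xb _))// exprS.
    have h : 0 <= (l * M) ^+ N by rewrite exprn_ge0.
    rewrite mulrA ler_wpM2r//.
    have : 0 <= l * B by rewrite mulr_ge0 ?ltW.
    by lra.
  - move=> N x xb; rewrite -mulrBr -mulrBl n1lC.
    have h : 0 <= (l * M) ^+ N by rewrite exprn_ge0.
    apply: (@le_trans _ _ (l * (4 * (l * M) ^+ N * B))).
      rewrite ler_wpM2l ?(ltW l0)// (le_trans (norm1M _ _))//.
      by apply: ler_pM; rewrite ?norm1_ge0 ?HB// norm1_distC HS'.
    rewrite (_ : l * _ = 4 * (l * B) * (l * M) ^+ N); last by ring.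
    by rewrite ler_wpM2r// lerDr.
have acY : abs_cont b Y (fun x => l%:C * (Z x * gi x)).
  by apply: (aclim _ _ _ YN ZN) => // N; case: (acN N).
have acZ' : abs_cont b Z (fun x => l%:C * (Y x * g2 x)).
  by apply: (aclim _ _ _ ZN YN) => // N; case: (acN N).
have at0 (S : R -> C) (P : nat -> R -> C) : P 0%N = cst 1 -> (forall k, P k.+1 0 = 0) ->
    (forall x, - b <= x <= b -> forall N, norm1 (S x - \sum_(0 <= k < N) (l ^+ k)%:C * P k x) <= 4 * (l * M) ^+ N) ->
    S 0 = 1.
  move=> P0 PS HS; apply/eqP; rewrite -subr_eq0; apply/eqP.
  apply: (@norm1_small_eq0 _ _ 1) => // e e0.
  have /cvgrPdist_le/(_ _ e0)[N _ HN] := cvg0 4.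
  have := HN N.+1 (leqnSn N); rewrite sub0r normrN => eN.
  have := HS 0 b00 N.+1; rewrite big_nat_recl//= big1 ?addr0; last first.
    by move=> k _; rewrite PS mulr0.
  rewrite expr0 P0 mulr1 => /le_trans; apply; rewrite mulr1.
  exact: le_trans (ler_norm _) eN.
have S0 k : (spps k.+1).1 0 = 0 /\ (spps k.+1).2 0 = 0.
  by rewrite /= /ointegral lexx !cintegral_set1 addr0.
have Y0 : Y 0 = 1 by apply: (at0 Y (fun k => (spps k).1)) => // k; case: (S0 k).
have Z0 : Z 0 = 1 by apply: (at0 Z (fun k => (spps k).2)) => // k; case: (S0 k).
exists (fun x => f x * Y x).
- exists (fun x => wf x * Y x + l%:C * (Z x * (f x)^-1)); split.
  + apply: derivative_of_abs_cont => //; apply: (eq_abs_cont _ _ (abs_contM b0 af acY)) => // x xb.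
    by rewrite /gi /df; field; exact: fn0.
  (* In w' the terms in Z are l Z (wf - df)/f^2, which equals - Q l Z / f because df = wf + Q f. *)
  + apply: derivative_of_abs_cont => //.
    apply: (eq_abs_cont _ _ (abs_contD (abs_contM b0 aw acY) (abs_contZ l%:C (abs_contM b0 acZ' (abs_contV b0 af fn0))))) => // x xb.
    by rewrite /gi /g2 /df; field; exact: fn0.
  + by rewrite f1 Y0 mulr1.
  + by rewrite wf0 mul0r add0r Z0 f1 invr1 !mulr1.
- move=> N x xb.
  rewrite (_ : _ - _ = f x * (Y x - YN N x)); last first.
    rewrite /YN mulrBr mulr_sumr; congr (_ - _); apply: eq_bigr => k _; ring.
  apply: le_trans (norm1M _ _) _.
  rewrite (_ : _ * l ^+ N = norm1 (f x) * (4 * (l * M) ^+ N)); last by rewrite exprMn; ring.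
  by rewrite ler_wpM2l ?norm1_ge0// HY.
Qed.

End SPPS.

(** * The transmutation kernel *)

Section ComplexExponential.
Context {R : realType}.
Local Notation mu := (@lebesgue_measure R).
Local Notation C := (R[i]).
Local Notation Re := (@complex.Re R).
Local Notation Im := (@complex.Im R).

Lemma Re_cexp (z : C) : Re (cexp z) = expR (Re z) * cos (Im z).
Proof. by rewrite /cexp complex_partsE /= mul0r subr0. Qed.

Lemma Im_cexp (z : C) : Im (cexp z) = expR (Re z) * sin (Im z).
Proof. by rewrite /cexp complex_partsE /= mul0r addr0. Qed.

Lemma cexp_real (t : R) : cexp t%:C = (expR t)%:C.
Proof.
by apply: complex_ext; rewrite ?Re_cexp ?Im_cexp /= ?cos0 ?sin0 ?mulr1 ?mulr0.
Qed.

Lemma Re_mulC (z : C) (y : R) : Re (z * y%:C) = Re z * y.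
Proof. by rewrite complex_partsE /= mulr0 subr0. Qed.

Lemma Im_mulC (z : C) (y : R) : Im (z * y%:C) = Im z * y.
Proof. by rewrite complex_partsE /= mulr0 add0r. Qed.

Lemma Re_Cmul (x : R) (z : C) : Re (x%:C * z) = x * Re z.
Proof. by rewrite complex_partsE /= mul0r subr0. Qed.

Lemma Im_Cmul (x : R) (z : C) : Im (x%:C * z) = x * Im z.
Proof. by rewrite complex_partsE /= mul0r addr0. Qed.

Lemma Re_iM (z : C) : Re ('i%C * z) = - Im z.
Proof. by rewrite complex_partsE /= mul0r mul1r sub0r. Qed.

Lemma cexp_cmeasurable (A : set R) (z : C) : measurable A ->
  cmeasurable A (fun y => cexp (z * y%:C)).
Proof.
move=> mA; have me : measurable_fun setT (fun y : R => expR (Re z * y)).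
  by apply: measurableT_comp => //; exact: measurable_funM.
split; apply: measurable_funTS.
  rewrite (_ : _ \o _ = fun y => expR (Re z * y) * cos (Im z * y)).
    by apply: measurable_funM => //; exact: measurable_cosM.
  by apply/funext => y; rewrite /comp Re_cexp Re_mulC Im_mulC.
rewrite (_ : _ \o _ = fun y => expR (Re z * y) * sin (Im z * y)).
  by apply: measurable_funM => //; exact: measurable_sinM.
by apply/funext => y; rewrite /comp Im_cexp Re_mulC Im_mulC.
Qed.

Lemma norm1_cexp (z : C) : norm1 (cexp z) <= 2 * expR `|Re z|.
Proof.
rewrite /norm1 Re_cexp Im_cexp !normrM (ger0_norm (expR_ge0 _)) mulrDl mul1r.
by apply: lerD; rewrite -[leRHS]mulr1; apply: ler_pM;
  rewrite ?expR_ge0 ?ler_expR ?ler_norm// ler_norml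
    ?cos_geN1 ?cos_le1 ?sin_geN1 ?sin_le1.
Qed.

(** The case n = 0 is [gaussian_fourier], and each raising step contributes one factor z. *)
Lemma cintegral_hermite (n : nat) (z : C) :
  cintegral [set: R] (fun y => ((herm n).[y])%:C * cexp (z * y%:C) * (expR (- y ^+ 2))%:C) =
  (Num.sqrt pi)%:C * cexp (z ^+ 2 / 4) * z ^+ n.
Proof.
pose J p : C := Jc p (Re z) (Im z) +i* Js p (Re z) (Im z).
have -> : cintegral [set: R] (fun y => ((herm n).[y])%:C * cexp (z * y%:C) * (expR (- y ^+ 2))%:C) = J (herm n).
  apply: complex_ext; apply: eq_Rintegral => y _.
    by rewrite Re_mulC Re_Cmul Re_cexp Re_mulC Im_mulC /gcos expRD; ring.
  by rewrite Im_mulC Im_Cmul Im_cexp Re_mulC Im_mulC /gsin expRD; ring.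
elim: n => [|n IH].
  rewrite expr0 mulr1 /J; have [-> ->] := gaussian_fourier (Re z) (Im z).
  have [e1 e2] : Re (z ^+ 2 / 4) = (Re z ^+ 2 - Im z ^+ 2) / 4 /\ Im (z ^+ 2 / 4) = Re z * Im z / 2.
    have -> : (4^-1 : C) = (4^-1)%:C by rewrite fmorphV rmorph_nat.
    by rewrite Re_mulC Im_mulC !expr2 !complex_partsE; split => //; field.
  by apply: complex_ext; rewrite ?Re_Cmul ?Im_Cmul ?Re_cexp ?Im_cexp e1 e2 mulrA.
rewrite [z ^+ n.+1]exprS mulrCA -IH; apply: complex_ext; rewrite !complex_partsE /=.
  exact: Jc_raise.
exact: Js_raise.
Qed.

End ComplexExponential.

Section SquareIntegrable.
Context {R : realType}.
Local Notation mu := (@lebesgue_measure R).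
Local Notation C := (R[i]).
Local Notation Re := (@complex.Re R).
Local Notation Im := (@complex.Im R).

Lemma square_integrable_sqr (A : set R) (g : R -> C) : measurable A ->
  square_integrable A g ->
  mu.-integrable A (EFin \o (fun y => Re (g y) ^+ 2 + Im (g y) ^+ 2)).
Proof.
move=> mA [mR mI fin]; apply/integrableP; split.
  by apply/measurable_EFinP; apply: measurable_funD; exact: measurable_funX.
move: fin; congr (_ < _)%E; apply: eq_integral => y _ /=.
by rewrite ger0_norm ?addr_ge0 ?sqr_ge0// normc_sqr.
Qed.

Lemma square_integrable_cintegrable (s t : R) (g : R -> C) :
  square_integrable `[s, t] g -> cintegrable `[s, t] g.
Proof.
move=> sg; have [mR mI _] := sg.
have IS := square_integrable_sqr (measurable_itv _) sg.
apply: (@cintegrable_le _ _ _ _ (fun y => 2 + (Re (g y) ^+ 2 + Im (g y) ^+ 2))) => //.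
  pose c2 : R -> R := cst 2.
  rewrite (_ : _ \o _ = (EFin \o c2) \+ (EFin \o (fun y => Re (g y) ^+ 2 + Im (g y) ^+ 2)%R))%E//.
  by apply: integrableD => //; exact: cst_integrable_itv.
move=> y _; rewrite /norm1 -(real_normK (num_real (Re (g y)))) -(real_normK (num_real (Im (g y)))).
move: `|Re _| `|Im _| => p q; have := sqr_ge0 (p - 2^-1); have := sqr_ge0 (q - 2^-1).
by rewrite !expr2; lra.
Qed.

(** On the support |y| <= a the growing weight, once squared, is at most e^{a^2}. The factor s
    serves for the sign of the oriented integral. *)
Lemma square_integrable_extend (a : R) (g k : R -> C) (s : C) :
  square_integrable `[- a, a] g ->
  (forall y, - a <= y <= a -> k y = s * g y) ->
  (forall y, ~~ (- a <= y <= a) -> k y = 0) ->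
  L2 (fun y => Re (k y) * expR (y ^+ 2 / 2)) /\
  L2 (fun y => Im (k y) * expR (y ^+ 2 / 2)).
Proof.
move=> sg kg k0; have [mR mI _] := sg.
pose A := (`[- a, a]%classic : set R).
have mA : measurable A by exact: measurable_itv.
have inA y : A y -> - a <= y <= a by rewrite /A /= in_itv.
have ninA y : ~ A y -> k y = 0.
  by move=> nA; apply: k0; apply/negP => h; apply: nA; rewrite /A /= in_itv.
have mk : cmeasurable A k.
  have [h1 h2] : cmeasurable A (fun y => s * g y).
    by apply: cmeasurableM; [exact: cmeasurable_cst|split].
  by split; [apply: eq_measurable_fun h1|apply: eq_measurable_fun h2] => y;
    rewrite inE => /inA yA /=; rewrite kg.
have Ik : mu.-integrable A (EFin \o (fun y => norm1 s ^+ 2 * 2 * (Re (g y) ^+ 2 + Im (g y) ^+ 2))).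
  by apply: integrable_EFinZ => //; exact: square_integrable_sqr.
have key (P : C -> R) : measurable_fun A (P \o k) -> P 0 = 0 -> (forall z, `|P z| <= norm1 z) ->
    L2 (fun y => P (k y) * expR (y ^+ 2 / 2)).
  move=> mP P0 Pn.
  have E : (fun y => P (k y) * expR (y ^+ 2 / 2)) =
     ((fun y => P (k y) * expR (y ^+ 2 / 2)) \_ A).
    apply/funext => y; rewrite patchE; case: (boolP (y \in A)) => // /negP yA.
    by rewrite ninA ?P0 ?mul0r// => /mem_set.
  have me : measurable_fun A (fun y : R => expR (y ^+ 2 / 2)).
    apply: measurable_funTS; apply: measurableT_comp => //.
    by apply: measurable_funM => //; exact: measurable_funX.
  have mPe : measurable_fun A (fun y => P (k y) * expR (y ^+ 2 / 2)).
    exact: (measurable_funM mP me).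
  split.
    have [h _] := measurable_restrictT (fun y => P (k y) * expR (y ^+ 2 / 2)) mA.
    by rewrite E; exact: h.
  have E2 : EFin \o (fun y => P (k y) * expR (y ^+ 2 / 2) * (P (k y) * expR (y ^+ 2 / 2))) =
     (EFin \o (fun y => P (k y) * expR (y ^+ 2 / 2) * (P (k y) * expR (y ^+ 2 / 2)))) \_ A.
    apply/funext => y; rewrite patchE; case: (boolP (y \in A)) => // /negP yA.
    by rewrite /= ninA ?P0 ?mul0r// => /mem_set.
  rewrite /L1 E2.
  have [h _] := integrable_mkcond (mu := mu) (EFin \o (fun y =>
    P (k y) * expR (y ^+ 2 / 2) * (P (k y) * expR (y ^+ 2 / 2)))) mA.
  apply: h.
  have IJ := integrable_EFinZ mA (expR (a ^+ 2)) Ik.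
  apply: (@le_integrable _ _ R mu A mA _ _ _ _ IJ).
    by apply/measurable_EFinP; apply: measurable_funM.
  move=> y Ay; rewrite lee_fin [leRHS]ger0_norm; last first.
    by rewrite !mulr_ge0 ?expR_ge0 ?addr_ge0 ?sqr_ge0.
  rewrite mulrACA -expRD mulrC ger0_norm; last by rewrite mulr_ge0 ?expR_ge0// -expr2 sqr_ge0.
  have ya : y ^+ 2 <= a ^+ 2.
    have := inA _ Ay => /andP[h1 h2].
    have : 0 <= (a - y) * (a + y) by rewrite mulr_ge0 ?subr_ge0// addrC -lerBlDr sub0r.
    by rewrite !expr2; lra.
  apply: ler_pM; rewrite ?expR_ge0 -?expr2 ?sqr_ge0//.
    by rewrite ler_expR; lra.
  rewrite -(real_normK (num_real (P (k y)))).
  apply: (@le_trans _ _ ((norm1 s * norm1 (g y)) ^+ 2)).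
    rewrite lerXn2r ?nnegrE ?mulr_ge0 ?norm1_ge0//.
    by apply: le_trans (Pn _) _; rewrite kg ?inA// norm1M.
  rewrite exprMn -mulrA ler_wpM2l ?sqr_ge0//.
  rewrite /norm1 -(real_normK (num_real (Re (g y)))) -(real_normK (num_real (Im (g y)))).
  move: `|Re _| `|Im _| => p q; have := sqr_ge0 (p - q).
  by rewrite !expr2; lra.
split; [apply: (key Re)|apply: (key Im)] => //; try by case: mk.
- by move=> z; rewrite /norm1 lerDl.
- by move=> z; rewrite /norm1 lerDr.
Qed.

End SquareIntegrable.

Section ExtendedKernel.
Context {R : realType}.
Local Notation mu := (@lebesgue_measure R).
Local Notation C := (R[i]).
Local Notation Re := (@complex.Re R).
Local Notation Im := (@complex.Im R).

(* The orientation of the integral from -x to x. *)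
Definition csign (x : R) : C := if 0 <= x then 1 else -1.

(** For x different from 0 only one of [-x, x] and [x, -x] is nonempty; at x = 0 the first case
    applies, with sign 1. *)
Lemma extended_kernelE b (K : R -> R -> C) x y : - b <= x <= b ->
  extended_kernel b K x y = if - `|x| <= y <= `|x| then csign x * K x y else 0.
Proof.
move=> xb; rewrite /extended_kernel xb /csign; have [x0|x0] := leP 0 x.
  rewrite ger0_norm// mul1r; case: ifP => // h; rewrite ifF//.
  by apply/negP => /andP[h1 h2]; move/negP : h; case; apply/andP; split; lra.
rewrite ltr0_norm// opprK mulN1r ifF//; apply/negP => /andP[h1 h2].
by have := le_trans h1 h2; lra.
Qed.

Lemma ointegral_sym (x : R) (g : R -> C) :
  ointegral (- x) x g = csign x * cintegral `[- `|x|, `|x|] g.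
Proof.
rewrite /ointegral /csign; have [x0|x0] := leP 0 x.
  by rewrite ger0_norm// ifT ?mul1r//; lra.
rewrite ltr0_norm// ifF ?opprK ?mulN1r//.
by apply/negP => ?; lra.
Qed.

Lemma square_integrable_mul (a B : R) (k h : R -> C) :
  square_integrable `[- a, a] k -> cmeasurable `[- a, a] h ->
  (forall y, - a <= y <= a -> norm1 (h y) <= B) ->
  cintegrable `[- a, a] (fun y => k y * h y).
Proof.
move=> sk mh hB; have ck := square_integrable_cintegrable sk.
apply: (@eq_cintegrable _ _ _ (fun y => h y * k y)) => //.
  by move=> y _; rewrite mulrC.
by apply: (@cintegrableM_bounded _ _ _ h k B) => //.
Qed.

Lemma extended_integral b (K : R -> R -> C) x (h : R -> C) B : - b <= x <= b ->
  square_integrable `[- `|x|, `|x|] (K x) -> cmeasurable `[- `|x|, `|x|] h ->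
  (forall y, - `|x| <= y <= `|x| -> norm1 (h y) <= B) ->
  cintegral setT (fun y => extended_kernel b K x y * h y) =
  ointegral (- x) x (fun y => K x y * h y).
Proof.
move=> xb sk mh hB; have ck := square_integrable_mul sk mh hB.
rewrite ointegral_sym -cintegralZ//.
have E1 y : `[- `|x|, `|x|]%classic y ->
    extended_kernel b K x y * h y = csign x * (K x y * h y).
  by rewrite /= in_itv/= extended_kernelE// => ->; rewrite mulrA.
have E2 y : ~ `[- `|x|, `|x|]%classic y -> extended_kernel b K x y * h y = 0.
  by rewrite /= in_itv/= extended_kernelE// => /negP/negPf ->; rewrite mul0r.
by have [-> _] := cintegral_mkcond (measurable_itv _) E1 E2.
Qed.

Lemma horner_bounded (p : {poly R}) (a : R) : exists B,
  forall y, - a <= y <= a -> norm1 (p.[y])%:C <= B.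
Proof.
have [C0 C00 HC] := poly_le_expR_sqr p (@ltr01 R).
exists (C0 * expR (1 * a ^+ 2)) => y /andP[y1 y2].
rewrite norm1C (le_trans (HC y))// ler_wpM2l// ler_expR !mul1r.
have : 0 <= (a - y) * (a + y) by rewrite mulr_ge0 ?subr_ge0// addrC -lerBlDr sub0r.
by rewrite !expr2; lra.
Qed.

Lemma horner_cmeasurable (A : set R) (p : {poly R}) :
  cmeasurable A (fun y => (p.[y])%:C).
Proof.
split; apply: measurable_funTS; first exact: measurable_horner.
exact: measurable_cst.
Qed.

Lemma cexp_bounded (z : C) (a y : R) : - a <= y <= a ->
  norm1 (cexp (z * y%:C)) <= 2 * expR (`|Re z| * a).
Proof.
rewrite -ler_norml => ya.
rewrite (le_trans (norm1_cexp _))// ler_wpM2l// ler_expR Re_mulC normrM.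
by rewrite ler_wpM2l.
Qed.

(** For r = cos or sin, E is the real or imaginary part of e^{zy-y^2/2}, z = a + ib. Its square is
    at most e^{2ay-y^2}, of integral sqrt(pi) e^{a^2}; the square root is the source of pi^{1/4}
    e^{(Im omega)^2/2} in the error bound. *)
Lemma ip_trig (a b : R) (r : R -> R) : measurable_fun [set: R] r -> (forall y, `|r y| <= 1) ->
  let E := fun y => expR (a * y) * r (b * y) * gw y in
  measurable_fun [set: R] (fun y => r (b * y)) ->
  L2 E /\ Num.sqrt (ip E E) <= pi `^ (4^-1) * expR (a ^+ 2 / 2).
Proof.
move=> mr r1 E mrb.
have EE y : E y * E y = expR (2 * a * y - y ^+ 2) * r (b * y) ^+ 2.
  have -> : expR (2 * a * y - y ^+ 2) = expR (a * y) * expR (a * y) * (gw y * gw y).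
    by rewrite gwM -!expRD; congr expR; ring.
  by rewrite /E; ring.
have le y : E y * E y <= expR (2 * a * y - y ^+ 2).
  rewrite EE ler_piMr ?expR_ge0// -real_normK ?num_real// expr_le1//.
have mE : measurable_fun [set: R] E.
  apply: measurable_funM; last exact: measurable_gw.
  by apply: measurable_funM => //; apply: measurableT_comp.
have LE : L2 E.
  split=> //; apply: (L1_le _ (gaussian_L1 (2 * a))); first exact: measurable_funM.
  by move=> y; rewrite ger0_norm// -expr2 sqr_ge0.
split=> //.
have -> : pi `^ (4^-1) * expR (a ^+ 2 / 2) = Num.sqrt (Num.sqrt pi * expR (a ^+ 2)) :> R.
  rewrite sqrtrM ?sqrtr_ge0//; congr (_ * _).
    by rewrite -!powR12_sqrt ?powR_ge0 ?pi_ge0// -powRrM; congr (_ `^ _); field.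
  have -> : expR (a ^+ 2) = expR (a ^+ 2 / 2) ^+ 2.
    by rewrite -expRM_natl; congr expR; field.
  by rewrite sqrtr_sqr ger0_norm// expR_ge0.
rewrite ler_wsqrtr//.
have -> : Num.sqrt pi * expR (a ^+ 2) = \int[mu]_y expR (2 * a * y - y ^+ 2).
  by rewrite gaussian_integral; congr (_ * expR _); field.
by apply: le_Rintegral => //; [exact: LE.2|exact: gaussian_L1].
Qed.

End ExtendedKernel.

(** * Hermite expansion of the extended kernel and the truncation error *)

Section KernelExpansion.
Context {R : realType}.
Local Notation mu := (@lebesgue_measure R).
Local Notation C := (R[i]).
Local Notation Re := (@complex.Re R).
Local Notation Im := (@complex.Im R).
Variables (b : R) (K : R -> R -> C).
Hypothesis sK : forall x, - b <= x <= b -> square_integrable `[- `|x|, `|x|] (K x).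

Definition kR x y := Re (extended_kernel b K x y) * expR (y ^+ 2 / 2).
Definition kI x y := Im (extended_kernel b K x y) * expR (y ^+ 2 / 2).

(** For x outside [-b, b] the extended kernel vanishes, which makes this and the expansion valid for
    every real x. *)
Lemma kernel_L2 x : L2 (kR x) /\ L2 (kI x).
Proof.
have [xb|xb] := boolP (- b <= x <= b).
  apply: (square_integrable_extend (sK xb) (s := csign x)).
    by move=> y yx; rewrite extended_kernelE// yx.
  by move=> y /negPf yx; rewrite extended_kernelE// yx.
have E : (fun=> 0) = pw (0 : {poly R}).
  by apply/funext => y; rewrite /pw horner0 mul0r.
have := pw_L2 (0 : {poly R}); rewrite -E => L0.
by split; move: L0; congr L2; apply/funext => y;
  rewrite /kR /kI /extended_kernel (negPf xb) mul0r.
Qed.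

Definition coef n x : C :=
  ((hermite_norm n)%:C)^-1 * cintegral [set: R] (fun y => extended_kernel b K x y * ((herm n).[y])%:C).

Lemma gwV (y : R) : gw y * expR (y ^+ 2 / 2) = 1.
Proof. by rewrite /gw -expRD addrC subrr expR0. Qed.

Lemma ReIm_coef n x : Re (coef n x) = ip (pw (herm n)) (kR x) / hermite_norm n /\
  Im (coef n x) = ip (pw (herm n)) (kI x) / hermite_norm n.
Proof.
rewrite /coef -fmorphV Re_Cmul Im_Cmul; split; rewrite mulrC; congr (_ / _);
  apply: eq_Rintegral => y _; rewrite ?Re_mulC ?Im_mulC /pw /kR /kI -mulrA.
  by rewrite [gw y * _]mulrCA gwV mulr1 mulrC.
by rewrite [gw y * _]mulrCA gwV mulr1 mulrC.
Qed.

Definition eR N x := kR x \- pw (\sum_(0 <= k < N.+1) (ip (pw (herm k)) (kR x) / hermite_norm k) *: herm k).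
Definition eI N x := kI x \- pw (\sum_(0 <= k < N.+1) (ip (pw (herm k)) (kI x) / hermite_norm k) *: herm k).

Lemma eR_L2 N x : L2 (eR N x).
Proof. by apply: L2B; [exact: (kernel_L2 x).1|exact: pw_L2]. Qed.

Lemma eI_L2 N x : L2 (eI N x).
Proof. by apply: L2B; [exact: (kernel_L2 x).2|exact: pw_L2]. Qed.

Lemma eR_cvg x : ip (eR N x) (eR N x) @[N --> \oo] --> 0.
Proof. by apply: hermite_expansion; exact: (kernel_L2 x).1. Qed.

Lemma eI_cvg x : ip (eI N x) (eI N x) @[N --> \oo] --> 0.
Proof. by apply: hermite_expansion; exact: (kernel_L2 x).2. Qed.

(** Multiplication by e^{y^2/2} turns H_n(y) e^{-y^2} into [pw (herm n)], so the weighted square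
    error splits into the two real residuals. *)
Lemma expansion_error N x y :
  Normc.normc (extended_kernel b K x y -
     \sum_(0 <= n < N.+1) coef n x * (((herm n).[y] * expR (- y ^+ 2))%:C)) ^+ 2 * expR (y ^+ 2) =
  eR N x y * eR N x y + eI N x y * eI N x y.
Proof.
have key (k : R) (a : nat -> R) : (k - \sum_(0 <= n < N.+1) a n * ((herm n).[y] * expR (- y ^+ 2))) ^+ 2 * expR (y ^+ 2) =
   (k * expR (y ^+ 2 / 2) - pw (\sum_(0 <= n < N.+1) a n *: herm n) y) ^+ 2.
  have -> : expR (y ^+ 2) = expR (y ^+ 2 / 2) ^+ 2.
    by rewrite -expRM_natl; congr expR; field.
  rewrite -exprMn mulrBl; congr ((_ - _) ^+ 2).
  rewrite /pw horner_sum !mulr_suml; apply: eq_bigr => n _.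
  rewrite hornerZ -gwM; have := gwV y; move: (gw y) (expR (y ^+ 2 / 2)) => g e ge.
  by rewrite -[RHS]mulr1 -ge; ring.
rewrite normc_sqr !complex_partsE Re_sum Im_sum mulrDl.
under eq_bigr do rewrite Re_mulC (ReIm_coef _ x).1.
rewrite key; under [in X in _ + X]eq_bigr do rewrite Im_mulC (ReIm_coef _ x).2.
by rewrite key /eR /eI !expr2.
Qed.

Lemma kernel_expansion x :
  (fun N => \int[mu]_(y in [set: R])
     ((Normc.normc (extended_kernel b K x y -
         \sum_(0 <= n < N.+1) coef n x * (((herm n).[y] * expR (- y ^+ 2))%:C))) ^+ 2
      * expR (y ^+ 2))%:E)%E @ \oo --> 0%E.
Proof.
have -> : (fun N => \int[mu]_(y in [set: R])
     ((Normc.normc (extended_kernel b K x y -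
         \sum_(0 <= n < N.+1) coef n x * (((herm n).[y] * expR (- y ^+ 2))%:C))) ^+ 2
      * expR (y ^+ 2))%:E)%E = fun N => (ip (eR N x) (eR N x) + ip (eI N x) (eI N x))%:E.
  apply/funext => N; under eq_integral do rewrite expansion_error.
  have IRI : L1 (fun y => eR N x y * eR N x y + eI N x y * eI N x y).
    by apply: L1D; [exact: (eR_L2 N x).2|exact: (eI_L2 N x).2].
  rewrite -[LHS](fineK (integrable_fin_num measurableT IRI)); congr EFin.
  rewrite /ip -RintegralD//; [exact: (eR_L2 N x).2|exact: (eI_L2 N x).2].
apply: cvg_EFin; first exact: nearW.
by rewrite -[X in _ --> X](addr0 (0 : R)); apply: cvgD; [exact: eR_cvg|exact: eI_cvg].
Qed.

(** The factor 2 arises because each residual is paired once with the cosine part and once with the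
    sine part of the exponential. *)
Definition eps N x := 2 * (Num.sqrt (ip (eR N x) (eR N x)) + Num.sqrt (ip (eI N x) (eI N x))).

Lemma eps_ge0 N x : 0 <= eps N x.
Proof. by rewrite mulr_ge0// addr_ge0// sqrtr_ge0. Qed.

Lemma cvg_sqrt0 (u : nat -> R) : u n @[n --> \oo] --> 0 ->
  Num.sqrt (u n) @[n --> \oo] --> 0.
Proof.
move=> u0; apply/cvgrPdist_le => e e0.
have e2 : 0 < e ^+ 2 by rewrite exprn_gt0.
move/cvgrPdist_le : u0 => /(_ _ e2)[N _ HN]; exists N => // n /HN.
rewrite !sub0r !normrN => ue; rewrite ger0_norm ?sqrtr_ge0//.
rewrite -[leRHS](ger0_norm (ltW e0)) -sqrtr_sqr ler_wsqrtr//.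
exact: le_trans (ler_norm _) ue.
Qed.

Lemma eps_cvg x : eps N x @[N --> \oo] --> 0.
Proof.
rewrite -(mulr0 2); apply: cvgM; first exact: cvg_cst.
rewrite -(addr0 0); apply: cvgD; apply: cvg_sqrt0; [exact: eR_cvg|exact: eI_cvg].
Qed.

Lemma four_bound (s t s' t' p q B : R) :
  `|s| <= p * B -> `|t| <= q * B -> `|s'| <= p * B -> `|t'| <= q * B ->
  `|s - t| + `|s' + t'| <= B * (2 * (p + q)).
Proof.
by have := ler_normB s t; have := ler_normD s' t'; lra.
Qed.

Lemma fourier_error N x (z : C) :
  norm1 (cintegral [set: R] (fun y => extended_kernel b K x y * cexp (z * y%:C)) -
      (Num.sqrt pi)%:C * cexp (z ^+ 2 / 4) * \sum_(0 <= n < N.+1) coef n x * z ^+ n) <=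
  pi `^ (4^-1) * expR (Re z ^+ 2 / 2) * eps N x.
Proof.
pose E1 y := expR (Re z * y) * cos (Im z * y) * gw y.
pose E2 y := expR (Re z * y) * sin (Im z * y) * gw y.
have [LE1 nE1] : L2 E1 /\ Num.sqrt (ip E1 E1) <= pi `^ (4^-1) * expR (Re z ^+ 2 / 2).
  apply: ip_trig; last exact: measurable_cosM.
  - by apply: continuous_measurable_fun; exact: continuous_cos.
  - by move=> y; rewrite ler_norml cos_geN1 cos_le1.
have [LE2 nE2] : L2 E2 /\ Num.sqrt (ip E2 E2) <= pi `^ (4^-1) * expR (Re z ^+ 2 / 2).
  apply: ip_trig; last exact: measurable_sinM.
  - by apply: continuous_measurable_fun; exact: continuous_sin.
  - by move=> y; rewrite ler_norml sin_geN1 sin_le1.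
have [LR LI] := kernel_L2 x.
(* [E1] + i [E2] is e^{zy-y^2/2}, so pairing with [pw p] integrates p(y) e^{zy-y^2}. *)
have pE1 p : ip (pw p) E1 = Jc p (Re z) (Im z).
  apply: eq_Rintegral => y _; rewrite /pw /E1 /gcos expRD -gwM; ring.
have pE2 p : ip (pw p) E2 = Js p (Re z) (Im z).
  apply: eq_Rintegral => y _; rewrite /pw /E2 /gsin expRD -gwM; ring.
have H1 : (Num.sqrt pi)%:C * cexp (z ^+ 2 / 4) * \sum_(0 <= n < N.+1) coef n x * z ^+ n =
    \sum_(0 <= n < N.+1) coef n x * (Jc (herm n) (Re z) (Im z) +i* Js (herm n) (Re z) (Im z)).
  rewrite mulr_sumr; apply: eq_bigr => n _; rewrite mulrCA -cintegral_hermite; congr (_ * _).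
  apply: complex_ext; apply: eq_Rintegral => y _.
    by rewrite Re_mulC Re_Cmul Re_cexp Re_mulC Im_mulC /gcos expRD; ring.
  by rewrite Im_mulC Im_Cmul Im_cexp Re_mulC Im_mulC /gsin expRD; ring.
have [K1 K2] : Re (cintegral [set: R] (fun y => extended_kernel b K x y * cexp (z * y%:C))) =
      ip (kR x) E1 - ip (kI x) E2 /\
    Im (cintegral [set: R] (fun y => extended_kernel b K x y * cexp (z * y%:C))) =
      ip (kR x) E2 + ip (kI x) E1.
  split.
    rewrite /ip -RintegralB//; [|exact: L2M..].
    apply: eq_Rintegral => y _; rewrite cReM Re_cexp Im_cexp Re_mulC Im_mulC /kR /kI /E1 /E2.
    have := gwV y; move: (gw y) (expR (y ^+ 2 / 2)) => g e ge.
    by rewrite -[LHS]mulr1 -ge; ring.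
  rewrite /ip -RintegralD//; [|exact: L2M..].
  apply: eq_Rintegral => y _; rewrite cImM Re_cexp Im_cexp Re_mulC Im_mulC /kR /kI /E1 /E2.
  have := gwV y; move: (gw y) (expR (y ^+ 2 / 2)) => g e ge.
  by rewrite -[LHS]mulr1 -ge; ring.
have ipe (k : R -> R) (a : nat -> R) (E : R -> R) : L2 k -> L2 E ->
    ip (k \- pw (\sum_(0 <= n < N.+1) a n *: herm n)) E =
    ip k E - \sum_(0 <= n < N.+1) a n * ip (pw (herm n)) E.
  by move=> Lk LE; rewrite ipBl ?ip_suml//; exact: pw_L2.
have D1 : Re (cintegral [set: R] (fun y => extended_kernel b K x y * cexp (z * y%:C)) -
      (Num.sqrt pi)%:C * cexp (z ^+ 2 / 4) * \sum_(0 <= n < N.+1) coef n x * z ^+ n) =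
    ip (eR N x) E1 - ip (eI N x) E2.
  rewrite cReD cReN K1 H1 Re_sum /eR /eI !ipe//.
  have -> : \sum_(0 <= n < N.+1) Re (coef n x * (Jc (herm n) (Re z) (Im z) +i* Js (herm n) (Re z) (Im z))) =
      \sum_(0 <= n < N.+1) ip (pw (herm n)) (kR x) / hermite_norm n * ip (pw (herm n)) E1 -
      \sum_(0 <= n < N.+1) ip (pw (herm n)) (kI x) / hermite_norm n * ip (pw (herm n)) E2.
    rewrite -sumrB; apply: eq_bigr => n _.
    by rewrite cReM (ReIm_coef n x).1 (ReIm_coef n x).2 pE1 pE2.
  by ring.
have D2 : Im (cintegral [set: R] (fun y => extended_kernel b K x y * cexp (z * y%:C)) -
      (Num.sqrt pi)%:C * cexp (z ^+ 2 / 4) * \sum_(0 <= n < N.+1) coef n x * z ^+ n) =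
    ip (eR N x) E2 + ip (eI N x) E1.
  rewrite cImD cImN K2 H1 Im_sum /eR /eI !ipe//.
  have -> : \sum_(0 <= n < N.+1) Im (coef n x * (Jc (herm n) (Re z) (Im z) +i* Js (herm n) (Re z) (Im z))) =
      \sum_(0 <= n < N.+1) ip (pw (herm n)) (kR x) / hermite_norm n * ip (pw (herm n)) E2 +
      \sum_(0 <= n < N.+1) ip (pw (herm n)) (kI x) / hermite_norm n * ip (pw (herm n)) E1.
    rewrite -big_split; apply: eq_bigr => n _.
    by rewrite cImM (ReIm_coef n x).1 (ReIm_coef n x).2 pE1 pE2.
  by ring.
rewrite /norm1 D1 D2; set B := pi `^ (4^-1) * _.
have CS (r E : R -> R) : L2 r -> L2 E -> Num.sqrt (ip E E) <= B ->
    `|ip r E| <= Num.sqrt (ip r r) * B.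
  move=> Lr LE EB; apply: le_trans (ip_CauchySchwarz Lr LE) _.
  by rewrite ler_wpM2l// sqrtr_ge0.
have c1 := CS _ _ (eR_L2 N x) LE1 nE1; have c2 := CS _ _ (eI_L2 N x) LE2 nE2.
have c3 := CS _ _ (eR_L2 N x) LE2 nE2; have c4 := CS _ _ (eI_L2 N x) LE1 nE1.
exact: (four_bound c1 c2 c3 c4).
Qed.

End KernelExpansion.

(** * Moments of the kernel and formal powers *)

Section FormalMoments.
Context {R : realType}.
Local Notation mu := (@lebesgue_measure R).
Local Notation C := (R[i]).
Local Notation Re := (@complex.Re R).
Local Notation Im := (@complex.Im R).
Variables (b : R) (Q : R -> C) (K : R -> R -> C) (f : R -> C).
Hypothesis b0 : 0 < b.
Hypothesis hK : transmutation_kernel b Q K.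
Hypothesis hf : solves_ivp b Q 0 f 1 0.
Hypothesis fn0 : forall s, - b <= s <= b -> f s != 0.

Lemma pow_cmeasurable (A : set R) k : cmeasurable A (fun y : R => (y ^+ k)%:C).
Proof.
have := horner_cmeasurable A ('X^k : {poly R}).
by congr cmeasurable; apply/funext => y; rewrite hornerXn.
Qed.

Lemma kernel_moments k x : - b <= x <= b ->
  ointegral (- x) x (fun y => K x y * (y ^+ k)%:C) = formal_power f k x - x%:C ^+ k.
Proof.
move=> xb; have [sKx hKx] := hK xb.
have [wf [af0 aw0 f1 wf0]] := hf.
have af := abs_cont_of_derivative b0 af0; have aw := abs_cont_of_derivative b0 aw0.
have [r [M [r0 M0 HS]]] := spps_solution b0 af aw f1 wf0 fn0.
pose a := `|x|.
have ab : a <= b by rewrite ler_norml.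
have a0 : 0 <= a by exact: normr_ge0.
have cK := square_integrable_cintegrable sKx.
have Ipow j : cintegrable `[- a, a] (fun y => K x y * (y ^+ j)%:C).
  apply: (@square_integrable_mul _ _ (a ^+ j)) => //; first exact: pow_cmeasurable.
  move=> y; rewrite -ler_norml => ya; rewrite norm1C normrX lerXn2r ?nnegrE//.
have Iexp (z : C) : cintegrable `[- a, a] (fun y => K x y * cexp (z * y%:C)).
  apply: (@square_integrable_mul _ _ (2 * expR (`|Re z| * a))) => //.
    exact: cexp_cmeasurable.
  by move=> y ya; exact: cexp_bounded.
pose m j := csign x * cintegral `[- a, a] (fun y => K x y * (y ^+ j)%:C).
(* The difference between the coefficients of t^j in the series of the solution and in e^{tx} + int
   K(x,y) e^{ty} dy. *)
pose d j : C := f x * (spps f j).1 x - (j`!%:R^-1)%:C * ((x ^+ j)%:C + m j).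
suff dk : d k = 0.
  have fne : (k`!%:R : C) != 0 by rewrite pnatr_eq0 -lt0n fact_gt0.
  have [E _] := spps_formal b0 af fn0 k xb.
  rewrite ointegral_sym -/(m k) /formal_power E.
  move/eqP : dk; rewrite /d subr_eq0 => /eqP dk.
  have -> : f x * (k`!%:R * (spps f k).1 x) = k`!%:R * (f x * (spps f k).1 x) by ring.
  rewrite dk fmorphV rmorph_nat mulVKf// rmorphXn/=; ring.
apply: (@expansion_unique _ d r) => // N.
pose T := \int[mu]_(y in `[- a, a]) norm1 (K x y).
have T0 : 0 <= T by apply: Rintegral_ge0 => y _; exact: norm1_ge0.
(* ce t^N bounds the Taylor remainder of e^{ty} for |y| <= b and t <= r. The constant below adds the
   truncation error of the solution, this remainder at y = x, and the remainder integrated against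
   K. *)
pose ce := b ^+ N * expR (r * b).
exists (M ^+ N * (norm1 (f x) * 4) + ce + ce * T) => t /andP[t0 tr].
have [v sv Hv] := HS t (introT andP (conj t0 tr)).
(* This omega makes i omega = t and - omega^2 = t^2, so the constructed v satisfies the initial
   value problem of the kernel hypothesis. *)
pose om : C := - 'i%C * t%:C.
have ii : ('i%C : C) * 'i%C = -1 by apply: complex_ext; rewrite ?cReM ?cImM /=; ring.
have omE : 'i%C * om = t%:C.
  by rewrite /om mulrA mulrN ii opprK mul1r.
have om2 : - om ^+ 2 = t%:C ^+ 2.
  by rewrite -[in RHS]omE [in RHS]expr2 mulrACA ii mulN1r -expr2.
have := hKx om v; rewrite om2 omE => /(_ sv) vE.
have Ebound y : - a <= y <= a ->
    `|expR (t * y) - \sum_(0 <= j < N) (t * y) ^+ j / j`!%:R| <= ce * t ^+ N.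
  rewrite -ler_norml => ya; apply: le_trans (expR_taylor _ _) _.
  have yb : `|y| <= b by exact: le_trans ab.
  rewrite normrM (gtr0_norm t0) exprMn /ce.
  rewrite (_ : _ * t ^+ N = t ^+ N * b ^+ N * expR (r * b)); last by ring.
  rewrite ler_pM ?mulr_ge0 ?exprn_ge0 ?expR_ge0 ?(ltW t0)//.
    by rewrite ler_wpM2l ?exprn_ge0 ?(ltW t0)// lerXn2r ?nnegrE// ltW.
  by rewrite ler_expR ler_pM// ltW.
pose rem y : C := (expR (t * y) - \sum_(0 <= j < N) (t * y) ^+ j / j`!%:R)%:C.
have rem_meas : cmeasurable `[- a, a] rem.
  pose p : {poly R} := \sum_(0 <= j < N) (t ^+ j / j`!%:R) *: 'X^j.
  have pE y : p.[y] = \sum_(0 <= j < N) (t * y) ^+ j / j`!%:R.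
    rewrite horner_sum; apply: eq_bigr => j _.
    by rewrite hornerZ hornerXn exprMn mulrAC.
  split; apply: measurable_funTS; last exact: measurable_cst.
  rewrite (_ : _ \o _ = fun y => expR (t * y) - p.[y]); last by apply/funext => y; rewrite /= pE.
  apply: measurable_funB; last exact: measurable_horner.
  by apply: measurableT_comp => //; exact: measurable_funM.
have Irem : cintegrable `[- a, a] (fun y => K x y * rem y).
  by apply: (@square_integrable_mul _ _ (ce * t ^+ N)) => // y ya; rewrite norm1C Ebound.
have sumE : cintegral `[- a, a] (fun y => K x y * cexp (t%:C * y%:C)) =
    cintegral `[- a, a] (fun y => K x y * rem y) +
    \sum_(0 <= j < N) (t ^+ j)%:C * ((j`!%:R^-1)%:C * cintegral `[- a, a] (fun y => K x y * (y ^+ j)%:C)).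
  have Is j : cintegrable `[- a, a] (fun y => ((t ^+ j)%:C * (j`!%:R^-1)%:C) * (K x y * (y ^+ j)%:C)).
    exact: cintegrableZ.
  have [I1 I2] := cintegrable_sum (measurable_itv _) N Is.
  have -> : \sum_(0 <= j < N) (t ^+ j)%:C * ((j`!%:R^-1)%:C * cintegral `[- a, a] (fun y => K x y * (y ^+ j)%:C)) =
      cintegral `[- a, a] (fun y => \sum_(0 <= j < N) ((t ^+ j)%:C * (j`!%:R^-1)%:C) * (K x y * (y ^+ j)%:C)).
    by rewrite I2; apply: eq_bigr => j _; rewrite cintegralZ// mulrA.
  rewrite -cintegralD//; apply: eq_cintegral => y _.
  rewrite -rmorphM cexp_real /rem rmorphB/= mulrBr rmorph_sum/= mulr_sumr.
  rewrite [X in _ - X](eq_bigr (fun j => (t ^+ j)%:C * (j`!%:R^-1)%:C * (K x y * (y ^+ j)%:C))) ?subrK//.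
  by move=> j _; rewrite exprMn !rmorphM/=; ring.
(* The representation of v x through K cancels the full functions, and only the three remainders of
   order t^N survive. *)
have -> : \sum_(0 <= j < N) (t ^+ j)%:C * d j =
    - (v x - \sum_(0 <= j < N) (t ^+ j)%:C * (f x * (spps f j).1 x)) +
    rem x + csign x * cintegral `[- a, a] (fun y => K x y * rem y).
  have -> : \sum_(0 <= j < N) (t ^+ j)%:C * d j =
      \sum_(0 <= j < N) (t ^+ j)%:C * (f x * (spps f j).1 x) -
      \sum_(0 <= j < N) ((t * x) ^+ j / j`!%:R)%:C -
      csign x * \sum_(0 <= j < N) (t ^+ j)%:C * ((j`!%:R^-1)%:C * cintegral `[- a, a] (fun y => K x y * (y ^+ j)%:C)).
    rewrite mulr_sumr -!sumrB; apply: eq_bigr => j _; rewrite /d /m.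
    by rewrite exprMn !rmorphM/=; ring.
  rewrite vE ointegral_sym sumE -rmorphM cexp_real /rem rmorphB/= rmorph_sum/=.
  ring.
rewrite mulrDl mulrDl; apply: le_trans (norm1D _ _) _; apply: lerD.
  apply: le_trans (norm1D _ _) _; apply: lerD; first by rewrite norm1N Hv.
  by rewrite norm1C Ebound// -ler_norml.
have -> : ce * T * t ^+ N = (ce * t ^+ N) * T by ring.
have nc z : norm1 (csign x * z) = norm1 z.
  by rewrite /csign; case: ifP => _; rewrite ?mul1r ?mulN1r ?norm1N.
rewrite nc /T -RintegralZl//; last by exact: norm1_integrable.
apply: norm1_cintegral_le => //.
  by apply: integrable_EFinZ => //; exact: norm1_integrable.
move=> y; rewrite /= in_itv/= => ya; apply: le_trans (norm1M _ _) _.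
by rewrite mulrC ler_wpM2r ?norm1_ge0// norm1C Ebound.
Qed.

End FormalMoments.

Theorem mainTheorem1 (R : realType) (b : R) (b_gt0 : 0 < b)
    (q : (R -> R) -> R[i]) (Q : R -> R[i]) (qQ : W2m1_primitive b q Q)
    (K : R -> R -> R[i]) (hK : transmutation_kernel b Q K)
    (u : R[i] -> R -> R[i])
    (hu : forall omega : R[i],
       solves_ivp b Q (- omega ^+ 2) (u omega) 1 ('i%C * omega))
    (H : nat -> {poly R}) (hH : hermite_polynomials H) :
  exists c : nat -> R -> R[i],
  [/\
    (* the series converges in L_2(R; e^{y^2} dy) for each x *)
    [/\ forall x : R,
          (fun N => \int[lebesgue_measure]_(y in [set: R])
             ((Normc.normc (extended_kernel b K x y -
                 \sum_(0 <= n < N.+1)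
                    c n x * (((H n).[y] * expR (- y ^+ 2))%:C))) ^+ 2
              * expR (y ^+ 2))%:E)%E @ \oo --> 0%E,
        forall (x : R) (n : nat),
          cintegral [set: R]
            (fun y => extended_kernel b K x y * ((H n).[y])%:C) =
          (Num.sqrt pi * n`!%:R * 2 ^+ n)%:C * c n x,
        forall (x : R) (n : nat), - b <= x <= b ->
          c n x = ((Num.sqrt pi * n`!%:R * 2 ^+ n)%:C)^-1 *
                  ointegral (- x) x (fun y => K x y * ((H n).[y])%:C) &
        forall f : R -> R[i],
          solves_ivp b Q 0 f 1 0 ->
          (forall s : R, - b <= s <= b -> f s != 0) ->
          forall (x : R) (n : nat), - b <= x <= b ->
          c n x = ((Num.sqrt pi * n`!%:R * 2 ^+ n)%:C)^-1 *
                  \sum_(0 <= k < n.+1)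
                     ((H n)`_k)%:C * (formal_power f k x - x%:C ^+ k)],
    forall (omega : R[i]) (x : R), - b <= x <= b ->
    [/\ u omega x = cexp ('i%C * omega * x%:C) +
          cintegral [set: R]
            (fun y => extended_kernel b K x y * cexp ('i%C * omega * y%:C)),
        ccvg (fun N => cexp ('i%C * omega * x%:C) +
            \sum_(0 <= n < N.+1) c n x *
              cintegral [set: R]
                (fun y => ((H n).[y])%:C * cexp ('i%C * omega * y%:C)
                          * (expR (- y ^+ 2))%:C))
          (u omega x) &
        ccvg (fun N => cexp ('i%C * omega * x%:C) +
            (Num.sqrt pi)%:C * cexp (- omega ^+ 2 / 4) *
              \sum_(0 <= n < N.+1) c n x * ('i%C * omega) ^+ n)
          (u omega x)] &
    (exists eps : nat -> R -> R,
       (forall N x, 0 <= eps N x) /\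
       forall (N : nat) (omega : R[i]) (x : R), - b <= x <= b ->
         Normc.normc (u omega x - u_partial c N omega x) <=
         pi `^ (4^-1) * expR (complex.Im omega ^+ 2 / 2) * eps N x) /\
    (forall (N : nat) (x : R), - b <= x <= b -> forall C : R,
       exists M : R, forall omega : R[i], `|complex.Im omega| <= C ->
         Normc.normc (u omega x - u_partial c N omega x) <= M)].
Proof.
have HE := hermite_herm hH; subst H.
have sK x : - b <= x <= b -> square_integrable `[- `|x|, `|x|] (K x).
  by move=> xb; have [] := hK _ xb.
have hN0 n : (hermite_norm n : R)%:C != 0 by rewrite fmorph_eq0 gt_eqF// hermite_norm_gt0.
have cE3 x n : - b <= x <= b -> coef b K n x = ((hermite_norm n)%:C)^-1 *
    ointegral (- x) x (fun y => K x y * ((herm n).[y])%:C).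
  move=> xb; have [B HB] := horner_bounded (herm n) `|x|.
  rewrite /coef (extended_integral xb (sK x xb) (horner_cmeasurable _ _) HB)//.
have uE om x : - b <= x <= b -> u om x = cexp ('i%C * om * x%:C) +
    cintegral [set: R] (fun y => extended_kernel b K x y * cexp ('i%C * om * y%:C)).
  move=> xb; have [_ /(_ om (u om) (hu om)) ->] := hK _ xb; congr (_ + _).
  rewrite (extended_integral xb (sK x xb) (cexp_cmeasurable _ (measurable_itv _))
    (fun y => @cexp_bounded _ _ _ y))//.
have z2 (om : R[i]) : - om ^+ 2 = ('i%C * om) ^+ 2.
  have ii : ('i%C : R[i]) * 'i%C = -1 by apply: complex_ext; rewrite ?cReM ?cImM /=; ring.
  by rewrite [RHS]expr2 mulrACA ii mulN1r expr2.
have err N om x : - b <= x <= b ->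
    norm1 (u om x - u_partial (coef b K) N om x) <=
    pi `^ (4^-1) * expR (complex.Im om ^+ 2 / 2) * eps b K N x.
  move=> xb; have := fourier_error sK N x ('i%C * om).
  (* For z = i omega, Re z = - Im omega: only the imaginary part of omega enters the bound. *)
  rewrite Re_iM sqrrN; congr (norm1 _ <= _).
  by rewrite uE// /u_partial z2; ring.
have errn N om x : - b <= x <= b ->
    Normc.normc (u om x - u_partial (coef b K) N om x) <=
    pi `^ (4^-1) * expR (complex.Im om ^+ 2 / 2) * eps b K N x.
  by move=> xb; exact: le_trans (normc_le_n1 _) (err N om x xb).
have cvgu om x : - b <= x <= b -> ccvg (fun N => u_partial (coef b K) N om x) (u om x).
  move=> xb; apply: ccvg_n1.
  apply: (@squeeze_cvgr _ _ _ _ (cst 0)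
    (fun N => pi `^ (4^-1) * expR (complex.Im om ^+ 2 / 2) * eps b K N x)).
  - by apply: nearW => N; rewrite /= norm1_ge0 err.
  - exact: cvg_cst.
  - rewrite -(mulr0 (pi `^ (4^-1) * expR (complex.Im om ^+ 2 / 2))).
    by apply: cvgM; [exact: cvg_cst|exact: eps_cvg].
exists (coef b K); split; [split| |split].
- by move=> x; exact: kernel_expansion.
- by move=> x n; apply/esym; exact: (mulVKf (hN0 n)).
- exact: cE3.
- move=> f hf fn0 x n xb; rewrite cE3//; congr (_ * _).
  have sn := (@size_lead_herm R n).1.
  have [sKx _] := hK x xb.
  have I0 j : cintegrable `[- `|x|, `|x|] (fun y => K x y * (y ^+ j)%:C).
    apply: (@square_integrable_mul _ _ (`|x| ^+ j)) => //.
      exact: pow_cmeasurable.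
    by move=> y; rewrite -ler_norml => ya; rewrite norm1C normrX lerXn2r ?nnegrE.
  have I1 j : cintegrable `[- `|x|, `|x|] (fun y => ((herm n)`_j)%:C * (K x y * (y ^+ j)%:C)).
    by apply: cintegrableZ.
  have [_ I2] := cintegrable_sum (measurable_itv _) n.+1 I1.
  rewrite ointegral_sym.
  (* The Hermite polynomial is split into monomials, whose moments against K are supplied by
     [kernel_moments]. *)
  have -> : cintegral `[- `|x|, `|x|] (fun y => K x y * ((herm n).[y])%:C) =
      cintegral `[- `|x|, `|x|] (fun y => \sum_(0 <= j < n.+1) ((herm n)`_j)%:C * (K x y * (y ^+ j)%:C)).
    apply: eq_cintegral => y _; rewrite horner_coef sn big_mkord rmorph_sum/= mulr_sumr.
    by apply: eq_bigr => j _; rewrite rmorphM/=; ring.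
  rewrite I2 mulr_sumr; apply: eq_bigr => j _.
  rewrite -(kernel_moments b_gt0 hK hf fn0 j xb) ointegral_sym.
  by rewrite (cintegralZ (measurable_itv _) _ (I0 j)) mulrCA.
- move=> om x xb; split; [exact: uE| |exact: cvgu].
  have := cvgu om x xb; congr (ccvg _ _); apply/funext => N.
  rewrite /u_partial mulr_sumr; congr (_ + _); apply: eq_bigr => n _.
  by rewrite cintegral_hermite z2 mulrCA.
- by exists (eps b K); split; [exact: eps_ge0|exact: errn].
- move=> N x xb C; exists (pi `^ (4^-1) * expR (C ^+ 2 / 2) * eps b K N x) => om omC.
  apply: le_trans (errn N om x xb) _.
  rewrite ler_wpM2r ?eps_ge0// ler_wpM2l ?powR_ge0// ler_expR ler_wpM2r//.
  rewrite -real_normK ?num_real// lerXn2r ?nnegrE//.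
  exact: le_trans omC.
Qed.
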